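(* Let $(X_N)_{N\in\mathbb{N}}$ be a self-adjoint random matrix ensemble having a second-order limit distribution, i.e.: (i) for all $m,n\in\mathbb{N}$ the limits $\alpha_n=\lim_{N\to\infty}\frac1N\mathbb{E}(\mathrm{Tr}(X_N^n))$ and $\alpha_{m,n}=\lim_{N\to\infty}\mathrm{Cov}(\mathrm{Tr}(X_N^m),\mathrm{Tr}(X_N^n))$ exist; and (ii) for all $r\ge3$ and all $n_1,\dots,n_r\in\mathbb{N}$, $\lim_{N\to\infty}k_r(\mathrm{Tr}(X_N^{n_1}),\dots,\mathrm{Tr}(X_N^{n_r}))=0$, where $k_r$ is the classical cumulant of order $r$. Suppose moreover that there are constants $M>0$, $K>0$ with (iii) $\lim_{N\to\infty}N^8\,\mathbb{P}(\|X_N\|>M)=0$; and (iv) for all $f\in C^1(\mathbb{R})$ and $N\in\mathbb{N}$, $\mathrm{Var}(\mathrm{Tr}(f(X_N)))\le K\|f'\|_\infty^2$. Let $\rho$ be the associated asymptotic covariance map on $C^1([-M,M])\times C^1([-M,M])$. Then for all $f\in\mathcal{S}$ with $f(\mathbb{R})\subset\mathbb{R}$, $$\mathrm{Tr}(f(X_N))-\mathbb{E}(\mathrm{Tr}(f(X_N)))\Rightarrow\mathcal{N}_{\mathbb{R}}(0,\rho(f|_M,f|_M))\quad\text{as }N\to\infty,$$ where $\Rightarrow$ denotes convergence in distribution.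
   Context: A self-adjoint random matrix ensemble $(X_N)_{N}$ is a sequence in which $X_N$ is an $N\times N$ self-adjoint complex random matrix; all moments $\mathbb{E}(\mathrm{Tr}(X_N^n))$ and joint moments of the random variables $\mathrm{Tr}(X_N^n)$ are assumed finite. $\|X_N\|$ is the operator norm; $\mathrm{Tr}$ is the unnormalized trace; $\mathrm{Tr}(f(X_N))=\sum_k f(\lambda_k)$, with $\lambda_1,\dots,\lambda_N$ the eigenvalues of $X_N$. $\mathrm{Cov}(X,Y)=\mathbb{E}(XY)-\mathbb{E}(X)\mathbb{E}(Y)$ (no complex conjugation) and $\mathrm{Var}(X)=\mathbb{E}|X-\mathbb{E}X|^2$ for complex random variables. $\mathcal{N}_{\mathbb{R}}(\mu,\sigma^2)$ is the real Gaussian distribution with mean $\mu$ and variance $\sigma^2$ (a point mass at $\mu$ if $\sigma^2=0$). $C^1(\mathbb{R})$ is the space of complex-valued functions on $\mathbb{R}$ with continuous derivative; $f|_M$ is the restriction of $f$ to $[-M,M]$; $C^1([-M,M])=\{f|_M:f\in C^1(\mathbb{R})\}$; $\|h\|_M=\sup_{|x|\le M}|h(x)|$; $\|h\|_\infty=\sup_{x\in\mathbb{R}}|h(x)|$. $\mathcal{S}=\{f\in C^1(\mathbb{R}):f\text{ is polynomially bounded}\}$. The asymptotic covariance map $\rho:C^1([-M,M])\times C^1([-M,M])\to\mathbb{C}$ is the unique bilinear map such that $\rho(x^m,x^n)=\alpha_{m,n}$ for $m,n\ge1$, $\rho(1,f)=\rho(f,1)=0$ for all $f$, and $|\rho(f,g)|\le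 K\|f'\|_M\|g'\|_M$ for all $f,g\in C^1([-M,M])$ (obtained by continuous extension from polynomials, which are dense). *)

(* Defs.v *)
(* MathComp-Analysis, with complex numbers R[i] from mathcomp-real-closed. *)
From HB Require Import structures.
From mathcomp Require Import all_boot all_order all_algebra.
From mathcomp Require Import complex.
From mathcomp Require Import all_classical all_reals all_analysis.

Set Implicit Arguments.
Unset Strict Implicit.
Unset Printing Implicit Defensive.

Import Order.TTheory GRing.Theory Num.Theory.
Import numFieldNormedType.Exports.

Local Open Scope classical_set_scope.
Local Open Scope ring_scope.
Local Open Scope complex_scope.

Local Notation Re := complex.Re.
Local Notation Im := complex.Im.
Local Notation normc := ComplexField.Normc.normc.

(* Convergence of complex sequences uses the norm topology of R[i], which the
   library attaches to the regular module R[i]^o. *)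
Definition ccvg (R : realType) (u : nat -> R[i]) (l : R[i]) : Prop :=
  (u : nat -> R[i]^o) @ \oo --> (l : R[i]^o).

Section ComplexRandomVariables.
Context (d : measure_display) (T : measurableType d) (R : realType).
Variable P : probability T R.

Definition cmeasurable (Z : T -> R[i]) : Prop :=
  measurable_fun [set: T] (fun w => Re (Z w)) /\
  measurable_fun [set: T] (fun w => Im (Z w)).

Definition cintegrable (Z : T -> R[i]) : Prop :=
  P.-integrable [set: T] (fun w => (Re (Z w))%:E) /\
  P.-integrable [set: T] (fun w => (Im (Z w))%:E).

(* Only meaningful when Z is integrable. *)
Definition cexpectation (Z : T -> R[i]) : R[i] :=
  fine ('E_P[fun w => Re (Z w)])%E +i* fine ('E_P[fun w => Im (Z w)])%E.

(* No complex conjugation. *)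
Definition ccovariance (Z W : T -> R[i]) : R[i] :=
  cexpectation (fun w => Z w * W w) - cexpectation Z * cexpectation W.

Definition cvariance (Z : T -> R[i]) : \bar R :=
  'E_P[(fun w => normc (Z w - cexpectation Z) ^+ 2)%R]%E.

(* Moment-cumulant formula: the sum ranges over the set partitions p of
   {0, ..., r - 1}. *)
Definition ccumulant (r : nat) (Y : 'I_r -> T -> R[i]) : R[i] :=
  \sum_(p : {set {set 'I_r}} | finset.partition p [set: 'I_r]%SET)
    (-1) ^+ (#|p|.-1) * (#|p|.-1)`!%:R *
    \prod_(B in p) cexpectation (fun w => \prod_(i in B) Y i w).

End ComplexRandomVariables.

Section Matrices.
Context (R : realType).

Definition l2norm (n : nat) (v : 'cV[R[i]]_n) : R :=
  Num.sqrt (\sum_(i < n) normc (v i 0) ^+ 2).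

Definition opnorm (n : nat) (A : 'M[R[i]]_n) : R :=
  sup [set l2norm (A *m v) | v in [set v : 'cV[R[i]]_n | l2norm v <= 1]].

(* Tr (f A) for self-adjoint A: spectral_diag A lists the eigenvalues of A with
   multiplicity; they are real, so taking Re loses nothing. *)
Definition trace_fun (n : nat) (f : R -> R[i]) (A : 'M[R[i]]_n) : R[i] :=
  \sum_(k < n) f (Re (spectral_diag A 0 k)).

Definition trace_pow (n : nat) (k : nat) (A : 'M[R[i]]_n) : R[i] :=
  \tr (A ^+ k).

End Matrices.

Section FunctionSpaces.
Context (R : realType).

Definition cderive (f : R -> R[i]) : R -> R[i] :=
  fun x => derive1 (fun t => Re (f t)) x +i* derive1 (fun t => Im (f t)) x.

Definition is_C1 (f : R -> R[i]) : Prop :=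
  [/\ forall x, derivable (fun t => Re (f t)) x 1,
      forall x, derivable (fun t => Im (f t)) x 1,
      continuous (fun x => Re (cderive f x)) &
      continuous (fun x => Im (cderive f x))].

Definition polynomially_bounded (f : R -> R[i]) : Prop :=
  exists (c : R) (k : nat), forall x, normc (f x) <= c * (1 + `|x|) ^+ k.

(* The supremum of |h| over D, possibly +oo. *)
Definition supnorm (D : set R) (h : R -> R[i]) : \bar R :=
  ereal_sup [set (normc (h x))%:E | x in D].

End FunctionSpaces.

Section Ensembles.
Context (R : realType) (d : nat -> measure_display).
Context (T : forall N, measurableType (d N)).
Variables (P : forall N, probability (T N) R).
Variable (X : forall N, T N -> 'M[R[i]]_N).

(* The index N = 0 (the empty matrix) is allowed: it satisfies every requirement
   below trivially. *)
Definition self_adjoint_ensemble : Prop :=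
  [/\ forall N (i j : 'I_N), cmeasurable (fun w => X w i j),
      forall N (w : T N), X w \is hermsymmx &
      forall N (s : seq nat),
        cintegrable (P N) (fun w => \prod_(n <- s) trace_pow n (X w))].

Definition second_order_limit (alpha1 : nat -> R[i])
    (alpha2 : nat -> nat -> R[i]) : Prop :=
  [/\ forall n, (0 < n)%N ->
        ccvg (fun N => N%:R^-1 *
          cexpectation (P N) (fun w => trace_pow n (X w))) (alpha1 n),
      forall m n, (0 < m)%N -> (0 < n)%N ->
        ccvg (fun N => ccovariance (P N) (fun w => trace_pow m (X w))
          (fun w => trace_pow n (X w))) (alpha2 m n) &
      forall (r : nat) (n : 'I_r -> nat), (3 <= r)%N ->
        (forall i, (0 < n i)%N) ->
        ccvg (fun N => ccumulant (P N)
          (fun i w => trace_pow (n i) (X w))) 0].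

Definition norm_tail_bound (M : R) : Prop :=
  ((N%:R ^+ 8)%:E * P N [set w | M < opnorm (X w)]%R)%E @[N --> \oo] --> 0%E.

Definition variance_bound (K : R) : Prop :=
  forall (f : R -> R[i]) (N : nat), is_C1 f ->
    (cvariance (P N) (fun w => trace_fun f (X w)) <=
     K%:E * supnorm [set: R] (cderive f) ^+ 2)%E.

End Ensembles.

Definition seg (R : realType) (M : R) : set R := `[- M, M].

(* Functions on [-M, M] are functions on the corresponding sigma-type. *)
Definition fun_on (R : realType) (M : R) : Type :=
  set_type (seg M) -> R[i].

Definition restr (R : realType) (M : R) (f : R -> R[i]) : fun_on M :=
  sigL (seg M) f.
Arguments restr {R} M f.

Section AsymptoticCovariance.
Context (R : realType).

Definition C1_on (M : R) (h : fun_on M) : Prop :=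
  exists2 f : R -> R[i], is_C1 f & h = restr M f.

(* The values of rho outside of C1_on M are irrelevant. *)
Definition asymptotic_covariance (M K : R) (alpha2 : nat -> nat -> R[i])
    (rho : fun_on M -> fun_on M -> R[i]) : Prop :=
  [/\ forall (a : R[i]) (f g h : fun_on M),
        C1_on f -> C1_on g -> C1_on h ->
        rho (fun x => a * f x + g x) h = a * rho f h + rho g h /\
        rho h (fun x => a * f x + g x) = a * rho h f + rho h g,
      forall m n, (0 < m)%N -> (0 < n)%N ->
        rho (restr M (fun x => x%:C ^+ m)) (restr M (fun x => x%:C ^+ n)) =
        alpha2 m n,
      forall f : fun_on M, C1_on f ->
        rho (restr M (fun=> 1)) f = 0 /\ rho f (restr M (fun=> 1)) = 0 &
      forall f g : R -> R[i], is_C1 f -> is_C1 g ->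
        ((normc (rho (restr M f) (restr M g)))%:E <=
         K%:E * supnorm (seg M) (cderive f)
              * supnorm (seg M) (cderive g))%E].

End AsymptoticCovariance.

(* The real Gaussian law with mean m and variance v >= 0.  normal_prob takes the
   standard deviation and is not a point mass when the latter is 0. *)
Definition gaussian (R : realType) (m v : R) : set (measurableTypeR R) -> \bar R :=
  if v == 0 then \d_m else normal_prob m (Num.sqrt v).

(* Convergence in distribution of real random variables Y N, each defined on its
   own probability space, to the law mu. *)
Definition cvg_in_distribution (R : realType) (d : nat -> measure_display)
    (T : forall N, measurableType (d N)) (P : forall N, probability (T N) R)
    (Y : forall N, T N -> R) (mu : set (measurableTypeR R) -> \bar R) : Prop :=
  (forall N, measurable_fun [set: T N] (Y N)) /\
  forall g : R -> R, continuous g -> (exists c : R, forall x : R, `|g x| <= c) ->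
    ('E_(P N)[fun w => g (Y N w)])%E @[N --> \oo] -->
    (\int[mu]_x (g x)%:E)%E.

(* Main.v *)
(* Near [-M, M], f is a polynomial p plus a function h with |h'| <= e.  Since
   cumulants are multilinear, all cumulants of order >= 3 of Tr p(X_N) tend to 0, so
   its central moments tend to Gaussian ones; with Taylor's formula this gives the
   limits of E cos(t Y) and E sin(t Y), Y being the centred Tr p(X_N).  The C^1
   function extending h linearly outside of [-M, M] has a trace of variance at most
   K e^2; it differs from h only if the norm of X_N exceeds M, an event whose
   contribution to E |Tr h(X_N)| vanishes by the N^8 tail bound and E Tr(X_N^k)^2 =
   O(N^2).  Hence E cos(t Y) and E sin(t Y) converge for f too.  Finally a bounded
   continuous function is, up to a term controlled by E |Y|, a polynomial in
   sin(c Y), that is, a trigonometric polynomial, so Y converges in distribution. *)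
Require Import Defs.
From HB Require Import structures.
From mathcomp Require Import all_boot all_order all_algebra.
From mathcomp Require Import complex.
From mathcomp Require Import all_classical all_reals all_analysis.
From mathcomp Require Import measurable_realfun.
From mathcomp Require Import ring lra.

Set Implicit Arguments.
Unset Strict Implicit.
Unset Printing Implicit Defensive.

Import Order.TTheory GRing.Theory Num.Theory.
Import numFieldNormedType.Exports.

Local Open Scope classical_set_scope.
Local Open Scope ring_scope.
Local Open Scope complex_scope.

Local Notation Re := complex.Re.
Local Notation Im := complex.Im.

(** The variance bound (iv) and the bound on [rho] see a function only through its derivative, and
    centring removes additive constants. Hence f' is what gets approximated, by the derivative of a
    polynomial without constant term, and one such polynomial controls the statistic and the limit
    variance together. The bound (iv) asks for a bounded derivative on the whole line, which f - p
    may lack; this is the reason for the extension. For polynomials there is convergence of all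
    moments, but the statistic of f is close to a polynomial one in L^1 only, so its moments are out
    of reach. Cosine and sine are the meeting point: they are Lipschitz, so L^1 errors pass through
    them, and their means are computed from moments by a Taylor expansion whose remainder vanishes
    because Gaussian moments grow slowly. Nothing says in advance that the limit variance is real
    and nonnegative; this follows since it is approximated by limits of variances of real polynomial
    statistics. The matrices enter through their eigenvalues, and what is given about these concerns
    power sums only, so measurability and integrability are derived from power sums. *)

(** * Uniform approximation by Bernstein polynomials *)

Section Weierstrass.
Context {R : realType}.
Implicit Types (f : R -> R) (F G : nat -> R).

(* [bern n F] is the polynomial in x giving the mean of F (S_n), where S_n is
   binomial with parameters n and x. *)
Fixpoint bern (n : nat) F : {poly R} :=
  if n is n'.+1 then (1 - 'X) * bern n' F + 'X * bern n' (F \o succn)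
  else (F 0%N)%:P.

Lemma bernS n F x :
  (bern n.+1 F).[x] = (1 - x) * (bern n F).[x] + x * (bern n (fun k => F k.+1)).[x].
Proof. by rewrite /= !hornerE. Qed.

Lemma bern_le n F G x : 0 <= x <= 1 ->
  (forall k, (k <= n)%N -> F k <= G k) -> (bern n F).[x] <= (bern n G).[x].
Proof.
move=> /andP[x0 x1]; elim: n F G => [|n IH] F G FG.
  by rewrite /= !hornerC FG.
rewrite !bernS lerD// ler_wpM2l ?subr_ge0//; apply: IH => k kn; apply: FG => //.
exact: leqW.
Qed.

Lemma bern_affine n F G a x :
  (bern n (fun k => a * F k + G k)).[x] = a * (bern n F).[x] + (bern n G).[x].
Proof.
elim: n F G => [|n IH] F G; first by rewrite /= !hornerE.
by rewrite !bernS !IH; ring.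
Qed.

Lemma bern_cst n a x : (bern n (fun=> a)).[x] = a.
Proof.
elim: n => [|n IH]; first by rewrite /= hornerE.
by rewrite bernS !IH; ring.
Qed.

(** Binomial variance plus squared bias. With [c = n%:R * x] the bias vanishes, and after division
    by n^2 the rest is of order 1/n. *)
Lemma bern_var n c x : (bern n (fun k => (k%:R - c) ^+ 2)).[x] =
  n%:R * x * (1 - x) + (n%:R * x - c) ^+ 2.
Proof.
elim: n c => [|n IH] c; first by rewrite /= hornerE; ring.
rewrite bernS (_ : (fun k => (k.+1%:R - c) ^+ 2) = fun k => (k%:R - (c - 1)) ^+ 2); last first.
  by apply/funext => k /=; congr (_ ^+ 2); rewrite -natr1; ring.
by rewrite !IH -natr1; ring.
Qed.

(** Heine-Cantor. If it fails there are pairs [u n] at distance below 1/(n+1) whose images stay [e]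
    apart. By continuity each point of the segment has a neighbourhood that contains no [(u n).1]
    for large n; compactness makes this uniform, so some [(u N).1] would lie nowhere in the
    segment. *)
Lemma within_itv_unif f (a b e : R) : 0 < e -> {within `[a, b], continuous f} ->
  exists2 d : R, 0 < d &
    {in `[a, b] &, forall x y, `|x - y| < d -> `|f x - f y| < e}.
Proof.
move=> e0 cf; apply: contrapT => H.
have bad n : exists xy : R * R, [/\ xy.1 \in `[a, b], xy.2 \in `[a, b],
    `|xy.1 - xy.2| < n.+1%:R^-1 & e <= `|f xy.1 - f xy.2|].
  apply: contrapT => Hn; apply: H; exists n.+1%:R^-1 => // x y xab yab xy.
  rewrite ltNge; apply/negP => fxy; apply: Hn; by exists (x, y).
have [u Hu] := choice bad.
have := @segment_compact R a b => /compact_near_coveringP.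
move=> /(_ nat (nbhs \oo) (fun n y => ~ (y = (u n).1)) _).
have Hloc : forall x, [set` `[a, b]] x -> \forall x' \near x & i \near \oo,
   (fun n y => ~ (y = (u n).1)) i x'.
  move=> x xab.
  have := cf x; rewrite /continuous_at /prop_for /from_subspace /=.
  move=> /cvgrPdist_lt /(_ (e / 2)); rewrite divr_gt0// => /(_ isT).
  rewrite /nbhs/= -nbhs_subspace_in//= near_withinE.
  move=> /nbhs_ballP[d /= d0 Hd].
  have [N HN] : exists N, forall n, (N <= n)%N -> n.+1%:R^-1 < d / 2.
    have d20 : 0 < d / 2 by rewrite divr_gt0.
    have [N _ HN] := near_infty_natSinv_lt (PosNum d20); by exists N => n Nn; exact: HN.
  exists (ball x (d / 2), [set n | (N <= n)%N]).
    split=> /=; first by apply: nbhsx_ballx; rewrite divr_gt0.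
    by exists N.
  move=> [y n] /= [xy Nn] yu; subst y.
  have [H1 H2 H3 H4] := Hu n.
  have Hn := HN n Nn.
  have D2 : ball x d (u n).2 by apply: ball_split xy _; exact: lt_trans H3 Hn.
  have D1 : ball x d (u n).1.
    by apply: le_ball xy; lra.
  have /= E1 := Hd _ D1 H1; have /= E2 := Hd _ D2 H2.
  have := ler_distD (f x) (f (u n).1) (f (u n).2).
  rewrite [in X in _ <= X + _]distrC; lra.
move=> /(_ Hloc)[N _ /(_ N (leqnn N))].
have [H1 _ _ _] := Hu N; by move=> /(_ (u N).1 H1).
Qed.

Lemma weierstrass01 f (e : R) : 0 < e -> {within `[0, 1], continuous f} ->
  exists p : {poly R}, forall x : R, 0 <= x <= 1 -> `|f x - p.[x]| <= e.
Proof.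
move=> e0 cf.
have e20 : 0 < e / 2 by rewrite divr_gt0.
have [d d0 Hd] := within_itv_unif e20 cf.
have [C C0 HC] : exists2 C : R, 0 <= C & forall x : R, 0 <= x <= 1 -> `|f x| <= C.
  have [c1 _ H1] := EVT_max (@ler01 R) cf.
  have [c2 _ H2] := EVT_min (@ler01 R) cf.
  exists (`|f c1| + `|f c2|) => [|x x01]; first by rewrite addr_ge0.
  have := H1 x; have := H2 x; rewrite in_itv/= => /(_ x01) A /(_ x01) B.
  have := ler_norm (f c1); have := ler_norm (- f c2); rewrite normrN ler_norml.
  have := normr_ge0 (f c1); have := normr_ge0 (f c2); lra.
(* With this [A], the parabola [A * (y - x) ^+ 2] exceeds the largest possible oscillation [2 * C]
   as soon as [y] is at distance at least [d] from [x]. This is Chebyshev's inequality in pointwise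
   form. *)
pose A := 2 * C / d ^+ 2.
have A0 : 0 <= A by apply: divr_ge0; [exact: mulr_ge0|exact: sqr_ge0].
have [n n0 Hn] : exists2 n : nat, (0 < n)%N & A / n%:R <= e / 2.
  have : 0 <= A / (e / 2) by rewrite divr_ge0// ltW.
  move=> /archi_boundP; set n := Num.bound _ => Hn.
  have n0 : 0 < n%:R :> R by apply: le_lt_trans Hn; rewrite divr_ge0// ltW.
  exists n; first by rewrite -(ltr0n R).
  by rewrite ler_pdivrMr// mulrC -ler_pdivrMr// ltW.
have nR0 : 0 < n%:R :> R by rewrite ltr0n.
exists (bern n (fun k => f (k%:R / n%:R))) => x x01.
(* For s = 1 and s = -1, an upper and a lower bound of the samples of [f]. Both are quadratic in
   [k], so their Bernstein means are explicit by [bern_var]. *)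
pose G s k : R := s * (A / n%:R ^+ 2 * (k%:R - n%:R * x) ^+ 2 + e / 2) + f x.
have EG s : (bern n (G s)).[x] = s * (A / n%:R * (x * (1 - x)) + e / 2) + f x.
  rewrite /G bern_affine bern_cst bern_affine bern_cst bern_var; congr (s * (_ + _) + _).
  by rewrite subrr expr0n addr0 expr2 invfM; field; rewrite gt_eqF.
have B : A / n%:R * (x * (1 - x)) + e / 2 <= e.
  have : A / n%:R * (x * (1 - x)) <= A / n%:R * 1.
    apply: ler_wpM2l; first by rewrite divr_ge0// ltW.
    have /andP[] := x01; nra.
  lra.
have main k : (k <= n)%N ->
    `|f (k%:R / n%:R) - f x| <= A / n%:R ^+ 2 * (k%:R - n%:R * x) ^+ 2 + e / 2.
  move=> kn; set y := k%:R / n%:R.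
  have y01 : 0 <= y <= 1.
    by rewrite divr_ge0//= ler_pdivrMr// mul1r ler_nat.
  have -> : A / n%:R ^+ 2 * (k%:R - n%:R * x) ^+ 2 = A * (y - x) ^+ 2.
    by rewrite /y; field; rewrite gt_eqF.
  have [yx|yx] := ltP `|y - x| d.
    have := Hd y x; rewrite !in_itv/= => /(_ y01 x01 yx).
    have := mulr_ge0 A0 (sqr_ge0 (y - x)); lra.
  have H : 2 * C <= A * (y - x) ^+ 2.
    rewrite /A mulrAC ler_pdivlMr ?exprn_gt0//.
    by rewrite ler_wpM2l ?mulr_ge0// -[leRHS]real_normK ?num_real// ler_sqr ?nnegrE// ltW.
  have := ler_normB (f y) (f x); have := HC _ y01; have := HC _ x01; lra.
rewrite ler_norml; apply/andP; split.
- have : (bern n (fun k => f (k%:R / n%:R))).[x] <= (bern n (G 1)).[x].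
    apply: bern_le => // k kn; rewrite /G mul1r; have := main k kn.
    by rewrite ler_norml; lra.
  rewrite EG; lra.
- have : (bern n (G (-1))).[x] <= (bern n (fun k => f (k%:R / n%:R))).[x].
    apply: bern_le => // k kn; rewrite /G; have := main k kn.
    by rewrite ler_norml; lra.
  rewrite EG; lra.
Qed.

Lemma weierstrass f (L e : R) : 0 < L -> 0 < e -> continuous f ->
  exists p : {poly R}, forall x : R, `|x| <= L -> `|f x - p.[x]| <= e.
Proof.
move=> L0 e0 cf.
have [//||p Hp] := @weierstrass01 (fun u => f (2 * L * u - L)) e.
  apply: continuous_subspaceT => x.
  apply: (@continuous_comp R R R (fun u : R => 2 * L * u - L) f) => //.
  by apply: cvgB; [apply: cvgM; [exact: cvg_cst|exact: cvg_id]|exact: cvg_cst].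
  exact: cf.
exists (p \Po ((2 * L)^-1 *: ('X + L%:P))) => x; rewrite ler_norml => /andP[x1 x2].
rewrite horner_comp !hornerE.
have -> : f x = f (2 * L * ((2 * L)^-1 * (x + L)) - L).
  by congr f; field; rewrite gt_eqF.
apply: Hp; rewrite mulrC ler_pdivlMr ?mulr_gt0// ler_pdivrMr ?mulr_gt0//; lra.
Qed.

End Weierstrass.

(** * Joint cumulants and the moment-cumulant recursion *)

Section Cumulants.
Context {A : comNzRingType}.

(* The joint cumulant of the variables indexed by D, where m B is the expectation
   of the product of those indexed by B. *)
Definition pcum (I : finType) (m : {set I} -> A) (D : {set I}) : A :=
  \sum_(p : {set {set I}} | finset.partition p D)
    (-1) ^+ (#|p|.-1) * (#|p|.-1)`!%:R * \prod_(B in p) m B.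

(* (C, p) |-> C |: p is a bijection onto the pairs of a partition of D and one of
   its blocks avoiding x. *)
Lemma partition_pointed (I : finType) (m : {set I} -> A) (D : {set I}) x
    (w : nat -> A) : x \in D ->
  \sum_(C : {set I} | (C \subset D :\ x)%SET && (C != finset.set0)) m C *
     (\sum_(p | finset.partition p (D :\: C)%SET) w #|p| * \prod_(B in p) m B) =
  \sum_(p | finset.partition p D) (w (#|p|.-1) * \prod_(B in p) m B) *+ (#|p|.-1).
Proof.
move=> xD.
(* Double counting: a partition of [D] has [#|p|.-1] blocks besides the one containing [x]. *)
transitivity (\sum_(p | finset.partition p D)
   \sum_(C in p | x \notin C) w (#|p|.-1) * \prod_(B in p) m B); last first.
  apply: eq_bigr => p pD; rewrite sumr_const; congr (_ *+ _).
  have xp : x \in finset.cover p by rewrite (cover_partition pD).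
  rewrite (cardsD1 (finset.pblock p x) p) finset.pblock_mem//=.
  apply: eq_card => C; rewrite [LHS]unfold_in /= !inE.
  case Cp : (C \in p); rewrite ?andbF//= andbT.
  apply/idP/idP; first by apply: contraNN => /eqP ->; rewrite finset.mem_pblock.
  apply: contraNN => xC; apply/eqP; symmetry.
  exact: finset.def_pblock (partition_trivIset pD) Cp xC.
rewrite (exchange_big_dep (fun C : {set I} =>
  (C \subset D :\ x)%SET && (C != finset.set0))) /=; last first.
  move=> p C pD /andP[Cp xC]; rewrite (partition_neq0 pD Cp) andbT.
  by rewrite subsetD1 (partitionS pD Cp).
apply: eq_bigr => C /andP[]; rewrite subsetD1 => /andP[CD xC] C0.
have Cnot p : finset.partition p (D :\: C)%SET -> C \notin p.
  have /set0Pn[y yC] := C0.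
  by move=> pD; apply/negP => /(partitionS pD)/fintype.subsetP/(_ y yC); rewrite inE yC.
rewrite [RHS](reindex_onto (fun p => C |: p)%SET (fun p => p :\ C)%SET) /=; last first.
  by move=> p /andP[_ /andP[Cp _]]; rewrite finset.setD1K.
rewrite big_distrr /=; apply: eq_big => [p|p pD].
- apply/idP/idP => [pD|].
    rewrite setU11 xC andbT andbT; apply/andP; split; last first.
      by rewrite finset.setU1K// Cnot.
    have DC : (C :|: (D :\: C))%SET = D.
      by apply/setP => y; rewrite !inE; case yC : (y \in C) => //; rewrite (fintype.subsetP CD).
    rewrite -[X in finset.partition _ X]DC; apply: partitionU1 => //.
    by rewrite finset.disjoints_subset; apply/fintype.subsetP => y; rewrite !inE => ->.
  move=> /andP[/andP[pD _] /eqP E].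
  by rewrite -E; apply: partitionD1 => //; rewrite setU11.
- have Cp := Cnot _ pD; rewrite cardsU1 Cp /= big_setU1//=.
  by rewrite mulrCA.
Qed.

(** By [partition_pointed], a partition with k blocks occurs in the sum with coefficient (k-1) times
    (-1)^(k-2) (k-2)!. For k >= 2 this cancels its coefficient (-1)^(k-1) (k-1)! in [pcum m D], so
    only the one-block partition is left. *)
Lemma pcum_rec (I : finType) (m : {set I} -> A) (D : {set I}) x : x \in D ->
  m D = pcum m D +
    \sum_(C : {set I} | (C \subset D :\ x)%SET && (C != finset.set0))
      m C * pcum m (D :\: C)%SET.
Proof.
move=> xD.
rewrite (partition_pointed m (fun n => (-1) ^+ n.-1 * (n.-1)`!%:R) xD).
rewrite /pcum -big_split /=.
have D0 : D != finset.set0 by apply/set0Pn; exists x.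
have pD : finset.partition [set D]%SET D.
  rewrite /finset.partition /finset.cover big_set1 eqxx finset.trivIset1 /= inE eq_sym.
  exact: D0.
rewrite (bigD1 [set D]%SET) //= [X in _ + X]big1 ?addr0 => [|p /andP[pP pn]].
  by rewrite cards1 /= big_set1 !mul1r mulr0n addr0.
have p0 : (0 < #|p|)%N.
  rewrite card_gt0; apply: contraTneq pP => ->; rewrite /finset.partition.
  by rewrite /finset.cover big_set0 eq_sym (negbTE D0).
have p1 : #|p| != 1%N.
  apply: contraNN pn => /cards1P[B pB]; move: (cover_partition pP).
  by rewrite pB /finset.cover big_set1 => ->.
case: #|p| p0 p1 => // -[//|n] _ _ /=.
by rewrite factS natrM exprS -mulr_natr; ring.
Qed.

Lemma pcum_set0 (I : finType) (m : {set I} -> A) : pcum m finset.set0 = 1.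
Proof.
rewrite /pcum (big_pred1 finset.set0) => [|p]; last by rewrite partition_set0.
by rewrite cards0 big_set0 !mulr1.
Qed.

Lemma sum_subsets_card (I : finType) (D : {set I}) (F : nat -> A) :
  \sum_(C : {set I} | C \subset D) F #|C| = \sum_(c < #|D|.+1) F c *+ 'C(#|D|, c).
Proof.
rewrite (partition_big (fun C : {set I} => inord #|C| : 'I_(#|D|.+1)) predT)//=.
apply: eq_bigr => c _.
rewrite (eq_bigr (fun=> F c)) => [|C /andP[CD /eqP <-]]; last first.
  by rewrite inordK// ltnS subset_leq_card.
rewrite sumr_const -cards_draws; congr (_ *+ _).
apply: eq_card => C; rewrite !inE unfold_in /=; case CD : (C \subset D) => //=.
by rewrite -val_eqE /= inordK// ltnS subset_leq_card.
Qed.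

(** All [r] arguments are the same variable, so the expectation of a block product depends on the
    size of the block alone. *)
Definition ncum (mu : nat -> A) (r : nat) : A :=
  pcum (fun B : {set 'I_r} => mu #|B|) [set: 'I_r]%SET.

(** The terms of [pcum_rec] depend on [C] only through its size, and [C] ranges over the nonempty
    subsets of the [n] elements other than [x]: hence the binomials. [k] stands for the cumulants of
    smaller sets, supplied by the induction in [pcum_card]. *)
Lemma pcum_card_step (mu k : nat -> A) n (I : finType) (D : {set I}) :
  #|D| = n.+1 ->
  (forall E : {set I}, (#|E| <= n)%N -> pcum (fun B : {set I} => mu #|B|) E = k #|E|) ->
  pcum (fun B : {set I} => mu #|B|) D =
    mu n.+1 - \sum_(c < n.+1 | (0 < c)%N) (mu c * k (n.+1 - c)%N) *+ 'C(n, c).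
Proof.
move=> Dn Hk.
have [x xD] : exists x, x \in D by apply/set0Pn; rewrite -card_gt0 Dn.
have Dx : #|(D :\ x)%SET| = n by move: Dn; rewrite (cardsD1 x) xD => -[].
have := pcum_rec (fun B : {set I} => mu #|B|) xD; rewrite Dn => ->.
set S := \sum_(C | _) _; set S' := \sum_(c < _ | _) _.
suff -> : S = S' by rewrite addrK.
transitivity (\sum_(C : {set I} | (C \subset D :\ x)%SET)
   (if (0 < #|C|)%N then mu #|C| * k (n.+1 - #|C|)%N else 0)).
  rewrite [RHS](bigID (fun C : {set I} => C != finset.set0)) /= [X in _ + X]big1; last first.
    by move=> C /andP[_ /negPn/eqP ->]; rewrite cards0.
  rewrite addr0; apply: eq_bigr => C /andP[CD C0]; rewrite card_gt0 C0.
  have CD' : C \subset D by apply: fintype.subset_trans CD (subsetDl _ _).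
  have DC : #|(D :\: C)%SET| = (n.+1 - #|C|)%N by rewrite cardsDS// Dn.
  by rewrite Hk DC// leq_subLR -addn1 addnC leq_add2r card_gt0.
rewrite (sum_subsets_card _ (fun c => if (0 < c)%N then mu c * k (n.+1 - c)%N else 0)) Dx.
rewrite /S' [RHS]big_mkcond /=.
by apply: eq_bigr => c _; case: ifP => //; rewrite mul0rn.
Qed.

(** The induction runs over all finite types at once, because [D] and [[set: 'I_r]] live in
    different types and are compared through the recursion that both satisfy. *)
Lemma pcum_card (mu : nat -> A) (I : finType) (D : {set I}) :
  pcum (fun B : {set I} => mu #|B|) D = ncum mu #|D|.
Proof.
have [n] := ubnP #|D|; elim: n I D => // n IH I D; rewrite ltnS => Dn.
case E : #|D| => [|r].
  move/eqP: E; rewrite cards_eq0 => /eqP ->; rewrite pcum_set0 /ncum.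
  rewrite (_ : [set: 'I_0]%SET = finset.set0) ?pcum_set0//.
  by apply/setP => -[].
have rn : (r < n)%N by rewrite -E.
rewrite (pcum_card_step (k := ncum mu) E) => [|F Fr]; last first.
  by apply: IH; apply: leq_ltn_trans Fr rn.
rewrite /ncum (pcum_card_step (k := ncum mu) (n := r))// ?cardsT ?card_ord// => F Fr.
by apply: IH; apply: leq_ltn_trans Fr rn.
Qed.

(** Here [j.+1] is the size of the block containing a fixed element, so [j] is [n - c] for the [c]
    of [pcum_card_step]. The term [c = 0], absent there, is the cumulant of full order times
    [mu 0 = 1]. *)
Lemma moment_cumulant (mu : nat -> A) n : mu 0%N = 1 ->
  mu n.+1 = \sum_(j < n.+1) (ncum mu j.+1 * mu (n - j)%N) *+ 'C(n, j).
Proof.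
move=> mu0; rewrite (reindex_inj rev_ord_inj) /= (bigD1 ord0)//=.
rewrite subSS subn0 subnn mu0 mulr1 binn mulr1n.
rewrite {1}/ncum (pcum_card_step (k := ncum mu) (n := n)) ?cardsT ?card_ord//; last first.
  by move=> E _; exact: pcum_card.
rewrite -addrA addrC [X in X + _](_ : _ = 0) ?add0r// addrC.
apply/eqP; rewrite subr_eq0; apply/eqP; apply: eq_big => [c|c c0].
  by rewrite lt0n -val_eqE.
have cn : (c <= n)%N by rewrite -ltnS.
by rewrite subSS subKn// bin_sub// mulrC subSn.
Qed.

End Cumulants.

(** * From cumulants to central moments *)

Section CentredMoments.
Context {R : numFieldType}.

Lemma derivn_XsubCX (a : R) n j :
  (('X - a%:P) ^+ n)^`(j) = ('X - a%:P) ^+ (n - j) *+ (n ^_ j).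
Proof.
elim: j => [|j IH]; first by rewrite derivn0 subn0 ffactn0.
rewrite derivnS IH derivMn deriv_exp derivXsubC mul1r -mulrnA ffactnSr.
by rewrite subnS mulnC.
Qed.

Lemma nderivn_XsubCX (a : R) n j :
  (('X - a%:P) ^+ n)^`N(j) = ('X - a%:P) ^+ (n - j) *+ 'C(n, j).
Proof.
apply: (@mulIf _ (j`!%:R)%:P); first by rewrite polyC_eq0 pnatr_eq0 -lt0n fact_gt0.
rewrite polyC_natr !mulr_natr -nderivn_def derivn_XsubCX.
by rewrite -mulrnA bin_ffact.
Qed.

Variables (L : {poly R} -> R) (k : nat -> R).
Hypothesis Llin : forall a p q, L (a *: p + q) = a * L p + L q.
Hypothesis LX : forall n,
  L ('X^(n.+1) : {poly R}) = \sum_(j < n.+1) (k j.+1 * L ('X^(n - j) : {poly R})) *+ 'C(n, j).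

Let L0 : L 0 = 0.
Proof. by have := Llin (-1) 0 0; rewrite scaler0 addr0 mulN1r addNr. Qed.

Let LD p q : L (p + q) = L p + L q.
Proof. by rewrite -{1}(scale1r p) Llin mul1r. Qed.

Let LZ a p : L (a *: p) = a * L p.
Proof. by rewrite -(addr0 (a *: p)) Llin L0 addr0. Qed.

Let LMn p n : L (p *+ n) = L p *+ n.
Proof. by rewrite -scaler_nat LZ mulr_natl. Qed.

(** Linear extension of [LX], since 'C(n, j) X^(n-j) is the j-th Hasse derivative of X^n. Stated for
    any polynomial, the recursion applies to powers of X - a as well. *)
Lemma cumulant_mulX s (q : {poly R}) : (size q <= s)%N ->
  L ('X * q) = \sum_(j < s) k j.+1 * L (q^`N(j)).
Proof.
move=> qs.
have Lsum n (F : 'I_n -> {poly R}) : L (\sum_i F i) = \sum_i L (F i).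
  exact: (big_morph L LD L0).
have Nsum j n (F : 'I_n -> {poly R}) : (\sum_i F i)^`N(j) = \sum_i (F i)^`N(j).
  by apply: (big_morph _ (nderivnD j)); rewrite -(polyC0) nderivnC; case: j.
have -> : q = \sum_(i < s) q`_i *: 'X^i.
  rewrite -[LHS](coefK q) poly_def (big_ord_widen _ (fun i => q`_i *: 'X^i) qs).
  rewrite big_mkcond; apply: eq_bigr => i _; case: ltnP => // qi.
  by rewrite nth_default// scale0r.
rewrite mulr_sumr Lsum.
transitivity (\sum_(j < s) \sum_(i < s) q`_i * ((k j.+1 * L 'X^(i - j)) *+ 'C(i, j))).
  rewrite exchange_big /=; apply: eq_bigr => i _.
  rewrite -scalerAr LZ -exprS LX -mulr_sumr; congr (_ * _).
  rewrite (big_ord_widen s (fun j => (k j.+1 * L 'X^(i - j)) *+ 'C(i, j)))//.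
  rewrite big_mkcond; apply: eq_bigr => j _; case: ltnP => // ij.
  by rewrite bin_small// mulr0n.
apply: eq_bigr => j _; rewrite Nsum Lsum mulr_sumr; apply: eq_bigr => i _.
by rewrite nderivnZ nderivnXn LZ LMn -mulrnAr mulrCA.
Qed.

(** Subtracting [a] times the functional cancels the term j = 0: centring kills the first cumulant
    and leaves the others unchanged. *)
Lemma central_moment_rec (a : R) n : a = k 1%N ->
  L (('X - a%:P) ^+ n.+1) =
  \sum_(j < n) (k j.+2 * L (('X - a%:P) ^+ (n - j.+1))) *+ 'C(n, j.+1).
Proof.
move=> ak; rewrite exprS mulrBl mul_polyC -scaleNr LD LZ mulNr.
rewrite (@cumulant_mulX n.+1) ?size_exp_XsubC// big_ord_recl /= nderivn0 -ak.
rewrite addrAC subrr add0r; apply: eq_bigr => j _.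
by rewrite nderivn_XsubCX LMn mulrnAr.
Qed.

End CentredMoments.

(** * Real random variables with finite absolute moments of all orders *)

Section AllMoments.
Context (d : measure_display) (T : measurableType d) (R : realType).
Variable P : probability T R.
Implicit Types Z W : T -> R.

(** A class closed under sums, products and domination, so that the integrability of every
    expression below follows from its shape. *)
Definition allmom Z := measurable_fun [set: T] Z /\
  forall k, P.-integrable [set: T] (EFin \o (fun w => `|Z w| ^+ k)).

Lemma le_integrable_real Z W : measurable_fun [set: T] Z ->
  (forall w, `|Z w| <= `|W w|) ->
  P.-integrable [set: T] (EFin \o W) -> P.-integrable [set: T] (EFin \o Z).
Proof.
move=> mZ ZW iW; apply: le_integrable iW => //; first exact/measurable_EFinP.
by move=> w _ /=; rewrite lee_fin.
Qed.

Lemma allmom_le Z W : measurable_fun [set: T] Z ->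
  (forall w, `|Z w| <= `|W w|) -> allmom W -> allmom Z.
Proof.
move=> mZ ZW [_ iW]; split=> // k; apply: le_integrable_real (iW k).
  by apply: measurable_funX; exact: measurableT_comp.
by move=> w; rewrite !normrX !normr_id lerXn2r ?nnegrE.
Qed.

Lemma allmom_cst c : allmom (fun=> c).
Proof.
split=> [|k]; first exact: measurable_cst.
exact: finite_measure_integrable_cst.
Qed.

Lemma integrable_sumr Z W : P.-integrable [set: T] (EFin \o Z) ->
  P.-integrable [set: T] (EFin \o W) ->
  P.-integrable [set: T] (EFin \o (fun w => Z w + W w)).
Proof. by move=> iZ iW; exact: (integrableD measurableT iZ iW). Qed.

Lemma integrable_scaler c Z : P.-integrable [set: T] (EFin \o Z) ->
  P.-integrable [set: T] (EFin \o (fun w => c * Z w)).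
Proof. by move=> iZ; exact: (integrableZl measurableT c iZ). Qed.

Lemma allmomD Z W : allmom Z -> allmom W -> allmom (fun w => Z w + W w).
Proof.
move=> [mZ iZ] [mW iW]; split=> [|k]; first exact: measurable_funD.
apply: (@le_integrable_real _ (fun w => 2 ^+ k * (`|Z w| ^+ k + `|W w| ^+ k))).
- by apply: measurable_funX; apply: measurableT_comp => //; exact: measurable_funD.
- move=> w; rewrite [leRHS]ger0_norm ?normrX ?normr_id; last first.
    by rewrite mulr_ge0 ?exprn_ge0// addr_ge0 ?exprn_ge0.
  have H (a b : R) : 0 <= a -> a <= b -> (a + b) ^+ k <= 2 ^+ k * (a ^+ k + b ^+ k).
    move=> a0 ab; have b0 := le_trans a0 ab.
    rewrite (@le_trans _ _ ((2 * b) ^+ k))//.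
      by rewrite lerXn2r ?nnegrE ?addr_ge0 ?mulr_ge0//; lra.
    by rewrite exprMn ler_wpM2l ?exprn_ge0// lerDr exprn_ge0.
  rewrite (@le_trans _ _ ((`|Z w| + `|W w|) ^+ k))//.
    by rewrite lerXn2r ?nnegrE ?addr_ge0 ?ler_normD.
  have [ZW|/ltW WZ] := leP `|Z w| `|W w|; first exact: H.
  by rewrite addrC [X in _ * X]addrC; exact: H.
- by apply: integrable_scaler; exact: integrable_sumr.
Qed.

Lemma allmomM Z W : allmom Z -> allmom W -> allmom (fun w => Z w * W w).
Proof.
move=> [mZ iZ] [mW iW]; split=> [|k]; first exact: measurable_funM.
apply: (@le_integrable_real _ (fun w => `|Z w| ^+ (k * 2) + `|W w| ^+ (k * 2))).
- by apply: measurable_funX; apply: measurableT_comp => //; exact: measurable_funM.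
- move=> w; rewrite [leRHS]ger0_norm ?normrX ?normr_id; last first.
    by rewrite addr_ge0 ?exprn_ge0.
  rewrite normrM exprMn !exprM.
  have := sqr_ge0 (`|Z w| ^+ k - `|W w| ^+ k); have := sqr_ge0 (`|Z w| ^+ k + `|W w| ^+ k).
  by nra.
- exact: integrable_sumr.
Qed.

Lemma allmomZ c Z : allmom Z -> allmom (fun w => c * Z w).
Proof. by apply: allmomM; exact: allmom_cst. Qed.

Lemma allmomB Z W : allmom Z -> allmom W -> allmom (fun w => Z w - W w).
Proof.
move=> aZ aW; have -> : (fun w => Z w - W w) = (fun w => Z w + (-1) * W w).
  by apply/funext => w; rewrite mulN1r.
by apply: allmomD => //; exact: allmomZ.
Qed.

Lemma allmomX Z n : allmom Z -> allmom (fun w => Z w ^+ n).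
Proof.
move=> aZ; elim: n => [|n IH]; first exact: allmom_cst.
have -> : (fun w => Z w ^+ n.+1) = (fun w => Z w * Z w ^+ n).
  by apply/funext => w; rewrite exprS.
exact: allmomM.
Qed.

Lemma allmom_sum (I : Type) (s : seq I) (Q : pred I) (F : I -> T -> R) :
  (forall i, Q i -> allmom (F i)) -> allmom (fun w => \sum_(i <- s | Q i) F i w).
Proof.
move=> aF; elim: s => [|i s IH].
  by under eq_fun do rewrite big_nil; exact: allmom_cst.
under eq_fun do rewrite big_cons.
by case Qi : (Q i) => //; apply: allmomD => //; exact: aF.
Qed.

Lemma allmom_prod (I : Type) (s : seq I) (Q : pred I) (F : I -> T -> R) :
  (forall i, Q i -> allmom (F i)) -> allmom (fun w => \prod_(i <- s | Q i) F i w).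
Proof.
move=> aF; elim: s => [|i s IH].
  by under eq_fun do rewrite big_nil; exact: allmom_cst.
under eq_fun do rewrite big_cons.
by case Qi : (Q i) => //; apply: allmomM => //; exact: aF.
Qed.

Lemma allmom_horner (p : {poly R}) Z : allmom Z -> allmom (fun w => p.[Z w]).
Proof.
move=> aZ; under eq_fun do rewrite horner_coef.
by apply: allmom_sum => i _; apply: allmomZ; exact: allmomX.
Qed.

Lemma allmom_norm Z : allmom Z -> allmom (fun w => `|Z w|).
Proof.
move=> aZ; apply: (allmom_le _ _ aZ) => [|w]; last by rewrite normr_id.
by apply: measurableT_comp => //; exact: aZ.1.
Qed.

Lemma allmom_bounded c Z : measurable_fun [set: T] Z ->
  (forall w, `|Z w| <= c) -> allmom Z.
Proof.
move=> mZ Zc; apply: (allmom_le mZ _ (allmom_cst c)) => w.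
exact: le_trans (Zc w) (ler_norm _).
Qed.

Lemma allmom_integrable Z : allmom Z -> P.-integrable [set: T] (EFin \o Z).
Proof.
move=> [mZ /(_ 1%N)]; apply: le_integrable_real => // w.
by rewrite expr1 normr_id.
Qed.

Definition mean Z : R := (\int[P]_w Z w)%R.

Lemma meanE Z : allmom Z -> ('E_P[Z] = (mean Z)%:E)%E.
Proof.
move=> aZ; rewrite unlock /mean /Rintegral fineK//.
by apply: integrable_fin_num => //; exact: allmom_integrable.
Qed.

Lemma meanD Z W : allmom Z -> allmom W ->
  mean (fun w => Z w + W w) = mean Z + mean W.
Proof. by move=> aZ aW; apply: RintegralD => //; exact: allmom_integrable. Qed.

Lemma meanZ c Z : allmom Z -> mean (fun w => c * Z w) = c * mean Z.
Proof. by move=> aZ; apply: RintegralZl => //; exact: allmom_integrable. Qed.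

Lemma meanB Z W : allmom Z -> allmom W ->
  mean (fun w => Z w - W w) = mean Z - mean W.
Proof. by move=> aZ aW; apply: RintegralB => //; exact: allmom_integrable. Qed.

Lemma mean_cst c : mean (fun=> c) = c.
Proof. by rewrite -[RHS]/(fine c%:E) -(expectation_cst P c) unlock. Qed.

Lemma mean_sum (I : Type) (s : seq I) (Q : pred I) (F : I -> T -> R) :
  (forall i, Q i -> allmom (F i)) ->
  mean (fun w => \sum_(i <- s | Q i) F i w) = \sum_(i <- s | Q i) mean (F i).
Proof.
move=> aF; elim: s => [|i s IH].
  by under eq_fun do rewrite big_nil; rewrite mean_cst big_nil.
under eq_fun do rewrite big_cons; rewrite big_cons.
by case Qi : (Q i) => //; rewrite meanD ?IH//; [exact: aF|exact: allmom_sum].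
Qed.

Lemma le_mean Z W : allmom Z -> allmom W -> (forall w, Z w <= W w) ->
  mean Z <= mean W.
Proof. by move=> aZ aW ZW; apply: le_Rintegral => //; exact: allmom_integrable. Qed.

Lemma mean_ge0 Z : (forall w, 0 <= Z w) -> 0 <= mean Z.
Proof. by move=> Z0; apply: Rintegral_ge0. Qed.

Lemma le_norm_mean Z W : allmom Z -> allmom W -> (forall w, `|Z w| <= W w) ->
  `|mean Z| <= mean W.
Proof.
move=> aZ aW ZW; apply: le_trans (le_mean (allmom_norm aZ) aW ZW).
by apply: le_normr_Rintegral => //; exact: allmom_integrable.
Qed.

(** The Cauchy-Schwarz inequality, read off from the nonnegative mean of (|Z| - m)^2, where m is the
    mean of |Z|. *)
Lemma mean_norm_le Z : allmom Z -> mean (fun w => `|Z w|) <= Num.sqrt (mean (fun w => Z w ^+ 2)).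
Proof.
move=> aZ; set m := mean (fun w => `|Z w|).
have m0 : 0 <= m by apply: mean_ge0.
have aN := allmom_norm aZ; have aZ2 := allmomX 2 aZ.
rewrite -[m]ger0_norm// -sqrtr_sqr ler_sqrt; last exact: (mean_ge0 (fun w => sqr_ge0 (Z w))).
have : 0 <= mean (fun w => (Z w ^+ 2 + (- (2 * m)) * `|Z w|) + m ^+ 2).
  apply: mean_ge0 => w; have := sqr_ge0 (`|Z w| - m).
  by rewrite sqrrB real_normK ?num_real//; lra.
rewrite meanD ?mean_cst; [|by apply: allmomD => //; exact: allmomZ|exact: allmom_cst].
rewrite meanD//; last exact: allmomZ.
rewrite meanZ// -/m; nra.
Qed.

End AllMoments.

(** * Taylor's formula for a cos x + b sin x *)

Section TrigTaylor.
Context {R : realType}.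
Implicit Types a b x : R.

Lemma is_derive_horner (p : {poly R}) x : is_derive x 1 (horner p) p^`().[x].
Proof.
have -> : p^`().[x] = 'D_1 (horner p) x by rewrite -derive1E -derivE.
exact/derivableP/derivable_horner.
Qed.

Lemma is_derive_ge0 (u du : R -> R) : (forall x, is_derive x 1 u (du x)) ->
  u 0 = 0 -> forall x, 0 <= x -> (forall y : R, 0 <= y -> 0 <= du y) -> 0 <= u x.
Proof.
move=> Du u0 x x0 du0.
have cu : {within `[0, x], continuous u}.
  by apply: derivable_within_continuous => z _; exact: (@ex_derive _ _ _ _ _ _ _ (Du z)).
have [c] := MVT_segment x0 (fun y _ => Du y) cu.
by rewrite in_itv /= u0 !subr0 => /andP[c0 _] ->; rewrite mulr_ge0 ?du0.
Qed.

(* The k-th derivative at 0 of x |-> a cos x + b sin x. *)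
Fixpoint trig_coef a b k : R := if k is k'.+1 then trig_coef b (- a) k' else a.

Definition trig_taylor n a b : {poly R} := \poly_(k < n) (trig_coef a b k / k`!%:R).

Lemma deriv_trig_taylor n a b : (trig_taylor n.+1 a b)^`() = trig_taylor n b (- a).
Proof.
apply/polyP => k; rewrite coef_deriv !coef_poly ltnS; case: ifP => _; last by rewrite mul0rn.
rewrite /= factS natrM -mulr_natr; field.
by rewrite nat1r !pnatr_eq0 -lt0n fact_gt0.
Qed.

Lemma is_derive_lin (u v : R -> R) a b du dv x :
  is_derive x 1 u du -> is_derive x 1 v dv ->
  is_derive x 1 (fun y => a * u y + b * v y) (a * du + b * dv).
Proof. by move=> hu hv; exact: (is_deriveD (is_deriveZ a hu) (is_deriveZ b hv)). Qed.

Lemma is_derive_trig a b x :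
  is_derive x 1 (fun y => a * cos y + b * sin y) (b * cos x + (- a) * sin x).
Proof.
have H := is_derive_lin a b (is_derive_cos x) (is_derive_sin x).
by apply: (is_derive_eq H); ring.
Qed.

(** Induction on the order: the derivative of the remainder for (a, b) is the remainder of one order
    less for (b, -a), and |a| + |b| is the same for both pairs. The bound is integrated by
    comparison with the monomial [q], which has the right derivative. *)
Lemma trig_taylor_le0 n a b x : 0 <= x ->
  `|a * cos x + b * sin x - (trig_taylor n a b).[x]| <=
    (`|a| + `|b|) * (x ^+ n / n`!%:R).
Proof.
elim: n a b x => [|n IH] a b x x0.
  rewrite /trig_taylor poly_def big_ord0 horner0 subr0 expr0 fact0 divr1 mulr1.
  apply: le_trans (ler_normD _ _) _; rewrite !normrM; apply: lerD.
    by rewrite ler_piMr// ler_norml cos_geN1 cos_le1.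
  by rewrite ler_piMr// ler_norml sin_geN1 sin_le1.
pose C : R := `|a| + `|b|; rewrite -/C.
have IHn (y : R) : 0 <= y -> `|b * cos y + (- a) * sin y - (trig_taylor n b (- a)).[y]| <=
    C * (y ^+ n / n`!%:R).
  by move=> y0; have := IH b (- a) y y0; rewrite normrN [`|b| + _]addrC.
pose q : {poly R} := (C / n.+1`!%:R)%:P * 'X^(n.+1).
have qE y : q.[y] = C * (y ^+ n.+1 / n.+1`!%:R)
  by rewrite /q hornerM hornerC hornerXn -mulrA [_^-1 * _]mulrC.
have dq y : q^`().[y] = C * (y ^+ n / n`!%:R).
  rewrite /q derivM derivC mul0r add0r derivXn hornerM hornerC hornerMn hornerXn /=.
  rewrite factS natrM -mulr_natr; field.
  by rewrite nat1r !pnatr_eq0 -lt0n fact_gt0.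
have T0 : (trig_taylor n.+1 a b).[0] = a.
  by rewrite horner_coef0 coef_poly /= fact0 divr1.
(* With s = 1 and s = -1 this yields the two halves of the absolute value. *)
have side s : `|s| = 1 ->
    0 <= q.[x] + s * (a * cos x + b * sin x - (trig_taylor n.+1 a b).[x]).
  move=> s1.
  pose u y := q.[y] + s * (a * cos y + b * sin y - (trig_taylor n.+1 a b).[y]).
  pose du y := q^`().[y] +
     s * (b * cos y + (- a) * sin y - (trig_taylor n b (- a)).[y]).
  apply: (@is_derive_ge0 u du) => //.
  - move=> y; rewrite /u /du -deriv_trig_taylor.
    have H1 := is_derive_horner q y.
    have H2 := is_derive_horner (trig_taylor n.+1 a b) y.
    have H3 := is_derive_trig a b y.
    have := is_derive_lin 1 s H1 (is_derive_lin 1 (-1) H3 H2).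
    rewrite !mul1r !mulN1r.
    by congr (is_derive _ _ _ _); apply/funext => z; rewrite !mul1r mulN1r.
  - by rewrite /u qE expr0n T0 cos0 sin0 /=; ring.
  - move=> y y0; rewrite /du dq.
    have : `|s * (b * cos y + (- a) * sin y - (trig_taylor n b (- a)).[y])| <=
      C * (y ^+ n / n`!%:R) by rewrite normrM s1 mul1r; exact: IHn.
    by rewrite ler_norml; lra.
have := side 1 (normr1 _); have := side (-1) (normrN1 _).
by rewrite qE ler_norml; lra.
Qed.

Lemma trig_taylor_le n a b x :
  `|a * cos x + b * sin x - (trig_taylor n a b).[x]| <=
    (`|a| + `|b|) * (`|x| ^+ n / n`!%:R).
Proof.
have [x0|x0] := leP 0 x; first by rewrite (ger0_norm x0); exact: trig_taylor_le0.
have nx0 : 0 <= - x by rewrite oppr_ge0 ltW.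
have := trig_taylor_le0 n a (- b) nx0.
rewrite cosN sinN mulrNN normrN (ltr0_norm x0).
suff -> : (trig_taylor n a (- b)).[- x] = (trig_taylor n a b).[x] by [].
rewrite !horner_poly; apply: eq_bigr => k _.
have -> : trig_coef a (- b) k = (-1) ^+ k * trig_coef a b k.
  elim: {k}(nat_of_ord k) a b => [|k IH] a b /=; first by rewrite mul1r.
  rewrite exprS mulN1r mulNr -IH.
  have : forall a b, trig_coef (- a) (- b) k = - trig_coef a b k.
    by elim: k {IH} => [|k IH] // a' b' /=; rewrite IH.
  by move=> <-; rewrite opprK.
rewrite [(- x) ^+ _]exprNn; set t := trig_coef _ _ _; set F := _^-1; set e := (-1) ^+ k.
have -> : e * t * F * (e * x ^+ k) = (e * e) * (t * F * x ^+ k) by ring.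
by rewrite -expr2 sqrr_sign mul1r.
Qed.

End TrigTaylor.

(** * Limits of real sequences in epsilon form *)

Section RealSequences.
Context {R : realType}.
Implicit Types (u v : nat -> R) (l : R).

Lemma cvgR_dist u l : u n @[n --> \oo] --> l -> forall e, 0 < e ->
  exists N, forall n, (N <= n)%N -> `|u n - l| < e.
Proof.
move=> ul e e0; have /cvgrPdist_lt /(_ e e0)[N _ HN] := ul.
by exists N => n Nn; rewrite distrC; exact: HN.
Qed.

Lemma cvgR_intro u l : (forall e, 0 < e ->
  exists N, forall n, (N <= n)%N -> `|u n - l| <= e) -> u n @[n --> \oo] --> l.
Proof.
move=> H; apply/cvgrPdist_le => e e0; have [N HN] := H e e0.
by exists N => // n Nn; rewrite distrC; exact: HN.
Qed.

(** The approximating sequence and its limit may both depend on [e]; this is how polynomial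
    statistics replace general ones. *)
Lemma cvgR_approx u l : (forall e, 0 < e -> exists v l', v n @[n --> \oo] --> l' /\
    `|l' - l| <= e /\ exists N, forall n, (N <= n)%N -> `|u n - v n| <= e) ->
  u n @[n --> \oo] --> l.
Proof.
move=> H; apply: cvgR_intro => e e0.
have e3 : 0 < e / 3 by rewrite divr_gt0.
have [v [l' [vl' [ll' [N HN]]]]] := H _ e3.
have [N' HN'] := cvgR_dist vl' e3.
exists (maxn N N') => n; rewrite geq_max => /andP[/HN H1 /HN' H2].
have -> : u n - l = (u n - v n) + (v n - l') + (l' - l) by ring.
apply: le_trans (ler_normD _ _) _; have := ler_normD (u n - v n) (v n - l').
lra.
Qed.

Lemma cvgR_sum (n : nat) (F : nat -> 'I_n -> R) (G : 'I_n -> R) :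
  (forall i, F N i @[N --> \oo] --> G i) ->
  \sum_(i < n) F N i @[N --> \oo] --> \sum_(i < n) G i.
Proof.
move=> FG; elim: n F G FG => [|n IH] F G FG.
  by rewrite big_ord0; under eq_cvg do rewrite big_ord0; exact: cvg_cst.
rewrite big_ord_recl; under eq_cvg do rewrite big_ord_recl.
by apply: cvgD; [exact: FG|apply: (IH (fun N i => F N (lift ord0 i)))].
Qed.

Lemma cvgR_eventually u v l : (exists N, forall n, (N <= n)%N -> u n = v n) ->
  u n @[n --> \oo] --> l -> v n @[n --> \oo] --> l.
Proof.
move=> [N uv] ul; apply: cvgR_intro => e /(cvgR_dist ul)[N' HN'].
exists (maxn N N') => n; rewrite geq_max => /andP[Nn N'n].
by rewrite -uv//; exact/ltW/HN'.
Qed.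

End RealSequences.

(** * From Gaussian limits of moments to limits of trigonometric means *)

Section MomentMethod.
Context {R : realType}.

(* The moments of the centred Gaussian law of variance [s]. *)
Fixpoint gmom2 (s : R) n : R * R :=
  if n is n'.+1 then let: (m, m') := gmom2 s n' in (m', n'.+1%:R * s * m) else (1, 0).
Definition gmom s n := (gmom2 s n).1.

Lemma gmom0 s : gmom s 0 = 1. Proof. by []. Qed.
Lemma gmom1 s : gmom s 1 = 0. Proof. by []. Qed.
Lemma gmomSS s n : gmom s n.+2 = n.+1%:R * s * gmom s n.
Proof. by rewrite /gmom /=; case: (gmom2 s n). Qed.

(** These quotients turn the Taylor sums of the cosine into partial sums of the exponential series,
    and they show that the Taylor remainder is small for large [m]. *)
Lemma gmom_even s m : gmom s m.*2 / (m.*2)`!%:R = (s / 2) ^+ m / m`!%:R.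
Proof.
elim: m => [|m IH]; first by rewrite gmom0.
rewrite doubleS gmomSS exprS.
have -> : (m.*2.+2)`! = (2 * m.+1 * m.*2.+1 * (m.*2)`!)%N.
  by rewrite !factS !mulnA; congr (_ * _ * _)%N; rewrite -doubleS -mul2n.
rewrite factS !natrM.
have f0 (k : nat) : k`!%:R != 0 :> R by rewrite pnatr_eq0 -lt0n fact_gt0.
have n0 (k : nat) : k.+1%:R != 0 :> R by rewrite pnatr_eq0.
have -> : m.*2.+1%:R * s * gmom s m.*2 / (2 * m.+1%:R * m.*2.+1%:R * (m.*2)`!%:R) =
   s / 2 / m.+1%:R * (gmom s m.*2 / (m.*2)`!%:R).
  move: (f0 m.*2) (n0 m.*2) (n0 m).
  set a := _`!%:R; set b := m.*2.+1%:R; set c := m.+1%:R => a0 b0 c0.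
  by clearbody a b c; field; rewrite ?a0 ?b0 ?c0.
rewrite IH; move: (f0 m) (n0 m); set a := _`!%:R; set c := m.+1%:R => a0 c0.
by clearbody a c; field; rewrite ?a0 ?c0.
Qed.

Lemma gmom_odd s m : gmom s m.*2.+1 = 0.
Proof. by elim: m => [|m IH] //; rewrite doubleS gmomSS IH mulr0. Qed.

Lemma gmom_scale s t n : t ^+ n * gmom s n = gmom (t ^+ 2 * s) n.
Proof.
have [m] := ubnP n; elim: m n => // m IH [|[|n]] nm.
- by rewrite !gmom0 mulr1.
- by rewrite !gmom1 mulr0.
- rewrite !gmomSS -IH; last by rewrite ltnS in nm; exact: ltnW.
  by rewrite !exprS expr0; ring.
Qed.

Lemma trig_coef_even (a b : R) m : trig_coef a b m.*2 = (-1) ^+ m * a.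
Proof.
elim: m a b => [|m IH] a b; first by rewrite mul1r.
by rewrite doubleS /= IH exprS mulN1r mulNr mulrN.
Qed.

Lemma trig_taylor_gmom (s a b : R) m :
  \sum_(k < m.*2) trig_coef a b k / k`!%:R * gmom s k =
  a * series (exp_coeff (- (s / 2))) m.
Proof.
rewrite /series /=; elim: m => [|m IH]; first by rewrite big_ord0 big_geq// mulr0.
rewrite doubleS !big_ord_recr /= IH gmom_odd mulr0 addr0 big_nat_recr//= mulrDr.
congr (_ + _); rewrite trig_coef_even /exp_coeff /= [(- (s / 2)) ^+ m]exprNn.
transitivity ((-1) ^+ m * a * (gmom s m.*2 / (m.*2)`!%:R)); first by ring.
by rewrite gmom_even; ring.
Qed.

Section OneVariable.
Context (d : measure_display) (T : measurableType d) (P : probability T R).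

Lemma allmom_trig a b t (Y : T -> R) : measurable_fun [set: T] Y ->
  allmom P (fun w => a * cos (t * Y w) + b * sin (t * Y w)).
Proof.
move=> mY; have mt : measurable_fun [set: T] (fun w => t * Y w).
  by apply: measurable_funM => //; exact: measurable_cst.
apply: allmomD; apply: allmomZ; apply: (@allmom_bounded _ _ _ P 1).
- by apply: (measurableT_comp _ mt); apply: continuous_measurable_fun; exact: continuous_cos.
- by move=> w; rewrite ler_norml cos_geN1 cos_le1.
- by apply: (measurableT_comp _ mt); apply: continuous_measurable_fun; exact: continuous_sin.
- by move=> w; rewrite ler_norml sin_geN1 sin_le1.
Qed.

(** Stopping at an even order makes the remainder bound a moment of [Y], with no absolute value. *)
Lemma mean_trig_taylor a b m (Y : T -> R) : allmom P Y ->
  `|mean P (fun w => a * cos (Y w) + b * sin (Y w)) -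
    \sum_(k < m.*2) trig_coef a b k / k`!%:R * mean P (fun w => Y w ^+ k)| <=
  (`|a| + `|b|) * (mean P (fun w => Y w ^+ m.*2) / (m.*2)`!%:R).
Proof.
move=> aY.
have aX k : allmom P (fun w => Y w ^+ k) by exact: allmomX.
have aT : allmom P (fun w => a * cos (Y w) + b * sin (Y w)).
  by have := allmom_trig a b 1 aY.1; under eq_fun do rewrite mul1r.
have -> : \sum_(k < m.*2) trig_coef a b k / k`!%:R * mean P (fun w => Y w ^+ k) =
    mean P (fun w => (trig_taylor m.*2 a b).[Y w]).
  under [in RHS]eq_fun do rewrite horner_poly.
  by rewrite mean_sum => [|k _]; [apply: eq_bigr => k _; rewrite meanZ|exact: allmomZ].
have aH := allmom_horner (trig_taylor m.*2 a b) aY.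
rewrite -meanB//.
have -> : (`|a| + `|b|) * (mean P (fun w => Y w ^+ m.*2) / (m.*2)`!%:R) =
   mean P (fun w => (`|a| + `|b|) / (m.*2)`!%:R * Y w ^+ m.*2).
  by rewrite meanZ//; ring.
apply: le_norm_mean; [exact: allmomB|exact: allmomZ|move=> w].
apply: le_trans (trig_taylor_le _ _ _ _) _.
have Y0 : 0 <= Y w ^+ m.*2 by rewrite -muln2 exprM sqr_ge0.
by rewrite -normrX (ger0_norm Y0) mulrA [leLHS]mulrAC.
Qed.

End OneVariable.

Section Sequence.
Context (d : nat -> measure_display) (T : forall N, measurableType (d N)).
Context (P : forall N, probability (T N) R) (Y : forall N, T N -> R).
Hypothesis aY : forall N, allmom (P N) (@Y N).

Lemma moments_trig1 (s a b : R) :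
  (forall n, mean (P N) (fun w => Y w ^+ n) @[N --> \oo] --> gmom s n) ->
  mean (P N) (fun w => a * cos (Y w) + b * sin (Y w)) @[N --> \oo] -->
    a * expR (- (s / 2)).
Proof.
move=> Hm; apply: cvgR_approx => e e0.
pose C := `|a| + `|b| + 1.
have C0 : 0 < C by rewrite ltr_wpDl ?addr_ge0.
have e1 : 0 < e / C / 2 by rewrite !divr_gt0.
have [m1 H1] := cvgR_dist (is_cvg_series_exp_coeff (- (s / 2)) : _ --> expR _) e1.
have [m2 H2] := cvgR_dist (cvg_exp_coeff (s / 2)) e1.
(* [m1] brings the exponential series close to its sum, [m2] makes the limit (s/2)^m / m! of the
   remainder small. The order is fixed here, before N is taken large, so only finitely many moments
   are involved. *)
pose m := maxn m1 m2.
exists (fun N => \sum_(k < m.*2) trig_coef a b k / k`!%:R * mean (P N) (fun w => Y w ^+ k)).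
exists (\sum_(k < m.*2) trig_coef a b k / k`!%:R * gmom s k).
have aC : `|a| <= C by rewrite /C; have := normr_ge0 b; lra.
have abC : `|a| + `|b| <= C by rewrite /C; lra.
split; [|split].
- by apply: cvgR_sum => k; apply: cvgM; [exact: cvg_cst|exact: Hm].
- rewrite trig_taylor_gmom -mulrBr normrM.
  have := H1 m (leq_maxl _ _) => /ltW H.
  apply: (@le_trans _ _ (C * (e / C / 2))); first by rewrite ler_pM.
  by have -> : C * (e / C / 2) = e / 2; [field; rewrite gt_eqF|lra].
- have e2 : 0 < e / C / 2 * (m.*2)`!%:R by rewrite mulr_gt0// ltr0n fact_gt0.
  have [N0 H0] := cvgR_dist (Hm m.*2) e2.
  exists N0 => N /H0 HN; apply: le_trans (mean_trig_taylor _ _ _ (aY N)) _.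
  have f0 : 0 < (m.*2)`!%:R :> R by rewrite ltr0n fact_gt0.
  set M := mean _ _ in HN *.
  have M0 : 0 <= M.
    by apply: mean_ge0 => w; rewrite -muln2 exprM sqr_ge0.
  have HM : M / (m.*2)`!%:R <= e / C.
    have : (M - gmom s m.*2) / (m.*2)`!%:R <= e / C / 2.
      by rewrite ler_pdivrMr//; apply: le_trans (ler_norm _) _; exact: ltW.
    have := H2 m (leq_maxr _ _); rewrite /exp_coeff /= subr0 -gmom_even ltr_norml.
    by rewrite mulrBl; lra.
  apply: (@le_trans _ _ (C * (e / C))).
    by apply: ler_pM => //; rewrite ?addr_ge0// divr_ge0.
  by rewrite mulrC divfK// gt_eqF.
Qed.

End Sequence.

Lemma moments_trig (d : nat -> measure_display) (T : forall N, measurableType (d N))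
    (P : forall N, probability (T N) R) (Y : forall N, T N -> R) (s a b t : R) :
  (forall N, allmom (P N) (@Y N)) ->
  (forall n, mean (P N) (fun w => Y N w ^+ n) @[N --> \oo] --> gmom s n) ->
  mean (P N) (fun w => a * cos (t * Y N w) + b * sin (t * Y N w)) @[N --> \oo] -->
    a * expR (- (t ^+ 2 * s / 2)).
Proof.
move=> aY Hm; apply: (@moments_trig1 d T P (fun N w => t * Y N w)) => [N|n].
  exact: allmomZ.
rewrite -gmom_scale.
have -> : (fun N => mean (P N) (fun w => (t * Y N w) ^+ n)) =
   (fun N => t ^+ n * mean (P N) (fun w => Y N w ^+ n)).
  apply/funext => N; rewrite -meanZ; last exact: allmomX.
  by congr mean; apply/funext => w; rewrite exprMn.
by apply: cvgM; [exact: cvg_cst|exact: Hm].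
Qed.

End MomentMethod.

(** * From trigonometric means to convergence in distribution *)

Section WeakConvergence.
Context {R : realType}.

(* For |x| <= L, x / 2L lies in [-1/2, 1/2], where sin is injective, so that g is a
   continuous function of sin (x / 2L) there. *)
Lemma sine_approx (g : R -> R) (C L e : R) : continuous g ->
  (forall x, `|g x| <= C) -> 0 < L -> 0 < e ->
  exists q : {poly R}, forall x,
    `|g x - q.[sin ((2 * L)^-1 * x)]| <= e + (2 * C + e) / L * `|x|.
Proof.
move=> cg gC L0 e0.
have C0 : 0 <= C by exact: le_trans (normr_ge0 _) (gC 0).
have L20 : 0 < 2 * L by rewrite mulr_gt0.
have pi2 := @pi_ge2 R.
pose s1 := sin (1 / 2 : R).
have half : (1 / 2 : R) \in `[- (pi / 2), pi / 2] by rewrite in_itv /=; apply/andP; split; lra.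
have zero : (0 : R) \in `[- (pi / 2), pi / 2] by rewrite in_itv /=; apply/andP; split; lra.
have pih : (pi / 2 : R) \in `[- (pi / 2), pi / 2] by rewrite in_itv /=; apply/andP; split; lra.
have s1lt : s1 < 1 by rewrite -sin_pihalf ltr_sin//; lra.
have s1gt : 0 < s1 by rewrite -sin0 ltr_sin//; lra.
(* The clamp keeps the argument of [asin] within [-sin(1/2), sin(1/2)], inside the open interval
   where [asin] is continuous; thus [h] is continuous on the whole line. *)
pose h u := g (2 * L * asin (Num.max (- s1) (Num.min s1 u))).
have clampP u : - s1 <= Num.max (- s1) (Num.min s1 u) <= s1.
  rewrite le_max lexx /= ge_max ge_min lexx /= andbT; lra.
have ch : continuous h.
  move=> u; apply: continuous_comp; last exact: cg.
  apply: cvgM; first exact: cvg_cst.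
  apply: (@continuous_comp R R R (fun u => Num.max (- s1) (Num.min s1 u)) asin).
    apply: (@continuous_max R R (fun=> - s1) (fun u => Num.min s1 u)); first exact: cvg_cst.
    by apply: (@continuous_min R R (fun=> s1) id); [exact: cvg_cst|exact: cvg_id].
  apply: continuous_asin; have := clampP u; lra.
have [q Hq] := weierstrass (@ltr01 R) e0 ch.
exists q => x; set y := (2 * L)^-1 * x.
have Hs : `|h (sin y) - q.[sin y]| <= e.
  by apply: Hq; rewrite ler_norml sin_geN1 sin_le1.
have hC : `|h (sin y)| <= C by exact: gC.
have A0 : 0 <= (2 * C + e) / L by apply: divr_ge0; lra.
have [xL|Lx] := leP `|x| L.
- suff -> : g x = h (sin y) by apply: le_trans Hs _; rewrite lerDl mulr_ge0.
  have yb : - (1 / 2) <= y <= 1 / 2.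
    have -> : y = x / (2 * L) by rewrite /y mulrC.
    move: xL; rewrite ler_norml ler_pdivlMr// ler_pdivrMr//; lra.
  have yin : y \in `[- (pi / 2), pi / 2] by rewrite in_itv /=; apply/andP; split; lra.
  have nhalf : (- (1 / 2) : R) \in `[- (pi / 2), pi / 2] by rewrite in_itv /=; apply/andP; split; lra.
  have sb : - s1 <= sin y <= s1.
    rewrite -sinN; rewrite !leNgt !ltr_sin// -!leNgt; lra.
  rewrite /h min_r; last by case/andP: sb.
  rewrite max_r; last by case/andP: sb.
  by rewrite sinK// /y mulrA divff ?gt_eqF// mul1r.
(* For |x| > L the error is at most 2C + e, and the factor |x| / L exceeds 1. *)
- have := ler_normB (g x) (h (sin y)); have := ler_normD (g x - h (sin y)) (h (sin y) - q.[sin y]).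
  rewrite addrA subrK => H1 H2.
  have H3 := gC x.
  have : 2 * C + e <= (2 * C + e) / L * `|x|.
    rewrite mulrAC ler_pdivlMr//; apply: ler_wpM2l; lra.
  lra.
Qed.

Lemma allmom_sin_trig (d : measure_display) (T : measurableType d)
    (P : probability T R) (Y : T -> R) k (c a b t : R) : measurable_fun [set: T] Y ->
  allmom P (fun w => sin (c * Y w) ^+ k * (a * cos (t * Y w) + b * sin (t * Y w))).
Proof.
move=> mY; apply: allmomM; last exact: allmom_trig.
apply: allmomX; have := allmom_trig P 0 1 c mY.
by under eq_fun do rewrite mul0r add0r mul1r.
Qed.

Section Sequence.
Context (d : nat -> measure_display) (T : forall N, measurableType (d N)).
Context (P : forall N, probability (T N) R) (Y : forall N, T N -> R).
Context (Q : probability (measurableTypeR R) R).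
Hypothesis aY : forall N, allmom (P N) (@Y N).
Hypothesis aQ : allmom Q (fun x : R => x).
Hypothesis trig_cvg : forall a b t : R,
  mean (P N) (fun w => a * cos (t * Y w) + b * sin (t * Y w)) @[N --> \oo] -->
  mean Q (fun x => a * cos (t * x) + b * sin (t * x)).

(** The product-to-sum formulas absorb one factor sin(c x) into trigonometric terms of frequencies t
    + c and t - c. The induction needs [a], [b] and [t] general for this reason. *)
Lemma sin_trig_cvg k (c a b t : R) :
  mean (P N) (fun w => sin (c * Y w) ^+ k * (a * cos (t * Y w) + b * sin (t * Y w)))
    @[N --> \oo] -->
  mean Q (fun x => sin (c * x) ^+ k * (a * cos (t * x) + b * sin (t * x))).
Proof.
elim: k a b t => [|k IH] a b t.
  have E x : sin (c * x) ^+ 0 * (a * cos (t * x) + b * sin (t * x)) =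
      a * cos (t * x) + b * sin (t * x) by rewrite expr0 mul1r.
  have -> : (fun N => mean (P N) (fun w => sin (c * Y w) ^+ 0 *
       (a * cos (t * Y w) + b * sin (t * Y w)))) =
     (fun N => mean (P N) (fun w => a * cos (t * Y w) + b * sin (t * Y w))).
    by apply/funext => N; congr mean; apply/funext => w; exact: E.
  have -> : (fun x : R => sin (c * x) ^+ 0 * (a * cos (t * x) + b * sin (t * x))) =
     (fun x => a * cos (t * x) + b * sin (t * x)) by apply/funext.
  exact: trig_cvg.
pose F t' a' b' x : R := sin (c * x) ^+ k * (a' * cos (t' * x) + b' * sin (t' * x)).
have E x : sin (c * x) ^+ k.+1 * (a * cos (t * x) + b * sin (t * x)) =
    F (t + c) (- b / 2) (a / 2) x + F (t - c) (b / 2) (- a / 2) x.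
  rewrite /F exprS; have -> : (t + c) * x = t * x + c * x by ring.
  have -> : (t - c) * x = t * x - c * x by ring.
  by rewrite cosD sinD cosB sinB; field.
have -> : (fun x => sin (c * x) ^+ k.+1 * (a * cos (t * x) + b * sin (t * x))) =
  (fun x => F (t + c) (- b / 2) (a / 2) x + F (t - c) (b / 2) (- a / 2) x).
  by apply/funext.
have -> : (fun N => mean (P N) (fun w => sin (c * Y w) ^+ k.+1 *
     (a * cos (t * Y w) + b * sin (t * Y w)))) =
  (fun N => mean (P N) (fun w => F (t + c) (- b / 2) (a / 2) (Y w)) +
            mean (P N) (fun w => F (t - c) (b / 2) (- a / 2) (Y w))).
  apply/funext => N; rewrite -meanD; first by congr mean; apply/funext => w; exact: E.
  - by apply: allmom_sin_trig; exact: (aY N).1.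
  - by apply: allmom_sin_trig; exact: (aY N).1.
rewrite meanD; first by apply: cvgD; exact: IH.
- by apply: allmom_sin_trig; exact: aQ.1.
- by apply: allmom_sin_trig; exact: aQ.1.
Qed.

Lemma poly_sin_cvg (q : {poly R}) (c : R) :
  mean (P N) (fun w => q.[sin (c * Y w)]) @[N --> \oo] -->
  mean Q (fun x => q.[sin (c * x)]).
Proof.
have E (d' : measure_display) (T' : measurableType d') (P' : probability T' R) (Z : T' -> R) :
    measurable_fun [set: T'] Z ->
    mean P' (fun w => q.[sin (c * Z w)]) = \sum_(i < size q)
      mean P' (fun w => sin (c * Z w) ^+ i * (q`_i * cos (0 * Z w) + 0 * sin (0 * Z w))).
  move=> mZ; rewrite -mean_sum => [|i _]; last exact: allmom_sin_trig.
  congr mean; apply/funext => w; rewrite horner_coef; apply: eq_bigr => i _.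
  by rewrite !mul0r cos0 mulr1 addr0 mulrC.
rewrite (E _ _ Q (fun x => x) aQ.1).
have -> : (fun N => mean (P N) (fun w => q.[sin (c * Y w)])) = (fun N => \sum_(i < size q)
      mean (P N) (fun w => sin (c * Y w) ^+ i * (q`_i * cos (0 * Y w) + 0 * sin (0 * Y w)))).
  by apply/funext => N; rewrite E//; exact: (aY N).1.
by apply: cvgR_sum => i; exact: sin_trig_cvg.
Qed.

(** The bound on E|Y| plays the part of tightness: it controls the error of [sine_approx], which is
    affine in |x|, uniformly in N. *)
Lemma trig_weak_cvg (B C : R) (g : R -> R) :
  (exists N0, forall N, (N0 <= N)%N -> mean (P N) (fun w => `|Y w|) <= B) ->
  continuous g -> (forall x, `|g x| <= C) ->
  mean (P N) (fun w => g (Y w)) @[N --> \oo] --> mean Q g.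
Proof.
move=> [N0 HB] cg gC.
have C0 : 0 <= C by exact: le_trans (normr_ge0 _) (gC 0).
have mg : measurable_fun [set: measurableTypeR R] g by exact: continuous_measurable_fun.
have ag (d' : measure_display) (T' : measurableType d') (P' : probability T' R) (Z : T' -> R) :
    allmom P' Z -> allmom P' (fun w => g (Z w)).
  move=> aZ; apply: (@allmom_bounded _ _ _ P' C) => [|w]; last exact: gC.
  exact: measurableT_comp aZ.1.
apply: cvgR_approx => e e0.
pose B' := `|B| + mean Q (fun x => `|x|) + 1.
have mQ0 : 0 <= mean Q (fun x => `|x|) by exact: mean_ge0.
have B0 : 0 < B' by rewrite /B'; have := normr_ge0 B; lra.
have BB' : B <= B' by rewrite /B'; have := ler_norm B; lra.
have QB' : mean Q (fun x => `|x|) <= B' by rewrite /B'; have := normr_ge0 B; lra.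
have e2 : 0 < e / 2 by rewrite divr_gt0.
(* Chosen so that (2C + e/2) / L times [B'] equals e/2. [B'] dominates the first absolute moment
   under [Q] and, for large N, under [P N], so that [key] serves for both. *)
pose L := (2 * C + e / 2) * B' / (e / 2).
have L0 : 0 < L by rewrite /L divr_gt0// mulr_gt0//; lra.
have [q Hq] := sine_approx cg gC L0 e2.
have key (d' : measure_display) (T' : measurableType d') (P' : probability T' R) (Z : T' -> R) :
    allmom P' Z -> mean P' (fun w => `|Z w|) <= B' ->
    `|mean P' (fun w => g (Z w)) - mean P' (fun w => q.[sin ((2 * L)^-1 * Z w)])| <= e.
  move=> aZ ZB.
  have aq : allmom P' (fun w => q.[sin ((2 * L)^-1 * Z w)]).
    apply: allmom_horner; have := allmom_trig P' 0 1 (2 * L)^-1 aZ.1.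
    by under eq_fun do rewrite mul0r add0r mul1r.
  have aN := allmom_norm aZ.
  have acst := allmom_cst P' (e / 2).
  rewrite -meanB//; last exact: ag.
  pose A := (2 * C + e / 2) / L.
  have -> : e = e / 2 + A * B'.
    rewrite /A /L; field; rewrite !gt_eqF//; lra.
  apply: (@le_trans _ _ (mean P' (fun w => e / 2 + A * `|Z w|))).
    apply: le_norm_mean.
    - by apply: allmomB => //; exact: ag.
    - by apply: allmomD => //; exact: allmomZ.
    - by move=> w; exact: Hq.
  rewrite meanD//; last exact: allmomZ.
  rewrite mean_cst meanZ// lerD2l; apply: ler_wpM2l => //.
  by rewrite /A divr_ge0//; lra.
exists (fun N => mean (P N) (fun w => q.[sin ((2 * L)^-1 * Y w)])).
exists (mean Q (fun x => q.[sin ((2 * L)^-1 * x)])).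
split; [exact: poly_sin_cvg|split].
- by rewrite distrC; apply: (key _ _ Q (fun x => x)).
- by exists N0 => N NN; apply: key => //; exact: le_trans (HB N NN) BB'.
Qed.

End Sequence.
End WeakConvergence.

(** * Moments of the Gaussian law *)

Section GaussianMoments.
Context {R : realType}.
Notation mu := (@lebesgue_measure R).
Implicit Types (s c x : R).

(** The Radon-Nikodym derivative agrees almost everywhere with [normal_pdf], because the two have
    the same integral over every measurable set. *)
Lemma ge0_integral_normal s (f : R -> \bar R) : s != 0 ->
  measurable_fun [set: measurableTypeR R] f -> (forall x, (0 <= f x)%E) ->
  (\int[normal_prob 0 s]_x f x = \int[mu]_x (f x * (normal_pdf 0 s x)%:E))%E.
Proof.
move=> s0 mf f0.
have dom := @normal_prob_dominates R 0 s.
rewrite -(Radon_Nikodym_SigmaFinite.change_of_variables dom)//.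
have mpdf : measurable_fun [set: measurableTypeR R] (fun x => (normal_pdf 0 s x)%:E).
  by apply/measurable_EFinP; exact: measurable_normal_pdf.
have iRN := Radon_Nikodym_SigmaFinite.f_integrable dom.
apply: ae_eq_integral => //.
- by apply: emeasurable_funM => //; exact: measurable_int iRN.
- exact: emeasurable_funM.
- apply: ae_eqe_mul2l; apply: integral_ae_eq => //.
  + by move=> A _ mA; rewrite -Radon_Nikodym_SigmaFinite.f_integral.
Qed.

Definition gphi c x : R := expR (- (c * x ^+ 2)).

Lemma gphi_normal s x : s != 0 -> normal_pdf 0 s x = normal_peak s * gphi (2 * s ^+ 2)^-1 x.
Proof.
move=> s0; rewrite normal_pdfE// /normal_fun /gphi subr0; congr (_ * expR _).
by rewrite mulNr -[s ^+ 2 *+ 2]mulr_natl mulrC.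
Qed.

Lemma continuous_gphi c : continuous (gphi c).
Proof.
move=> x; apply: (@continuous_comp R R R (fun x => - (c * x ^+ 2)) expR).
  apply: cvgN; apply: cvgM; first exact: cvg_cst.
  exact: exprn_continuous.
exact: continuous_expR.
Qed.

Lemma is_derive_gphi c x : is_derive x 1 (gphi c) (- (2 * c * x) * gphi c x).
Proof.
have H : is_derive x 1 (horner (- (c *: 'X^2) : {poly R})) (- (2 * c * x)).
  apply: (is_derive_eq (is_derive_horner _ _)).
  by rewrite derivN derivZ derivXn !hornerE /=; ring.
have := @is_derive1_comp R expR (horner (- (c *: 'X^2) : {poly R})) x _ _
  (is_derive_expR _) H.
rewrite (_ : expR \o _ = gphi c); last first.
  by apply/funext => y /=; rewrite /gphi !hornerE.
by move=> H'; apply: (is_derive_eq H'); rewrite /gphi !hornerE mulrC.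
Qed.

Lemma pow_le_expR n (y : R) : 0 <= y -> y ^+ n <= n`!%:R * expR y.
Proof.
move=> y0.
have f0 : 0 < n`!%:R :> R by rewrite ltr0n fact_gt0.
rewrite mulrC -ler_pdivrMr//.
have : exp_coeff y n <= series (exp_coeff y) n.+1.
  rewrite /series /= big_nat_recr//= lerDr; apply: sumr_ge0 => i _.
  exact: exp_coeff_ge0.
move=> /le_trans; apply; rewrite /expR.
apply: nondecreasing_cvgn_le; last exact: is_cvg_series_exp_coeff.
by apply: nondecreasing_series => i _ _; exact: exp_coeff_ge0.
Qed.

(** One half of the exponent is kept; the other half absorbs |x|^k, by y^k <= k! exp(y) and |x|^k <=
    1 + x^(2k). *)
Lemma pow_gphi_le k c : 0 < c -> exists2 C : R, 0 <= C &
  forall x, `|x| ^+ k * gphi c x <= C * gphi (c / 2) x.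
Proof.
move=> c0; exists (1 + (2 / c) ^+ k * k`!%:R) => [|x].
  by rewrite addr_ge0// mulr_ge0// exprn_ge0// divr_ge0// ltW.
have -> : gphi c x = gphi (c / 2) x * gphi (c / 2) x.
  by rewrite /gphi -expRD; congr expR; field.
rewrite mulrA ler_wpM2r ?expR_ge0//.
have y0 : 0 <= c / 2 * x ^+ 2 by rewrite mulr_ge0 ?sqr_ge0// divr_ge0// ltW.
have e1 : 1 <= expR (c / 2 * x ^+ 2) by rewrite -[leLHS]expR0 ler_expR.
rewrite /gphi expRN ler_pdivrMr ?expR_gt0//.
have Hk := pow_le_expR k y0.
have xk : `|x| ^+ k <= 1 + (2 / c) ^+ k * (c / 2 * x ^+ 2) ^+ k.
  rewrite -exprMn mulrA (_ : 2 / c * (c / 2) = 1); last by field; rewrite gt_eqF.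
  rewrite mul1r -real_normK ?num_real// -exprM mulnC exprM.
  have := sqr_ge0 (`|x| ^+ k - 1); have := sqr_ge0 (`|x| ^+ k); nra.
apply: le_trans xk _; set E := expR _ in e1 Hk *.
have -> : (1 + (2 / c) ^+ k * k`!%:R) * E = E + (2 / c) ^+ k * (k`!%:R * E) by ring.
apply: lerD => //.
by rewrite ler_wpM2l// exprn_ge0// divr_ge0// ltW.
Qed.

Lemma integrable_gphi c : 0 < c -> mu.-integrable [set: R] (EFin \o gphi c).
Proof.
move=> c0; pose s := Num.sqrt (2 * c)^-1.
have s2 : s ^+ 2 = (2 * c)^-1 by rewrite sqr_sqrtr// invr_ge0 mulr_ge0// ltW.
have s0 : s != 0 by rewrite gt_eqF// sqrtr_gt0 invr_gt0 mulr_gt0.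
have p0 := normal_peak_gt0 s0.
have := integrableZl measurableT (normal_peak s)^-1 (integrable_normal_pdf 0 s).
congr (_.-integrable _ _); apply/funext => x /=; rewrite gphi_normal// s2 -EFinM.
rewrite mulrA mulVf ?gt_eqF// mul1r (_ : (2 * (2 * c)^-1)^-1 = c)//.
by field; rewrite gt_eqF.
Qed.

Lemma continuous_pow_gphi k c : continuous (fun x => x ^+ k * gphi c x).
Proof.
by move=> x; apply: cvgM; [exact: exprn_continuous|exact: continuous_gphi].
Qed.

Lemma integrable_pow_gphi k c : 0 < c ->
  mu.-integrable [set: R] (EFin \o (fun x => x ^+ k * gphi c x)).
Proof.
move=> c0; have [C C0 HC] := pow_gphi_le k c0.
have c20 : 0 < c / 2 by rewrite divr_gt0.
apply: le_integrable (integrableZl measurableT C (integrable_gphi c20)) => //.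
  by apply/measurable_EFinP; apply: continuous_measurable_fun; exact: continuous_pow_gphi.
move=> x _ /=; rewrite lee_fin normrM normrX (ger0_norm (expR_ge0 _)).
apply: le_trans (HC x) _; exact: ler_norm.
Qed.

Lemma pow_gphi_cvg0 k c : 0 < c ->
  n%:R ^+ k * gphi c n%:R @[n --> \oo] --> (0 : R).
Proof.
move=> c0; have [C C0 HC] := pow_gphi_le k.+1 c0.
have c20 : 0 < c / 2 by rewrite divr_gt0.
apply: cvgR_intro => e e0.
have [N HN] : exists N : nat, C / e < N%:R.
  exists (Num.bound (C / e)); apply: archi_boundP; rewrite divr_ge0//; exact: ltW.
exists N => n Nn; rewrite subr0 normrM normrX (ger0_norm (expR_ge0 _)).
have n0 : 0 < n%:R :> R.
  by apply: lt_le_trans (_ : N%:R <= _); [apply: le_lt_trans HN; rewrite divr_ge0// ltW|rewrite ler_nat].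
have := HC n%:R; rewrite exprS -mulrA (ger0_norm (ltW n0)) => H.
have g1 : gphi (c / 2) n%:R <= 1.
  rewrite /gphi -[leRHS]expR0 ler_expR oppr_le0 mulr_ge0 ?sqr_ge0//; exact: ltW.
have Cn : C <= e * n%:R.
  by rewrite mulrC -ler_pdivrMr//; apply: ltW; apply: lt_le_trans HN _; rewrite ler_nat.
rewrite -(ler_pM2l n0) [n%:R * e]mulrC; apply: le_trans H _; apply: le_trans Cn.
by rewrite ler_piMr.
Qed.

(** The fundamental theorem of calculus on [-n, n], followed by dominated convergence. It takes the
    place of integration by parts in the moment recursion. *)
Lemma integral_derivative0 (G g : R -> R) :
  (forall x, is_derive x 1 G (g x)) -> continuous g ->
  mu.-integrable [set: R] (EFin \o g) ->
  G n%:R @[n --> \oo] --> (0 : R) -> G (- n%:R) @[n --> \oo] --> (0 : R) ->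
  (\int[mu]_x g x = 0)%R.
Proof.
move=> dG cg ig G1 G2.
have DG x : derivable G x 1 by exact: (@ex_derive _ _ _ _ _ _ _ (dG x)).
have cG : continuous G.
  by move=> x; apply/differentiable_continuous/derivable1_diffP.
pose F n : R -> \bar R := (EFin \o g) \_ `[- n%:R, n%:R].
have HF : (\int[mu]_x F n x)%E @[n --> \oo] --> (\int[mu]_x (g x)%:E)%E.
  apply: (@dominated_cvg _ _ _ mu setT measurableT F (EFin \o g)
    (fun x => `|(g x)%:E|%E)) => //.
  - move=> n; apply/(measurable_restrictT _ _).1 => //.
    by apply: measurable_funTS; exact: measurable_int ig.
  - move=> x _; apply: cvg_near_cst; near=> n; rewrite /F patchE ifT// inE /= in_itv /= -ler_norml.
    by near: n; exact: nbhs_infty_ger.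
  - exact: integrable_abse.
  - by move=> n x _; rewrite /F patchE; case: ifP => // _; rewrite abse0.
have EF n : (0 < n)%N -> (\int[mu]_x F n x = (G n%:R - G (- n%:R))%:E)%E.
  move=> n0; rewrite /F -integral_mkcond EFinB.
  apply: continuous_FTC2.
  - by rewrite -subr_gt0 opprK addr_gt0// ltr0n.
  - exact: continuous_subspaceT.
  - split=> [x _//||]; [apply: cvg_at_right_filter|apply: cvg_at_left_filter]; exact: cG.
  - by move=> x _; rewrite derive1E; exact: derive_val.
have : fine (\int[mu]_x F n x)%E @[n --> \oo] --> fine (\int[mu]_x (g x)%:E)%E.
  apply: fine_cvg; rewrite fineK//; exact: integrable_fin_num.
move=> H1; rewrite /Rintegral.
have H2 : fine (\int[mu]_x F n x)%E @[n --> \oo] --> (0 - 0 : R).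
  by apply: cvgR_eventually (cvgB G1 G2); exists 1%N => n n0; rewrite EF.
rewrite subr0 in H2; exact: (cvg_unique _ H1 H2).
Unshelve. all: by end_near.
Qed.

(** The derivative of x^(n+1) exp(-c x^2) is the difference of (n+1) x^n exp(-c x^2) and 2c x^(n+2)
    exp(-c x^2), and its integral vanishes. *)
Lemma gphi_moment_rec n c : 0 < c ->
  (\int[mu]_x (x ^+ n.+2 * gphi c x) =
   n.+1%:R * (2 * c)^-1 * \int[mu]_x (x ^+ n * gphi c x))%R.
Proof.
move=> c0.
have i2 := integrable_pow_gphi n.+2 c0; have i0 := integrable_pow_gphi n c0.
pose g x := n.+1%:R * (x ^+ n * gphi c x) + (- (2 * c)) * (x ^+ n.+2 * gphi c x).
have iz a k : mu.-integrable [set: R] (EFin \o (fun x => a * (x ^+ k * gphi c x))).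
  exact: (integrableZl measurableT a (integrable_pow_gphi k c0)).
have : (\int[mu]_x g x = 0)%R.
  apply: (@integral_derivative0 (fun x => x ^+ n.+1 * gphi c x)).
  - move=> x.
    have Hx : is_derive x 1 (horner ('X^(n.+1) : {poly R})) (n.+1%:R * x ^+ n).
      apply: (is_derive_eq (is_derive_horner _ _)).
      by rewrite derivXn hornerMn hornerXn mulr_natl.
    have := is_deriveM Hx (is_derive_gphi c x).
    rewrite (_ : horner _ * gphi c = fun x => x ^+ n.+1 * gphi c x); last first.
      by apply/funext => y; rewrite /GRing.mul /= hornerXn.
    move=> H; apply: (is_derive_eq H).
    by rewrite hornerXn /g /GRing.scale /= !exprS; ring.
  - by move=> x; apply: cvgD; (apply: cvgM; [exact: cvg_cst|exact: continuous_pow_gphi]).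
  - exact: (integrableD measurableT (iz _ _) (iz _ _)).
  - exact: pow_gphi_cvg0.
  - have -> : (fun m : nat => (- m%:R) ^+ n.+1 * gphi c (- m%:R)) =
      (fun m : nat => (-1) ^+ n.+1 * (m%:R ^+ n.+1 * gphi c m%:R)).
      by apply/funext => m; rewrite (exprNn m%:R n.+1) /gphi sqrrN -mulrA.
    rewrite -[X in _ --> X](mulr0 ((-1) ^+ n.+1)).
    by apply: cvgM; [exact: cvg_cst|exact: pow_gphi_cvg0].
rewrite /g RintegralD//.
rewrite !RintegralZl// => /eqP; rewrite addr_eq0 mulNr opprK => /eqP H.
by rewrite mulrAC H [2 * c * _]mulrC mulfK// mulf_neq0// gt_eqF.
Qed.

(** [gaussian] is a set function defined by cases. The witness [Q] presents it as a probability, to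
    which the lemmas on [mean] apply. *)
Lemma gaussian_moments (v : R) : 0 <= v ->
  exists Q : probability (measurableTypeR R) R, gaussian 0 v = Q :> (set _ -> \bar R) /\
    allmom Q (fun x : R => x) /\ forall n, mean Q (fun x => x ^+ n) = gmom v n.
Proof.
rewrite /gaussian le_eqVlt eq_sym; case: eqP => [->|_] /=.
  move=> _; exists (\d_(0 : measurableTypeR R)); split=> //.
  have mid : measurable_fun [set: measurableTypeR R] (fun x : R => x) by exact: measurable_id.
  split=> [|n].
    split=> // k; apply/integrableP; split.
      by apply/measurable_EFinP; apply: measurable_funX; exact: normr_measurable.
    rewrite integral_dirac//=; first by rewrite diracT mul1e ltry.
    apply/measurable_EFinP; apply: measurableT_comp; first exact: normr_measurable.
    by apply: measurable_funX; exact: normr_measurable.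
  rewrite /mean /Rintegral integral_dirac//; last first.
    by apply/measurable_EFinP; apply: measurable_funX.
  rewrite diracT mul1e /=.
  case: n => [|[|n]]; rewrite ?expr0 ?gmom0 ?expr1 ?gmom1//.
  by rewrite gmomSS expr0n mulr0 mul0r.
move=> v0.
pose s := Num.sqrt v.
have s0 : s != 0 by rewrite gt_eqF// sqrtr_gt0.
have s2 : s ^+ 2 = v by rewrite sqr_sqrtr// ltW.
exists (normal_prob 0 s); split=> //.
pose c := (2 * v)^-1.
have c0 : 0 < c by rewrite invr_gt0 mulr_gt0.
have mid : measurable_fun [set: measurableTypeR R] (fun x : R => x) by exact: measurable_id.
have pdfE x : normal_pdf 0 s x = normal_peak s * gphi c x by rewrite gphi_normal// s2.
have aid : allmom (normal_prob 0 s) (fun x : R => x).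
  split=> // k; have mk : measurable_fun [set: measurableTypeR R] (fun x : R => (`|x| ^+ k)%:E).
    by apply/measurable_EFinP; apply: measurable_funX; exact: normr_measurable.
  apply/integrableP; split => //.
  rewrite ge0_integral_normal//; last by apply: measurableT_comp.
  have := integrableZl measurableT (normal_peak s) (integrable_pow_gphi k c0).
  move=> /integrableP[_]; congr (_ < _)%E; apply: eq_integral => x _ /=.
  rewrite pdfE -EFinM; congr (_%:E); rewrite !normrM !normrX ?normr_id.
  rewrite (ger0_norm (expR_ge0 _)) (ger0_norm (normal_peak_ge0 s)); exact: mulrCA.
split=> // n.
have aX k : allmom (normal_prob 0 s) (fun x : R => x ^+ k) by exact: allmomX.
have E k : (mean (normal_prob 0 s) (fun x => x ^+ k) =
    normal_peak s * \int[mu]_x (x ^+ k * gphi c x))%R.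
  have mk : measurable_fun [set: measurableTypeR R] (fun x : R => (x ^+ k)%:E).
    by apply/measurable_EFinP; apply: measurable_funX.
  have ik := integrable_pow_gphi k c0.
  rewrite -RintegralZl// /mean /Rintegral; congr fine.
  (* The density formula holds for nonnegative functions, so positive and negative parts are treated
     apart. *)
  rewrite [in LHS]integralE [in RHS]integralE.
  rewrite !ge0_integral_normal//; [|exact: measurable_funeneg|exact: measurable_funepos].
  have p0 := normal_peak_ge0 s.
  have max_scale (u a : R) : 0 <= a -> (maxe u%:E 0 * a%:E = maxe (u * a)%:E 0)%E.
    by move=> a0; rewrite -!EFin_max -EFinM maxr_pMl// mul0r.
  have pg0 x : 0 <= normal_peak s * gphi c x by rewrite mulr_ge0// expR_ge0.
  congr (_ - _)%E; apply: eq_integral => x _.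
    by rewrite !funeposE pdfE max_scale//= mulrCA.
  by rewrite !funenegE pdfE -!EFinN max_scale//= mulrCA mulNr mulrN.
have [m] := ubnP n; elim: m n => // m IH [|[|n]] nm.
- by under eq_fun do rewrite expr0; rewrite mean_cst gmom0.
(* Up to a constant factor, x exp(-c x^2) is the derivative of exp(-c x^2). *)
- have ev : (\int[mu]_x (x ^+ 1 * gphi c x) = 0)%R.
    have : (\int[mu]_x ((- (2 * c)) * (x ^+ 1 * gphi c x)) = 0)%R.
      apply: (@integral_derivative0 (gphi c)).
      - by move=> x; apply: (is_derive_eq (is_derive_gphi c x)); rewrite expr1; ring.
      - by move=> x; apply: cvgM; [exact: cvg_cst|exact: continuous_pow_gphi].
      - exact: (integrableZl measurableT _ (integrable_pow_gphi 1 c0)).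
      - by have := pow_gphi_cvg0 0 c0; under eq_cvg do rewrite mul1r.
      - have := pow_gphi_cvg0 0 c0; under eq_cvg do rewrite mul1r.
        by under [X in _ -> X]eq_cvg do rewrite /gphi sqrrN.
    rewrite RintegralZl//; last exact: integrable_pow_gphi.
    by move=> /eqP; rewrite mulf_eq0 oppr_eq0 mulf_eq0 pnatr_eq0 (gt_eqF c0) => /eqP.
  by rewrite E ev mulr0 gmom1.
- rewrite E gphi_moment_rec// mulrCA -E IH; last by rewrite ltnS in nm; exact: ltnW.
  rewrite gmomSS; congr (_ * _ * _); by rewrite /c; field; rewrite gt_eqF.
Qed.

End GaussianMoments.

(** * Traces of powers and the operator norm in terms of eigenvalues *)

Section HermitianMatrices.

Lemma conj_diag_exp (F : comUnitRingType) n (U : 'M[F]_n) (D : 'rV[F]_n) k :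
  U \in unitmx -> (invmx U *m diag_mx D *m U) ^+ k =
  invmx U *m diag_mx (\row_i (D 0 i ^+ k)) *m U.
Proof.
move=> Uu; elim: k => [|k IH].
  rewrite expr0 (_ : diag_mx _ = 1%:M) ?mulmx1 ?mulVmx//.
  by apply/matrixP => i j; rewrite !mxE expr0.
rewrite exprS IH -[_ * _]/(_ *m _) !mulmxA mulmxK// -[_ *m _ *m diag_mx _]mulmxA.
by rewrite mulmx_diag; congr (_ *m diag_mx _ *m _); apply/rowP => i; rewrite !mxE exprS.
Qed.

Lemma invmx_unitarymx (C : numClosedFieldType) n (U : 'M[C]_n) :
  U \is unitarymx -> invmx U \is unitarymx.
Proof. by move=> UU; rewrite invmx_unitary// trmxC_unitary. Qed.

Context {R : realType}.
Local Notation normc := ComplexField.Normc.normc.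

Definition ev (n : nat) (A : 'M[R[i]]_n) (k : 'I_n) : R := Re (spectral_diag A 0 k).

Lemma hermitian_spectralE n (A : 'M[R[i]]_n) : A \is hermsymmx ->
  A = invmx (spectralmx A) *m diag_mx (\row_k (ev A k)%:C) *m spectralmx A.
Proof.
move=> hA; have -> : \row_k (ev A k)%:C = spectral_diag A; last first.
  exact/orthomx_spectralP/hermitian_normalmx.
apply/rowP => k; rewrite mxE /ev.
have /mxOverP/(_ 0 k) := hermitian_spectral_diag_real hA.
exact: RRe_real.
Qed.

Lemma trace_powE n k (A : 'M[R[i]]_n) : A \is hermsymmx ->
  trace_pow k A = (\sum_i ev A i ^+ k)%:C.
Proof.
move=> hA; have PU := spectral_unit A.
rewrite /trace_pow {1}(hermitian_spectralE hA) conj_diag_exp//.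
rewrite mxtrace_mulC mulmxA mulmxV// mul1mx mxtrace_diag rmorph_sum /=.
by apply: eq_bigr => i _; rewrite !mxE rmorphXn.
Qed.

Lemma sqr_normcE (z : R[i]) : (normc z ^+ 2)%:C = z^* * z.
Proof.
case: z => a b; rewrite /normc sqr_sqrtr ?addr_ge0 ?sqr_ge0//.
by simpc; congr (_ +i* _); ring.
Qed.

Lemma l2norm_ge0 n (v : 'cV[R[i]]_n) : 0 <= l2norm v.
Proof. exact: sqrtr_ge0. Qed.

Lemma sqr_l2norm n (v : 'cV[R[i]]_n) : l2norm v ^+ 2 = \sum_i normc (v i 0) ^+ 2.
Proof. by rewrite sqr_sqrtr// sumr_ge0// => i _; exact: sqr_ge0. Qed.

Lemma l2normE n (v : 'cV[R[i]]_n) :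
  (l2norm v ^+ 2)%:C = ((map_mx Num.conj v^T) *m v) 0 0.
Proof.
rewrite sqr_l2norm rmorph_sum mxE; apply: eq_bigr => i _ /=.
by rewrite !mxE sqr_normcE.
Qed.

Lemma l2norm_unitary n (U : 'M[R[i]]_n) (v : 'cV[R[i]]_n) : U \is unitarymx ->
  l2norm (U *m v) = l2norm v.
Proof.
move=> UU; apply/eqP; rewrite -(@eqrXn2 _ 2)// ?l2norm_ge0//; apply/eqP.
apply: (@complexI R); rewrite !l2normE trmx_mul map_mxM mulmxA.
have := UU; rewrite -trmxC_unitary => /unitarymxP.
rewrite map_trmx trmxK -map_mx_comp (map_mx_id (@conjCK _)) => H.
by rewrite -[_ *m _ *m U]mulmxA H mulmx1.
Qed.

Lemma l2norm_hermitian n (A : 'M[R[i]]_n) (v : 'cV[R[i]]_n) : A \is hermsymmx ->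
  l2norm (A *m v) ^+ 2 =
  \sum_k ev A k ^+ 2 * normc ((spectralmx A *m v) k 0) ^+ 2.
Proof.
move=> hA; have PU := spectral_unitarymx A; set P := spectralmx A in PU *.
rewrite {1}(hermitian_spectralE hA) -/P -!mulmxA l2norm_unitary; last exact: invmx_unitarymx.
rewrite sqr_l2norm; apply: eq_bigr => k _; rewrite mul_diag_mx mxE mxE.
by rewrite ComplexField.Normc.normcM exprMn /= expr0n addr0 sqrtr_sqr real_normK ?num_real.
Qed.

(** In a unitary eigenbasis the matrix is diagonal, so its norm is the largest |eigenvalue|.
    Comparing with M >= 0 also covers the empty matrix, which has norm 0 and no eigenvalue. *)
Lemma opnorm_gtE n (A : 'M[R[i]]_n) (M : R) : A \is hermsymmx -> 0 <= M ->
  (M < opnorm A) = [exists k, M < `|ev A k|].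
Proof.
move=> hA M0; have PU := spectral_unitarymx A; have Pu := spectral_unit A.
set P := spectralmx A in PU Pu.
set S := [set l2norm (A *m v) | v in [set v : 'cV[R[i]]_n | l2norm v <= 1]].
have ubS (C : R) : 0 <= C -> (forall k, `|ev A k| <= C) -> ubound S C.
  move=> C0 HC _ [v /= v1 <-].
  rewrite -(@ler_pXn2r _ 2) ?nnegrE ?l2norm_ge0// l2norm_hermitian//.
  apply: (@le_trans _ _ (\sum_k C ^+ 2 * normc ((P *m v) k 0) ^+ 2)).
    apply: ler_sum => k _; rewrite ler_wpM2r ?sqr_ge0//.
    by rewrite -real_normK ?num_real// ler_pXn2r ?nnegrE.
  rewrite -mulr_sumr -sqr_l2norm l2norm_unitary// ler_piMr ?sqr_ge0//.
  by rewrite expr_le1 ?l2norm_ge0.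
have S0 : S !=set0.
  exists (l2norm (A *m 0)), 0 => //=.
  rewrite /l2norm big1 ?sqrtr0// => i _.
  by rewrite mxE ComplexField.Normc.normc0 expr0n.
have hasS : has_sup S.
  split=> //; exists (\sum_k `|ev A k|); apply: ubS; first by apply: sumr_ge0.
  by move=> k; rewrite (bigD1 k)//= lerDl sumr_ge0.
apply/idP/existsP => [MA|[k Mk]].
  apply: contrapT => H; move: MA; apply/negP; rewrite -leNgt.
  apply: ge_sup => //; apply: ubS => // k; rewrite leNgt; apply/negP => Mk.
  by apply: H; exists k.
apply: lt_le_trans Mk _; apply: ub_le_sup; first exact: hasS.2.
(* The unit eigenvector of the k-th eigenvalue. *)
exists (invmx P *m delta_mx k 0) => /=.
  rewrite l2norm_unitary; last exact: invmx_unitarymx.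
  rewrite /l2norm (bigD1 k)//= big1 => [|i ik].
    by rewrite mxE !eqxx ComplexField.Normc.normc1 expr1n addr0 sqrtr1.
  by rewrite mxE (negbTE ik) ComplexField.Normc.normc0 expr0n.
apply/eqP; rewrite -(@eqrXn2 _ 2)// ?l2norm_ge0//; apply/eqP.
rewrite l2norm_hermitian// -/P mulmxA mulmxV// mul1mx (bigD1 k)//= big1 => [|i ik].
  by rewrite mxE !eqxx ComplexField.Normc.normc1 expr1n addr0 mulr1 real_normK ?num_real.
by rewrite mxE (negbTE ik) ComplexField.Normc.normc0 expr0n mulr0.
Qed.

End HermitianMatrices.

(** * Linear statistics of random points with integrable products of power sums *)

Section LinearStatistics.
Context (d : measure_display) (T : measurableType d) (R : realType).
Variables (P : probability T R) (n : nat) (lam : T -> 'I_n -> R).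

Definition lstat (g : R -> R) (w : T) : R := \sum_k g (lam w k).

Hypothesis lam_int : forall s : seq nat, P.-integrable [set: T]
  (EFin \o (fun w => \prod_(k <- s) lstat (fun x => x ^+ k) w)).

Lemma lstat_affine a g h : lstat (fun x => a * g x + h x) = fun w => a * lstat g w + lstat h w.
Proof.
by apply/funext => w; rewrite /lstat mulr_sumr -big_split.
Qed.

Lemma lstatB g h : lstat (fun x => g x - h x) = fun w => lstat g w - lstat h w.
Proof. by apply/funext => w; rewrite /lstat sumrB. Qed.

Lemma lstat_sum (m : nat) (c : 'I_m -> R) (g : 'I_m -> R -> R) :
  lstat (fun x => \sum_(i < m) c i * g i x) = fun w => \sum_(i < m) c i * lstat (g i) w.
Proof.
apply/funext => w; rewrite /lstat exchange_big /=.
by apply: eq_bigr => i _; rewrite mulr_sumr.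
Qed.

Lemma lstat_norm_le g h : (forall x, `|g x| <= h x) ->
  forall w, `|lstat g w| <= lstat h w.
Proof.
by move=> gh w; apply: le_trans (ler_norm_sum _ _ _) _; apply: ler_sum => k _; exact: gh.
Qed.

(** An even power of a power sum is one of the products in [lam_int], and |t|^m is dominated by 1 +
    t^(2m). *)
Lemma allmom_power k : allmom P (lstat (fun x => x ^+ k)).
Proof.
have mk : measurable_fun [set: T] (lstat (fun x => x ^+ k)).
  have /measurable_int/measurable_EFinP := lam_int [:: k].
  by under eq_fun do rewrite big_seq1.
split=> // m.
have i2 : P.-integrable [set: T] (EFin \o (fun w => lstat (fun x => x ^+ k) w ^+ m.*2)).
  have := lam_int (nseq m.*2 k); congr (_.-integrable _ _).
  by apply/funext => w /=; rewrite big_nseq -Monoid.iteropE.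
apply: le_integrable_real (integrable_sumr (allmom_integrable (allmom_cst P 1)) i2).
  by apply: measurable_funX; exact: measurableT_comp.
move=> w; set t := lstat _ w.
have -> : t ^+ m.*2 = (`|t| ^+ m) ^+ 2.
  by rewrite -exprM muln2 -normrX ger0_norm// -muln2 exprM sqr_ge0.
rewrite normrX normr_id [leRHS]ger0_norm ?addr_ge0 ?sqr_ge0//.
have := sqr_ge0 (`|t| ^+ m - 1); have := sqr_ge0 (`|t| ^+ m); nra.
Qed.

Lemma lstat_horner (p : {poly R}) :
  lstat (horner p) = fun w => \sum_(i < size p) p`_i * lstat (fun x => x ^+ i) w.
Proof. by rewrite -lstat_sum; congr lstat; apply/funext => x; rewrite horner_coef. Qed.

Lemma allmom_lstat_horner (p : {poly R}) : allmom P (lstat (horner p)).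
Proof. by rewrite lstat_horner; apply: allmom_sum => i _; apply: allmomZ; exact: allmom_power. Qed.

(** No measurability of a single [lam w k] is assumed. Polynomial statistics are measurable as
    combinations of power sums, and the statistic of [g] is their pointwise limit: the m-th
    polynomial is within 1/(m+1) of [g] on [-(m+1), m+1], an interval that eventually contains the
    finitely many points [lam w k]. *)
Lemma measurable_lstat (g : R -> R) : continuous g -> measurable_fun [set: T] (lstat g).
Proof.
move=> cg.
have H (m : nat) : exists p : {poly R}, forall x : R, `|x| <= m.+1%:R -> `|g x - p.[x]| <= m.+1%:R^-1.
  by apply: weierstrass.
have [p Hp] := choice H.
apply: (@measurable_fun_cvg _ _ _ _ (fun m => lstat (horner (p m)))) => [m|w _].
  exact: (allmom_lstat_horner (p m)).1.
rewrite /lstat; apply: cvgR_sum => k; apply: cvgR_intro => e e0.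
have [N1 HN1] : exists N : nat, `|lam w k| < N%:R.
  by exists (Num.bound `|lam w k|); apply: archi_boundP.
have [N2 HN2] : exists N : nat, e^-1 < N%:R.
  by exists (Num.bound e^-1); apply: archi_boundP; rewrite invr_ge0 ltW.
exists (maxn N1 N2) => m; rewrite geq_max => /andP[m1 m2].
have H1 : `|lam w k| <= m.+1%:R.
  by apply: le_trans (ltW HN1) _; rewrite ler_nat ltnW.
rewrite distrC; apply: le_trans (Hp m _ H1) _.
rewrite -[e]invrK lef_pV2 ?posrE ?invr_gt0//.
by apply: le_trans (ltW HN2) _; rewrite ler_nat ltnW.
Qed.

Lemma allmom_lstat (g : R -> R) (c : R) k : continuous g -> (forall x, `|g x| <= c * (1 + x ^+ k)) ->
  allmom P (lstat g).
Proof.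
move=> cg gc.
have aW : allmom P (lstat (fun x => c * (1 + x ^+ k))).
  have -> : (fun x => c * (1 + x ^+ k)) = horner (c *: (1 + 'X^k)).
    by apply/funext => x; rewrite !hornerE.
  exact: allmom_lstat_horner.
apply: (allmom_le (measurable_lstat cg) _ aW) => w.
exact: le_trans (lstat_norm_le gc w) (ler_norm _).
Qed.

(** The event says that the statistic of the continuous function max(|x| - M, 0) is positive. *)
Lemma measurable_max_eigenvalue (M : R) : measurable [set w | [exists k, M < `|lam w k|]].
Proof.
pose u (x : R) : R := Num.max (`|x| - M) 0.
have cu : continuous u.
  move=> x; apply: (@continuous_max R R (fun x => `|x| - M) (fun=> 0)); last exact: cvg_cst.
  by apply: cvgB; [exact: norm_continuous|exact: cvg_cst].
have mu := measurable_lstat cu.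
have -> : [set w | [exists k, M < `|lam w k|]] = lstat u @^-1` `]0, +oo[.
  apply/seteqP; split => w /=; rewrite in_itv /= andbT.
    move=> /existsP[k Mk]; rewrite /lstat (bigD1 k)//= ltr_pwDl//.
      by rewrite /u lt_max subr_gt0 Mk.
    by apply: sumr_ge0 => i _; rewrite /u le_max lexx orbT.
  move=> H; apply/existsP; apply: contrapT => H'; move: H.
  rewrite /lstat big1 ?ltxx// => k _; rewrite /u max_r// subr_le0 leNgt.
  by apply/negP => Mk; apply: H'; exists k.
rewrite -[X in measurable X]setTI; exact: mu.
Qed.

End LinearStatistics.

(** * Extension of C^1 functions beyond [-M, M], and approximation of derivatives *)

Section C1Extension.
Context {R : realType}.
Implicit Types (u v h g : R -> R) (x : R).

Lemma is_derive_epsP h (x d : R) : is_derive x 1 h d <->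
  forall e, 0 < e -> exists2 dl : R, 0 < dl &
    forall t, `|t| < dl -> `|h (x + t) - h x - d * t| <= e * `|t|.
Proof.
split=> [[dh hd] e e0|H].
- have : (t^-1 *: (h (t *: 1 + x) - h x)) @[t --> (0 : R)^'] --> d.
    by rewrite -hd; exact: dh.
  move=> /cvgrPdist_le /(_ e e0); rewrite near_withinE => /nbhs_ballP[dl /= dl0 Hdl].
  exists dl => // t tdl.
  have [->|t0] := eqVneq t 0; first by rewrite addr0 subrr mulr0 subr0 normr0 mulr0.
  have : ball 0 dl t by rewrite -ball_normE /= sub0r normrN.
  move=> /Hdl /(_ t0); rewrite /GRing.scale /= mulr1 distrC => H.
  have -> : h (x + t) - h x - d * t = (t^-1 * (h (t + x) - h x) - d) * t.
    by rewrite [t + x]addrC; field.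
  by rewrite normrM ler_wpM2r.
- have H1 : (t^-1 *: (h (t *: 1 + x) - h x)) @[t --> (0 : R)^'] --> d.
    apply/cvgrPdist_le => e e0; have [dl dl0 Hdl] := H e e0.
    rewrite near_withinE; apply/nbhs_ballP; exists dl => //= t.
    rewrite -ball_normE /= sub0r normrN => tdl t0.
    have := Hdl t tdl; rewrite /GRing.scale /= mulr1 [X in _ -> X <= _]distrC.
    have -> : h (x + t) - h x - d * t = (t^-1 * (h (t + x) - h x) - d) * t.
      by rewrite [t + x]addrC; field.
    by rewrite normrM ler_pM2r ?normr_gt0.
  by apply: DeriveDef; [apply/cvg_ex; exists d|exact: cvg_lim H1].
Qed.

Lemma is_derive_glue u v (du dv : R -> R) (a : R) :
  (forall x, is_derive x 1 u (du x)) -> (forall x, is_derive x 1 v (dv x)) ->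
  u a = v a -> du a = dv a ->
  forall x, is_derive x 1 (fun y => if y <= a then u y else v y)
    (if x <= a then du x else dv x).
Proof.
move=> Du Dv uv duv x; apply/is_derive_epsP => e e0.
have [d1 d10 H1] := (is_derive_epsP u x (du x)).1 (Du x) e e0.
have [d2 d20 H2] := (is_derive_epsP v x (dv x)).1 (Dv x) e e0.
have [xa|ax|xa] := ltgtP x a.
- exists (Num.min d1 (a - x)) => [|t]; first by rewrite lt_min d10 subr_gt0.
  rewrite lt_min => /andP[t1 t2]; rewrite ifT; first exact: H1.
  by have := ler_norm t; lra.
- exists (Num.min d2 (x - a)) => [|t]; first by rewrite lt_min d20 subr_gt0.
  rewrite lt_min => /andP[t1 t2]; rewrite ifF; first exact: H2.
  by apply/negbTE; rewrite -ltNge; have := ler_norm (- t); rewrite normrN; lra.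
- subst x; exists (Num.min d1 d2) => [|t]; first by rewrite lt_min d10.
  rewrite lt_min => /andP[t1 t2]; case: ifP => _; first exact: H1.
  by rewrite uv duv; exact: H2.
Qed.

Lemma is_derive_continuous h (dh : R -> R) :
  (forall x, is_derive x 1 h (dh x)) -> continuous h.
Proof.
move=> H x; apply/differentiable_continuous/derivable1_diffP.
exact: (@ex_derive _ _ _ _ _ _ _ (H x)).
Qed.

Lemma is_derive_lipschitz h (dh : R -> R) (D : R) :
  (forall x, is_derive x 1 h (dh x)) -> (forall x, `|dh x| <= D) ->
  forall x y : R, `|h x - h y| <= D * `|x - y|.
Proof.
move=> H HD.
have ch (a b : R) : {within `[a, b], continuous h}.
  by apply: continuous_subspaceT; exact: is_derive_continuous H.
have main (x y : R) : y <= x -> `|h x - h y| <= D * `|x - y|.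
  move=> yx; have [c _ ->] := MVT_segment yx (fun z _ => H z) (ch y x).
  by rewrite normrM ler_wpM2r.
move=> x y; have [|/ltW] := leP y x; first exact: main.
by rewrite distrC [`|x - y|]distrC; exact: main.
Qed.

Lemma C1_extension g (dg : R -> R) (M : R) : 0 < M ->
  (forall x, is_derive x 1 g (dg x)) -> continuous dg ->
  exists h dh : R -> R, [/\ forall x, is_derive x 1 h (dh x), continuous dh,
    forall x, `|x| <= M -> h x = g x &
    forall x, exists2 y, `|y| <= M & dh x = dg y].
Proof.
move=> M0 Dg cdg.
have lin (a b c : R) : forall x, is_derive x 1 (fun y => a + b * (y - c)) b.
  move=> x; apply/is_derive_epsP => e e0; exists 1 => // t _.
  have -> : a + b * (x + t - c) - (a + b * (x - c)) - b * t = 0 by ring.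
  by rewrite normr0 mulr_ge0// ltW.
pose w1 x := if x <= M then g x else g M + dg M * (x - M).
pose dw1 x := if x <= M then dg x else dg M.
have Dw1 x : is_derive x 1 w1 (dw1 x).
  by apply: (is_derive_glue Dg (lin _ _ _)) => //; rewrite subrr mulr0 addr0.
have MM : - M <= M by lra.
exists (fun x => if x <= - M then g (- M) + dg (- M) * (x - - M) else w1 x).
exists (fun x => if x <= - M then dg (- M) else dw1 x).
(* The derivative of the extension is [dg] at the point of [-M, M] nearest to [x]; its continuity
   and its bound both follow. *)
have clampE x : (if x <= - M then dg (- M) else dw1 x) =
    dg (Num.max (- M) (Num.min M x)).
  rewrite /dw1; have [x1|x1] := leP x (- M).
    by rewrite (min_r (le_trans x1 MM)) max_l.
  by have [x2|x2] := leP x M; [rewrite max_r// ltW|rewrite max_r].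
split.
- apply: (is_derive_glue (lin _ _ _) Dw1).
    by rewrite /w1 MM subrr mulr0 addr0.
  by rewrite /dw1 MM.
- have -> : (fun x => if x <= - M then dg (- M) else dw1 x) =
     (fun x => dg (Num.max (- M) (Num.min M x))) by apply/funext.
  have c1 : continuous (Num.min (M : R) : R -> R).
    by move=> x; exact: (@continuous_min R R (fun=> M) id x (cvg_cst _) cvg_id).
  have c2 : continuous (fun x : R => Num.max (- M) (Num.min M x)).
    by move=> x; exact: (@continuous_max R R (fun=> - M) (Num.min M) x (cvg_cst _) (c1 x)).
  by move=> x; apply: continuous_comp; [exact: c2|exact: cdg].
- move=> x; rewrite ler_norml => /andP[x1 x2]; rewrite /w1 x2.
  case: ifP => // x3; have -> : x = - M by apply/eqP; rewrite eq_le x1 x3.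
  by rewrite subrr mulr0 addr0.
- move=> x; exists (Num.max (- M) (Num.min M x)); last exact: clampE.
  by rewrite ler_norml le_max lexx /= ge_max MM ge_min lexx.
Qed.

Lemma continuous_seg_bounded (g : R -> R) (M : R) : 0 < M -> continuous g ->
  exists2 C : R, 0 <= C & forall x, `|x| <= M -> `|g x| <= C.
Proof.
move=> M0 cg; have MM : - M <= M by lra.
have cs : {within `[- M, M], continuous (fun x => `|g x|)}.
  apply: continuous_subspaceT => x.
  by apply: continuous_comp; [exact: cg|exact: norm_continuous].
have [c _ H] := EVT_max MM cs.
by exists `|g c| => // x; rewrite ler_norml => xM; apply: H; rewrite in_itv.
Qed.

(* The polynomial is taken without constant term, in the form X q, because the
   covariances of traces are only given for positive powers. *)
Lemma C1_poly_approx (dg : R -> R) (M e : R) : 0 < M -> 0 < e -> continuous dg ->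
  exists q : {poly R}, forall x, `|x| <= M -> `|dg x - (('X * q)^`()).[x]| <= e.
Proof.
move=> M0 e0 cdg; have [p Hp] := weierstrass M0 e0 cdg.
exists (\poly_(i < size p) (p`_i / i.+1%:R)) => x xM.
suff -> : ('X * \poly_(i < size p) (p`_i / i.+1%:R))^`() = p by exact: Hp.
apply/polyP => i; rewrite coef_deriv coefXM /= coef_poly.
case: ltnP => ip; last by rewrite mul0rn nth_default.
by rewrite -[LHS]mulr_natr divfK// pnatr_eq0.
Qed.

End C1Extension.

(** * Multilinearity of cumulants and the cumulant central limit theorem *)

Lemma cvgR_const (R : realType) (u : nat -> R) (l : R) :
  (forall n, u n = l) -> u n @[n --> \oo] --> l.
Proof. by move=> /funext ->; exact: cvg_cst. Qed.

(** Each partition has exactly one block containing [i0], so each of its products is linear in one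
    factor. [m' j] gives the expectations after the variable at [i0] has been replaced by the j-th
    summand. *)
Lemma pcum_multilinear (A : comNzRingType) (I : finType) (i0 : I) (D : {set I})
    (J : nat) (c : 'I_J -> A) (m : {set I} -> A) (m' : 'I_J -> {set I} -> A) :
  i0 \in D ->
  (forall B : {set I}, i0 \in B -> m B = \sum_j c j * m' j B) ->
  (forall j (B : {set I}), i0 \notin B -> m' j B = m B) ->
  pcum m D = \sum_j c j * pcum (m' j) D.
Proof.
move=> iD mE m'E; rewrite /pcum.
under [RHS]eq_bigr do rewrite mulr_sumr.
rewrite [RHS]exchange_big /=; apply: eq_bigr => p pD.
have ip : i0 \in finset.cover p by rewrite (cover_partition pD).
have Bp := pblock_mem ip.
rewrite (bigD1 (finset.pblock p i0))//= mE ?finset.mem_pblock//.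
rewrite mulr_suml mulr_sumr; apply: eq_bigr => j _.
rewrite [in RHS](bigD1 (finset.pblock p i0))//=.
have -> : \prod_(B in p | B != finset.pblock p i0) m' j B =
    \prod_(B in p | B != finset.pblock p i0) m B.
  apply: eq_bigr => B /andP[Bin BB]; apply: m'E.
  apply: contraNN BB => iB; apply/eqP; symmetry.
  exact: finset.def_pblock (partition_trivIset pD) Bin iB.
by rewrite -!mulrA [RHS]mulrCA; congr (_ * _); rewrite [RHS]mulrCA.
Qed.

Section CumulantCLT.
Context {R : realType} (d : nat -> measure_display) (T : forall N, measurableType (d N)).
Context (P : forall N, probability (T N) R) (Z : forall N, T N -> R) (s : R).
Hypothesis aZ : forall N, allmom (P N) (@Z N).

Let mu N n := mean (P N) (fun w => Z w ^+ n).

Hypothesis var_cvg : mu N 2 - mu N 1 ^+ 2 @[N --> \oo] --> s.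
Hypothesis cum_cvg : forall r, (3 <= r)%N -> ncum (mu N) r @[N --> \oo] --> (0 : R).

(** The recursion for central moments passes to the limit: the second cumulant tends to [s], and
    every other term carries a cumulant tending to 0 times a convergent central moment of lower
    order. *)
Lemma central_moments_cvg n :
  mean (P N) (fun w => (Z w - mean (P N) (@Z N)) ^+ n) @[N --> \oo] --> gmom s n.
Proof.
have aX N k : allmom (P N) (fun w => Z w ^+ k) by exact: allmomX.
have mu0 N : mu N 0 = 1.
  by rewrite /mu; under eq_fun do rewrite expr0; rewrite mean_cst.
have mu1 N : mu N 1 = mean (P N) (@Z N).
  by rewrite /mu; under eq_fun do rewrite expr1.
have MC N k := moment_cumulant k (mu0 N).
have k1 N : ncum (mu N) 1 = mean (P N) (@Z N).
  by rewrite -mu1 MC big_ord1 /= subnn mu0 mulr1.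
have k2 N : ncum (mu N) 2 = mu N 2 - mu N 1 ^+ 2.
  rewrite (MC N 1%N) big_ord_recl big_ord1 /= !subn0 subnn mu0 mulr1 k1 -mu1.
  by rewrite expr2 /= !mulr1n addrAC subrr add0r.
(* The expectation of a polynomial in [Z], seen as a linear functional of the polynomial, is the
   setting of [central_moment_rec]. *)
pose L N (p : {poly R}) := mean (P N) (fun w => p.[Z w]).
have aH N p : allmom (P N) (fun w => p.[Z w]) by exact: allmom_horner.
have Llin N a p q : L N (a *: p + q) = a * L N p + L N q.
  rewrite /L -meanZ// -meanD//; last exact: allmomZ.
  by congr mean; apply/funext => w; rewrite !hornerE.
have LX N k : L N ('X^(k.+1) : {poly R}) =
    \sum_(j < k.+1) (ncum (mu N) j.+1 * L N ('X^(k - j) : {poly R})) *+ 'C(k, j).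
  have E i : L N ('X^i : {poly R}) = mu N i.
    by rewrite /L; congr mean; apply/funext => w; rewrite hornerXn.
  by rewrite E MC; apply: eq_bigr => j _; rewrite E.
have LE N k : mean (P N) (fun w => (Z w - mean (P N) (@Z N)) ^+ k) =
    L N (('X - (mean (P N) (@Z N))%:P) ^+ k).
  by congr mean; apply/funext => w; rewrite horner_exp hornerXsubC.
have rec N k := central_moment_rec (Llin N) (LX N) k (esym (k1 N)).
have [m] := ubnP n; elim: m n => // m IH [|[|n]] nm.
- by rewrite gmom0; apply: cvgR_const => N; under eq_fun do rewrite expr0; rewrite mean_cst.
- rewrite gmom1; apply: cvgR_const => N; under eq_fun do rewrite expr1.
  by rewrite meanB ?mean_cst ?subrr//; exact: allmom_cst.
- have -> : (fun N => mean (P N) (fun w => (Z w - mean (P N) (@Z N)) ^+ n.+2)) =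
    (fun N => \sum_(j < n.+1) (ncum (mu N) j.+2 *
       mean (P N) (fun w => (Z w - mean (P N) (@Z N)) ^+ (n.+1 - j.+1))) *+ 'C(n.+1, j.+1)).
    by apply/funext => N; rewrite LE rec; apply: eq_bigr => j _; rewrite LE.
  (* The two-step recursion of [gmom], padded with zero terms; its factor n + 1 is 'C(n.+1, 1). *)
  rewrite (_ : gmom s n.+2 = \sum_(j < n.+1)
     ((if j == ord0 then s else 0) * gmom s (n.+1 - j.+1)) *+ 'C(n.+1, j.+1)); last first.
    rewrite big_ord_recl big1 /= ?addr0 => [|j _]; last by rewrite mul0r mul0rn.
    by rewrite subn1 /= bin1 gmomSS -[RHS]mulr_natl mulrA.
  apply: cvgR_sum => j; rewrite -[X in _ --> X]mulr_natr.
  under eq_cvg do rewrite -mulr_natr.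
  apply: cvgM; last exact: cvg_cst.
  apply: cvgM; last first.
    apply: IH; rewrite subSS ltnS in nm *.
    by apply: leq_ltn_trans (leq_subr _ _) _; exact: ltnW.
  case: eqP => [->|/eqP j0].
    by under eq_cvg do rewrite k2; exact: var_cvg.
  by apply: cum_cvg; rewrite !ltnS lt0n -val_eqE in j0 *.
Qed.

End CumulantCLT.

(** * Gaussian limits of the central moments of polynomial statistics *)

Section LinearStatisticsCLT.
Context {R : realType} (d : nat -> measure_display) (T : forall N, measurableType (d N)).
Context (P : forall N, probability (T N) R) (lam : forall N, T N -> 'I_N -> R).
Local Notation tau N k := (lstat (@lam N) (fun x => x ^+ k)).
Hypothesis lam_int : forall N (s : seq nat), (P N).-integrable [set: T N]
  (EFin \o (fun w => \prod_(k <- s) tau N k w)).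
Variable alpha2 : nat -> nat -> R.
Hypothesis cov_cvg : forall m n, (0 < m)%N -> (0 < n)%N ->
  mean (P N) (fun w => tau N m w * tau N n w) - mean (P N) (tau N m) * mean (P N) (tau N n)
    @[N --> \oo] --> alpha2 m n.
Hypothesis cum_cvg : forall r (n : 'I_r -> nat), (3 <= r)%N -> (forall i, (0 < n i)%N) ->
  pcum (fun B : {set 'I_r} => mean (P N) (fun w => \prod_(i in B) tau N (n i) w))
    [set: 'I_r]%SET @[N --> \oo] --> (0 : R).

(** The covariance form at (X q, X q) in coordinates. The shift by one in the indices of [alpha2]
    comes from the factor X. *)
Definition poly_var (q : {poly R}) : R :=
  \sum_(i < size q) q`_i * \sum_(j < size q) q`_j * alpha2 i.+1 j.+1.

Local Notation pstat q N := (lstat (@lam N) (horner ('X * q))).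

Lemma pstatE (q : {poly R}) N w : pstat q N w = \sum_(j < size q) q`_j * tau N j.+1 w.
Proof.
have -> : horner ('X * q) = fun x => \sum_(j < size q) q`_j * x ^+ j.+1.
  apply/funext => x; rewrite hornerM hornerX horner_coef mulr_sumr.
  by apply: eq_bigr => j _; rewrite exprS mulrCA.
exact: (congr1 (fun F => F w) (lstat_sum (@lam N) (fun j : 'I_(size q) => q`_j)
  (fun j x => x ^+ j.+1))).
Qed.

Lemma allmom_tau N k : allmom (P N) (tau N k).
Proof. exact: (allmom_power (lam_int N)). Qed.

Lemma allmom_pstat q N : allmom (P N) (pstat q N).
Proof. exact: (allmom_lstat_horner (lam_int N)). Qed.

Lemma pstat_var_cvg (q : {poly R}) :
  mean (P N) (fun w => pstat q N w ^+ 2) - mean (P N) (pstat q N) ^+ 2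
    @[N --> \oo] --> poly_var q.
Proof.
have Emean N : mean (P N) (pstat q N) = \sum_(j < size q) q`_j * mean (P N) (tau N j.+1).
  have -> : pstat q N = (fun w => \sum_(j < size q) q`_j * tau N j.+1 w).
    by apply/funext => w; exact: pstatE.
  rewrite mean_sum => [|j _]; last by apply: allmomZ; exact: allmom_tau.
  by apply: eq_bigr => j _; rewrite meanZ//; exact: allmom_tau.
have E N : mean (P N) (fun w => pstat q N w ^+ 2) - mean (P N) (pstat q N) ^+ 2 =
  \sum_(i < size q) q`_i * \sum_(j < size q) q`_j *
    (mean (P N) (fun w => tau N i.+1 w * tau N j.+1 w) -
     mean (P N) (tau N i.+1) * mean (P N) (tau N j.+1)).
  have aT k := allmom_tau N k.
  have aTT k l : allmom (P N) (fun w => tau N k w * tau N l w) by exact: allmomM.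
  rewrite Emean expr2 mulr_suml.
  have -> : (fun w => pstat q N w ^+ 2) = (fun w => \sum_(i < size q) q`_i *
       \sum_(j < size q) q`_j * (tau N i.+1 w * tau N j.+1 w)).
    apply/funext => w; rewrite pstatE expr2 mulr_suml; apply: eq_bigr => i _.
    rewrite -mulrA mulr_sumr; congr (_ * _); apply: eq_bigr => j _.
    by rewrite mulrCA.
  have aS i : allmom (P N) (fun w => \sum_(j < size q) q`_j * (tau N i w * tau N j.+1 w)).
    by apply: allmom_sum => j _; exact: allmomZ.
  rewrite mean_sum => [|i _]; last exact: allmomZ.
  rewrite -sumrB; apply: eq_bigr => i _; rewrite meanZ// -mulrA -mulrBr; congr (_ * _).
  rewrite mean_sum => [|j _]; last exact: allmomZ.
  rewrite mulr_sumr -sumrB; apply: eq_bigr => j _; rewrite meanZ//; ring.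
rewrite (funext E).
apply: cvgR_sum => i; apply: cvgM; first exact: cvg_cst.
apply: cvgR_sum => j; apply: cvgM; first exact: cvg_cst.
exact: cov_cvg.
Qed.

(* S is the set of the indices at which the statistic of X q has not yet been
   expanded into power sums. *)
Let mixed (q : {poly R}) r (S : {set 'I_r}) (n : 'I_r -> nat) N (i : 'I_r) : T N -> R :=
  if i \in S then pstat q N else tau N (n i).
Arguments mixed : clear implicits.

(** Induction on the size of [S]: multilinearity at a single index turns the cumulant into a
    combination of cumulants for a smaller set. At the end all arguments are power sums and
    [cum_cvg] applies. *)
Lemma mixed_cum_cvg (q : {poly R}) r (S : {set 'I_r}) (n : 'I_r -> nat) : (3 <= r)%N ->
  (forall i, (0 < n i)%N) ->
  pcum (fun B : {set 'I_r} => mean (P N) (fun w => \prod_(i in B) mixed q r S n N i w))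
    [set: 'I_r]%SET @[N --> \oo] --> (0 : R).
Proof.
move=> r3; have [m] := ubnP #|S|; elim: m S n => // m IH S n Sm n0.
have amix S' n' N i : allmom (P N) (mixed q r S' n' N i).
  by rewrite /mixed; case: ifP => _; [exact: allmom_pstat|exact: allmom_tau].
have [S0|[i0 iS]] := set_0Vmem S.
  have -> : (fun N => pcum (fun B : {set 'I_r} =>
      mean (P N) (fun w => \prod_(i in B) mixed q r S n N i w)) [set: 'I_r]%SET) =
    (fun N => pcum (fun B : {set 'I_r} =>
      mean (P N) (fun w => \prod_(i in B) tau N (n i) w)) [set: 'I_r]%SET).
    apply/funext => N; congr pcum; apply/funext => B; congr mean; apply/funext => w.
    by apply: eq_bigr => i _; rewrite /mixed S0 finset.in_set0.
  exact: cum_cvg.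
(* The coefficient q_j belongs to X^(j+1) in X q. *)
pose n' (j : 'I_(size q)) i := if i == i0 then j.+1 else n i.
have E N : pcum (fun B : {set 'I_r} =>
      mean (P N) (fun w => \prod_(i in B) mixed q r S n N i w)) [set: 'I_r]%SET =
    \sum_(j < size q) q`_j * pcum (fun B : {set 'I_r} =>
      mean (P N) (fun w => \prod_(i in B) mixed q r (S :\ i0)%SET (n' j) N i w)) [set: 'I_r]%SET.
  have same j i : i != i0 -> mixed q r (S :\ i0)%SET (n' j) N i = mixed q r S n N i.
    by move=> ii; rewrite /mixed !inE ii /n' (negbTE ii).
  apply: (pcum_multilinear (i0 := i0)) => [|B iB|j B iB]; first by rewrite inE.
  - have aj j : allmom (P N) (fun w => \prod_(i in B) mixed q r (S :\ i0)%SET (n' j) N i w).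
      by apply: allmom_prod.
    under [RHS]eq_bigr do rewrite -meanZ//.
    rewrite -mean_sum => [|j _]; last exact: allmomZ.
    congr mean; apply/funext => w.
    rewrite (bigD1 i0)//= {1}/mixed iS pstatE mulr_suml; apply: eq_bigr => j _.
    rewrite [in RHS](bigD1 i0)//= {2}/mixed !inE eqxx /= /n' eqxx mulrA; congr (_ * _).
    by apply: eq_bigr => i /andP[_ ii]; rewrite same.
  - congr mean; apply/funext => w; apply: eq_bigr => i Bi; rewrite same//.
    by apply: contraNneq iB => <-.
rewrite (funext E).
rewrite [X in _ --> X](_ : _ = \sum_(j < size q) (0 : R)); last by rewrite big1.
apply: cvgR_sum => j; rewrite -[X in _ --> X](mulr0 q`_j).
apply: cvgM; first exact: cvg_cst.
apply: IH => [|i]; last by rewrite /n'; case: ifP.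
by rewrite ltnS in Sm; move: Sm; rewrite (cardsD1 i0) iS.
Qed.

Lemma pstat_central_moments (q : {poly R}) n :
  mean (P N) (fun w => (pstat q N w - mean (P N) (pstat q N)) ^+ n)
    @[N --> \oo] --> gmom (poly_var q) n.
Proof.
apply: (@central_moments_cvg R d T P (fun N => pstat q N)) => [N||r r3].
- exact: allmom_pstat.
- under eq_cvg => N.
    rewrite (_ : mean (P N) (fun w => pstat q N w ^+ 1) = mean (P N) (pstat q N)); last first.
      by congr mean; apply/funext => w; rewrite expr1.
    over.
  exact: pstat_var_cvg.
- have E N : ncum (fun k => mean (P N) (fun w => pstat q N w ^+ k)) r =
      pcum (fun B : {set 'I_r} => mean (P N) (fun w => \prod_(i in B)
        mixed q r [set: 'I_r]%SET (fun=> 1%N) N i w)) [set: 'I_r]%SET.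
    congr pcum; apply/funext => B; congr mean; apply/funext => w.
    by under [RHS]eq_bigr do rewrite /mixed finset.in_setT; rewrite prodr_const.
  by rewrite (funext E); exact: mixed_cum_cvg.
Qed.

End LinearStatisticsCLT.

(** * Polynomial growth and Lipschitz bounds *)

Section PolynomialGrowth.
Context {R : realType}.
Implicit Types (g h : R -> R) (x : R).

Definition polygrowth g := exists (c : R) (k : nat),
  0 <= c /\ forall x, `|g x| <= c * (1 + `|x|) ^+ k.

Lemma polygrowthD g h : polygrowth g -> polygrowth h -> polygrowth (fun x => g x + h x).
Proof.
move=> [c [k [c0 Hg]]] [c' [k' [c'0 Hh]]].
exists (c + c'), (k + k')%N; split=> [|x]; first exact: addr_ge0.
have x1 : 1 <= 1 + `|x| by rewrite lerDl.
apply: le_trans (ler_normD _ _) _; rewrite mulrDl; apply: lerD.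
  by apply: le_trans (Hg x) _; rewrite ler_wpM2l// ler_weXn2l// leq_addr.
by apply: le_trans (Hh x) _; rewrite ler_wpM2l// ler_weXn2l// leq_addl.
Qed.

Lemma polygrowthZ a g : polygrowth g -> polygrowth (fun x => a * g x).
Proof.
move=> [c [k [c0 Hg]]]; exists (`|a| * c), k; split=> [|x]; first exact: mulr_ge0.
by rewrite normrM -mulrA ler_wpM2l.
Qed.

Lemma polygrowthB g h : polygrowth g -> polygrowth h -> polygrowth (fun x => g x - h x).
Proof.
move=> Hg /(polygrowthZ (-1)) Hh; have := polygrowthD Hg Hh.
by under eq_fun do rewrite mulN1r.
Qed.

Lemma polygrowth_horner (p : {poly R}) : polygrowth (horner p).
Proof.
have cst c : polygrowth (fun=> c).
  by exists `|c|, 0%N; split=> // x; rewrite mulr1.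
elim/poly_ind: p => [|p c [b [k [b0 Hp]]]].
  by rewrite horner0_ext; exact: cst.
have -> : horner (p * 'X + c%:P) = fun x => x * p.[x] + c.
  by apply/funext => x; rewrite !hornerE mulrC.
apply: polygrowthD => //; exists b, k.+1; split=> // x.
rewrite normrM exprS mulrCA; apply: ler_pM => //; first by rewrite lerDr.
Qed.

(** The exponent produced is even, which removes the absolute value and makes the bound a
    polynomial, and positive, as [mean_cvg] and [cov_cvg] require. *)
Lemma polygrowth_even g : polygrowth g -> exists (c : R) (k : nat),
  [/\ 0 <= c, (0 < k)%N & forall x, `|g x| <= c * (1 + x ^+ k)].
Proof.
move=> [c [k [c0 Hg]]].
exists (c * 2 ^+ (k.+1 * 2)), (k.+1 * 2)%N; split=> // [|x].
  by rewrite mulr_ge0// exprn_ge0.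
apply: le_trans (Hg x) _; rewrite -mulrA ler_wpM2l//.
have -> : x ^+ (k.+1 * 2) = `|x| ^+ (k.+1 * 2).
  by rewrite mulnC !exprM real_normK ?num_real.
set y := `|x|; have y0 : 0 <= y by exact: normr_ge0.
have y1 : 1 <= 1 + y by rewrite lerDl.
apply: (@le_trans _ _ ((1 + y) ^+ (k.+1 * 2))).
  by rewrite ler_weXn2l// muln2 -addnn (leq_trans (leqnSn k))// leq_addr.
move: (k.+1 * 2)%N => n; have [yle|/ltW yge] := leP y 1.
  apply: (@le_trans _ _ (2 ^+ n)); first by rewrite lerXn2r ?nnegrE//; lra.
  by rewrite ler_peMr ?exprn_ge0// lerDl exprn_ge0.
apply: (@le_trans _ _ ((2 * y) ^+ n)); first by rewrite lerXn2r ?nnegrE//; lra.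
by rewrite exprMn ler_wpM2l ?exprn_ge0// lerDr.
Qed.

Lemma polygrowth_lipschitz h (D : R) :
  (forall x y, `|h x - h y| <= D * `|x - y|) -> polygrowth h.
Proof.
move=> H; exists (`|h 0| + `|D|), 1%N; split=> [|x]; first by rewrite addr_ge0.
have := H x 0; rewrite subr0 expr1 => H1.
have := ler_normD (h x - h 0) (h 0); rewrite subrK => H2.
have H3 : D * `|x| <= `|D| * `|x| by rewrite ler_wpM2r// ler_norm.
have := normr_ge0 (h 0); have := normr_ge0 D; have := normr_ge0 x; nra.
Qed.

Lemma cvgR_ge0 (u : nat -> R) (l : R) : (forall n, 0 <= u n) -> u n @[n --> \oo] --> l -> 0 <= l.
Proof.
move=> u0 ul; rewrite leNgt; apply/negP => l0.
have nl : 0 < - l by rewrite oppr_gt0.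
have [N /(_ N (leqnn N))] := cvgR_dist ul nl.
by rewrite ltr_norml; have := u0 N; lra.
Qed.

Lemma expRN_lipschitz (x y : R) : 0 <= x -> 0 <= y -> `|expR (- x) - expR (- y)| <= `|x - y|.
Proof.
have main (u v : R) : 0 <= u -> u <= v -> `|expR (- u) - expR (- v)| <= `|u - v|.
  move=> u0 uv; rewrite ger0_norm ?subr_ge0 ?ler_expR ?lerN2//.
  rewrite [`|u - v|]distrC ger0_norm ?subr_ge0//.
  have -> : expR (- u) - expR (- v) = expR (- u) * (1 - expR (- (v - u))).
    by rewrite mulrBr mulr1 -expRD; congr (_ - expR _); ring.
  have e1 := expR_ge1Dx (- (v - u)).
  have e2 : expR (- u) <= 1 by rewrite expR_le1 oppr_le0.
  have e3 := expR_gt0 (- u).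
  have e4 : expR (- (v - u)) <= 1 by rewrite expR_le1 oppr_le0 subr_ge0.
  apply: (@le_trans _ _ (1 * (1 - expR (- (v - u))))); last by lra.
  by rewrite ler_wpM2r ?subr_ge0.
move=> x0 y0; have [xy|/ltW yx] := leP x y; first exact: main.
by rewrite distrC [`|x - y|]distrC; exact: main.
Qed.

Lemma trig_lipschitz (a b x y : R) :
  `|(a * cos x + b * sin x) - (a * cos y + b * sin y)| <= (`|a| + `|b|) * `|x - y|.
Proof.
apply: (is_derive_lipschitz (is_derive_trig a b)) => z.
apply: le_trans (ler_normD _ _) _; rewrite !normrM normrN addrC.
by apply: lerD; rewrite ler_piMr// ler_norml ?cos_geN1 ?cos_le1 ?sin_geN1 ?sin_le1.
Qed.

End PolynomialGrowth.

(** * From polynomials to functions of class C^1 *)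

Section Transfer.
Context {R : realType} (d : nat -> measure_display) (T : forall N, measurableType (d N)).
Context (P : forall N, probability (T N) R) (lam : forall N, T N -> 'I_N -> R).
Local Notation tau N k := (lstat (@lam N) (fun x => x ^+ k)).
Local Notation Lf N g := (lstat (@lam N) g).
Hypothesis lam_int : forall N (s : seq nat), (P N).-integrable [set: T N]
  (EFin \o (fun w => \prod_(k <- s) tau N k w)).
Variable alpha2 : nat -> nat -> R.
Hypothesis mean_cvg : forall k, (0 < k)%N ->
  exists l : R, N%:R^-1 * mean (P N) (tau N k) @[N --> \oo] --> l.
Hypothesis cov_cvg : forall m n, (0 < m)%N -> (0 < n)%N ->
  mean (P N) (fun w => tau N m w * tau N n w) - mean (P N) (tau N m) * mean (P N) (tau N n)
    @[N --> \oo] --> alpha2 m n.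
Hypothesis cum_cvg : forall r (n : 'I_r -> nat), (3 <= r)%N -> (forall i, (0 < n i)%N) ->
  pcum (fun B : {set 'I_r} => mean (P N) (fun w => \prod_(i in B) tau N (n i) w))
    [set: 'I_r]%SET @[N --> \oo] --> (0 : R).
Variables (M K : R).
Hypothesis M0 : 0 < M.
Hypothesis K0 : 0 < K.
Hypothesis tail_cvg :
  N%:R ^+ 8 * fine (P N [set w | [exists k, M < `|@lam N w k|]]) @[N --> \oo] --> (0 : R).
Hypothesis var_bound : forall (h dh : R -> R) (D : R),
  (forall x : R, is_derive x 1 h (dh x)) -> continuous dh -> (forall x, `|dh x| <= D) ->
  forall N, mean (P N) (fun w => (Lf N h w - mean (P N) (Lf N h)) ^+ 2) <= K * D ^+ 2.

Lemma allmom_Lf N g : continuous g -> polygrowth g -> allmom (P N) (Lf N g).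
Proof.
move=> cg /polygrowth_even[c [k [_ _ H]]].
exact: (allmom_lstat (lam_int N) cg H).
Qed.

(** The second moment is the variance, which converges, plus the squared mean, and the mean is
    O(N). *)
Lemma tau_sqr_bound k : (0 < k)%N -> exists (C : R) N0, forall N, (N0 <= N)%N ->
  mean (P N) (fun w => tau N k w ^+ 2) <= C * N%:R ^+ 2.
Proof.
move=> k0; have [l Hl] := mean_cvg k0.
have [N1 H1] := cvgR_dist Hl ltr01.
have [N2 H2] := cvgR_dist (cov_cvg k0 k0) ltr01.
exists (`|alpha2 k k| + 1 + (`|l| + 1) ^+ 2), (maxn 1 (maxn N1 N2)) => N.
rewrite !geq_max => /and3P[N0 N1N N2N].
have NR : 1 <= N%:R :> R by rewrite ler1n.
have := H2 N N2N.
have -> : (fun w => tau N k w * tau N k w) = (fun w => tau N k w ^+ 2).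
  by apply/funext => w; rewrite expr2.
set m := mean (P N) (tau N k); set S := mean (P N) _; set n : R := N%:R in NR *.
have [r Hr ->] : exists2 r, `|r - l| < 1 & m = n * r.
  exists (n^-1 * m); first exact: H1.
  by rewrite mulrA divff ?mul1r// gt_eqF//; lra.
move=> HS.
have r1 : `|r| <= `|l| + 1.
  by have := ler_normD (r - l) l; rewrite subrK; lra.
have r2 : r ^+ 2 <= (`|l| + 1) ^+ 2.
  by rewrite -real_normK ?num_real// lerXn2r ?nnegrE// addr_ge0.
have S1 : S <= `|alpha2 k k| + 1 + n ^+ 2 * r ^+ 2.
  by move: HS; rewrite ltr_norml; have := ler_norm (alpha2 k k); nra.
apply: le_trans S1 _; rewrite mulrDl; apply: lerD; last first.
  by rewrite mulrC ler_wpM2r// sqr_ge0.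
by rewrite ler_peMr ?addr_ge0// expr_ge1// (le_trans ler01).
Qed.

(** The statistic vanishes unless some eigenvalue exceeds M in modulus. In general it is dominated
    by [W], a combination of N and one power sum, whose second moment is O(N^2). *)
Lemma tail_mean_cvg (u : R -> R) : continuous u -> polygrowth u ->
  (forall x, `|x| <= M -> u x = 0) ->
  mean (P N) (fun w => `|Lf N u w|) @[N --> \oo] --> (0 : R).
Proof.
move=> cu gu u0; have [c [k [c0 k0 Hu]]] := polygrowth_even gu.
have [C [N0 HC]] := tau_sqr_bound k0.
pose C' := c ^+ 2 * 2 * (1 + `|C|).
have C'0 : 0 <= C' by rewrite /C' !mulr_ge0 ?sqr_ge0// addr_ge0.
apply: cvgR_intro => e e0.
have [N1 HN1] := cvgR_dist tail_cvg e0.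
have [N2 HN2] : exists N : nat, C' / e < N%:R.
  exists (Num.bound (C' / e)); apply: archi_boundP; rewrite divr_ge0//; exact: ltW.
exists (maxn 1 (maxn N0 (maxn N1 N2))) => N.
rewrite !geq_max => /and4P[N_gt0 N0N N1N N2N].
have := HN1 N N1N; rewrite subr0.
set A := [set w | _]; set n : R := N%:R => HA.
have mA : measurable A by exact: (measurable_max_eigenvalue (lam_int N)).
have n1 : 1 <= n by rewrite /n ler1n.
have n0 : 0 < n by lra.
have PA0 : 0 <= fine (P N A) by exact: fine_ge0.
have aA : allmom (P N) (\1_A : T N -> R).
  apply: (@allmom_bounded _ _ _ (P N) 1) => [|w]; first exact: measurable_indic.
  by rewrite indicE; case: (_ \in _); rewrite ?normr1 ?normr0.
have meanA : mean (P N) (\1_A : T N -> R) = fine (P N A).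
  by rewrite /mean /Rintegral integral_indic// setIT.
pose W w := c * (n + tau N k w).
have aW : allmom (P N) W.
  by apply: allmomZ; apply: allmomD; [exact: allmom_cst|exact: (allmom_power (lam_int N))].
have aW2 := allmomX 2 aW.
have LuW w : `|Lf N u w| <= W w.
  apply: le_trans (lstat_norm_le (@lam N) Hu w) _.
  by rewrite /lstat -mulr_sumr big_split /= sumr_const card_ord.
(* AM-GM with the weight N^3, for which both N^3 P(A) and N^-3 E(W^2) = O(1/N)
   tend to 0. *)
have pw w : `|Lf N u w| <= n ^+ 3 / 2 * (\1_A w) + (n ^+ 3)^-1 / 2 * W w ^+ 2.
  have n3 : 0 < n ^+ 3 by rewrite exprn_gt0.
  have W20 : 0 <= (n ^+ 3)^-1 / 2 * W w ^+ 2.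
    by rewrite mulr_ge0 ?sqr_ge0// divr_ge0// invr_ge0 ltW.
  rewrite indicE; have [wA|wA] := boolP (w \in A); last first.
    rewrite mulr0 add0r /lstat big1 ?normr0// => i _; apply: u0.
    move: wA; rewrite notin_setE /A /= => H; rewrite leNgt; apply/negP => Mi.
    by apply: H; apply/existsP; exists i.
  rewrite mulr1; apply: le_trans (LuW w) _.
  have : 0 <= (n ^+ 3)^-1 / 2 * (n ^+ 3 - W w) ^+ 2.
    by rewrite mulr_ge0 ?sqr_ge0// divr_ge0// invr_ge0 ltW.
  have -> : (n ^+ 3)^-1 / 2 * (n ^+ 3 - W w) ^+ 2 =
     n ^+ 3 / 2 - W w + (n ^+ 3)^-1 / 2 * W w ^+ 2.
    by move: (n ^+ 3) n3 => z z0; field; rewrite gt_eqF.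
  lra.
have aLu := allmom_Lf N cu gu.
have W2le : mean (P N) (fun w => W w ^+ 2) <= C' * n ^+ 2.
  have aT2 : allmom (P N) (fun w => tau N k w ^+ 2).
    by apply: allmomX; exact: (allmom_power (lam_int N)).
  apply: (@le_trans _ _ (mean (P N) (fun w => c ^+ 2 * 2 * (n ^+ 2 + tau N k w ^+ 2)))).
    apply: le_mean => //.
      by apply: allmomZ; apply: allmomD => //; exact: allmom_cst.
    move=> w; rewrite /W exprMn -mulrA ler_wpM2l ?sqr_ge0//.
    have := sqr_ge0 (n - tau N k w); nra.
  rewrite meanZ; last by apply: allmomD => //; exact: allmom_cst.
  rewrite meanD ?mean_cst//; last exact: allmom_cst.
  have -> : C' * n ^+ 2 = c ^+ 2 * 2 * (n ^+ 2 + `|C| * n ^+ 2) by rewrite /C'; ring.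
  apply: ler_wpM2l; first by rewrite mulr_ge0// sqr_ge0.
  rewrite lerD2l.
  apply: le_trans (HC N N0N) _; rewrite ler_wpM2r ?sqr_ge0//; exact: ler_norm.
rewrite subr0 ger0_norm; last by apply: mean_ge0.
have aR1 : allmom (P N) (fun w => n ^+ 3 / 2 * (\1_A w)) by exact: allmomZ.
have aR2 : allmom (P N) (fun w => (n ^+ 3)^-1 / 2 * W w ^+ 2) by exact: allmomZ.
apply: le_trans (le_mean (allmom_norm aLu) (allmomD aR1 aR2) pw) _.
rewrite meanD// !meanZ// meanA.
have B1 : n ^+ 3 / 2 * fine (P N A) <= e / 2.
  have : n ^+ 3 * fine (P N A) <= e.
    apply: (@le_trans _ _ (n ^+ 8 * fine (P N A))).
      by rewrite ler_wpM2r// ler_weXn2l.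
    by apply: le_trans (ler_norm _) _; exact: ltW.
  lra.
have B2 : (n ^+ 3)^-1 / 2 * mean (P N) (fun w => W w ^+ 2) <= e / 2.
  apply: (@le_trans _ _ ((n ^+ 3)^-1 / 2 * (C' * n ^+ 2))).
    by rewrite ler_wpM2l// divr_ge0// invr_ge0 exprn_ge0// ltW.
  have -> : (n ^+ 3)^-1 / 2 * (C' * n ^+ 2) = C' / n / 2 by field; rewrite gt_eqF.
  rewrite ler_wpM2r// ler_pdivrMr// mulrC -ler_pdivrMr//.
  by apply: le_trans (ltW HN2) _; rewrite /n ler_nat.
lra.
Qed.

(** The extension [h] of [g] has derivative at most [e] everywhere, so the variance bound controls
    it; [u = g - h] vanishes on [-M, M] and falls under [tail_mean_cvg]. *)
Lemma centred_stat_bound (g dg : R -> R) (e eta : R) : (forall x : R, is_derive x 1 g (dg x)) ->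
  continuous dg -> polygrowth g -> (forall x, `|x| <= M -> `|dg x| <= e) -> 0 < eta ->
  exists N0, forall N, (N0 <= N)%N ->
    mean (P N) (fun w => `|Lf N g w - mean (P N) (Lf N g)|) <= Num.sqrt K * e + eta.
Proof.
move=> Dg cdg gg dge eta0.
have e0 : 0 <= e by apply: le_trans (normr_ge0 (dg 0)) (dge 0 _); rewrite normr0 ltW.
have [h [dh [Dh cdh hg dhE]]] := C1_extension M0 Dg cdg.
have dhe x : `|dh x| <= e by have [y yM ->] := dhE x; exact: dge.
have gh : polygrowth h by exact: polygrowth_lipschitz (is_derive_lipschitz Dh dhe).
have cg := is_derive_continuous Dg; have ch := is_derive_continuous Dh.
pose u x := g x - h x.
have cu : continuous u by move=> x; apply: cvgB; [exact: cg|exact: ch].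
have gu : polygrowth u by exact: polygrowthB.
have u0 x : `|x| <= M -> u x = 0 by move=> xM; rewrite /u hg// subrr.
(* Half, because centring makes E|Lf N u| count twice. *)
have eta2 : 0 < eta / 2 by rewrite divr_gt0.
have [N0 HN0] := cvgR_dist (tail_mean_cvg cu gu u0) eta2.
exists N0 => N /HN0; rewrite subr0.
have au := allmom_Lf N cu gu; have ah := allmom_Lf N ch gh.
have mu0 : 0 <= mean (P N) (fun w => `|Lf N u w|) by exact: mean_ge0.
rewrite ger0_norm// => Hu.
have gE : g = fun x => u x + h x by apply/funext => x; rewrite /u subrK.
have LgE w : Lf N g w = Lf N u w + Lf N h w.
  rewrite gE; have := lstat_affine (@lam N) 1 u h; under eq_fun do rewrite mul1r.
  by move=> ->; rewrite mul1r.
have meanE : mean (P N) (Lf N g) = mean (P N) (Lf N u) + mean (P N) (Lf N h).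
  by rewrite -meanD//; congr mean; apply/funext.
set mu := mean (P N) (Lf N u) in meanE; set mh := mean (P N) (Lf N h) in meanE.
have ach : allmom (P N) (fun w => Lf N h w - mh) by apply: allmomB => //; exact: allmom_cst.
have achn := allmom_norm ach; have aun := allmom_norm au.
have acs := allmom_cst (P N) `|mu|.
apply: (@le_trans _ _ (mean (P N) (fun w => (`|Lf N u w| + `|mu|) + `|Lf N h w - mh|))).
  apply: le_mean.
  - apply: allmom_norm; apply: allmomB; last exact: allmom_cst.
    exact: allmom_Lf.
  - by apply: allmomD => //; exact: allmomD.
  - move=> w; rewrite LgE meanE.
    have -> : Lf N u w + Lf N h w - (mu + mh) = (Lf N u w - mu) + (Lf N h w - mh) by ring.
    apply: le_trans (ler_normD _ _) _; rewrite lerD2r; exact: ler_normB.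
rewrite meanD//; last exact: allmomD.
rewrite meanD// mean_cst.
have mule : `|mu| <= mean (P N) (fun w => `|Lf N u w|).
  by apply: le_norm_mean.
have vb : mean (P N) (fun w => `|Lf N h w - mh|) <= Num.sqrt K * e.
  apply: le_trans (mean_norm_le ach) _.
  rewrite -[e]ger0_norm// -sqrtr_sqr -sqrtrM; last exact: ltW.
  rewrite ler_sqrt; first exact: var_bound Dh cdh dhe N.
  by rewrite mulr_ge0 ?sqr_ge0//; exact: ltW.
lra.
Qed.

Section OneFunction.
Variables (g dg : R -> R) (s : R).
Hypothesis Dg : forall x : R, is_derive x 1 g (dg x).
Hypothesis cdg : continuous dg.
Hypothesis gg : polygrowth g.
(** The same polynomial has to serve the statistic, through the derivative, and the limit law,
    through the variance. *)
Hypothesis approx : forall e : R, 0 < e -> exists q : {poly R},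
  (forall x, `|x| <= M -> `|dg x - (('X * q)^`()).[x]| <= e) /\
  `|poly_var alpha2 q - s| <= e.

Let Y N (w : T N) : R := Lf N g w - mean (P N) (Lf N g).

(** A limit of variances. *)
Lemma poly_var_ge0 q : 0 <= poly_var alpha2 q.
Proof.
apply: (cvgR_ge0 _ (pstat_var_cvg lam_int cov_cvg (q := q))) => N.
set Z := lstat _ _; have aZ : allmom (P N) Z by exact: (allmom_pstat lam_int).
have aZ2 := allmomX 2 aZ; set m := mean (P N) Z.
have : 0 <= mean (P N) (fun w => Z w ^+ 2 + ((- (2 * m)) * Z w + m ^+ 2)).
  by apply: mean_ge0 => w; have := sqr_ge0 (Z w - m); nra.
have aZm := allmomZ (- (2 * m)) aZ; have ac := allmom_cst (P N) (m ^+ 2).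
rewrite meanD//; last exact: allmomD.
by rewrite meanD// mean_cst meanZ// -/m; nra.
Qed.

(** Otherwise the accuracy [- s / 2] would make some [poly_var] negative. *)
Lemma limit_var_ge0 : 0 <= s.
Proof.
rewrite leNgt; apply/negP => s0; have ns : 0 < - s / 2 by rewrite divr_gt0// oppr_gt0.
have [q [_]] := approx ns; have := poly_var_ge0 q.
rewrite ler_norml; lra.
Qed.

Lemma continuous_g : continuous g.
Proof. exact: is_derive_continuous Dg. Qed.

Lemma allmom_Y N : allmom (P N) (@Y N).
Proof.
by apply: allmomB; [exact: allmom_Lf continuous_g gg|exact: allmom_cst].
Qed.

Lemma trig_cvg_Y (a b t : R) :
  mean (P N) (fun w => a * cos (t * Y w) + b * sin (t * Y w)) @[N --> \oo] -->
    a * expR (- (t ^+ 2 * s / 2)).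
Proof.
have s0 := limit_var_ge0.
apply: cvgR_approx => e e0.
pose c1 := `|a| * t ^+ 2; pose c2 := (`|a| + `|b|) * `|t|.
have c10 : 0 <= c1 by rewrite mulr_ge0 ?sqr_ge0.
have c20 : 0 <= c2 by rewrite mulr_ge0 ?addr_ge0.
have sK : 0 <= Num.sqrt K by exact: sqrtr_ge0.
(* [c1] weighs the error in the limit variance, [c2] the L^1 error [(Num.sqrt K + 1) * e'] of the
   statistics; the summand 1 keeps the divisor positive. *)
pose c3 := 1 + c1 + c2 * (Num.sqrt K + 1).
have c2K : 0 <= c2 * (Num.sqrt K + 1) by rewrite mulr_ge0// addr_ge0.
have c30 : 0 < c3 by rewrite /c3; lra.
pose e' := e / c3; have e'0 : 0 < e' by rewrite divr_gt0.
have c3e : c3 * e' = e by rewrite /e' mulrC divfK// gt_eqF.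
have [q [Hq Hs]] := approx e'0; have q0 := poly_var_ge0 q.
pose Z N (w : T N) := lstat (@lam N) (horner ('X * q)) w.
pose Yq N (w : T N) := Z N w - mean (P N) (Z N).
have aZ N : allmom (P N) (Z N) by exact: (allmom_pstat lam_int).
have aYq N : allmom (P N) (Yq N) by apply: allmomB => //; exact: allmom_cst.
exists (fun N => mean (P N) (fun w => a * cos (t * Yq N w) + b * sin (t * Yq N w))).
exists (a * expR (- (t ^+ 2 * poly_var alpha2 q / 2))); split; [|split].
- apply: moments_trig => // n.
  exact: (pstat_central_moments lam_int cov_cvg cum_cvg).
- rewrite -mulrBr normrM.
  apply: (@le_trans _ _ (`|a| * (t ^+ 2 * e'))).
    rewrite ler_wpM2l//; apply: le_trans (expRN_lipschitz _ _) _.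
    + by rewrite divr_ge0// mulr_ge0// sqr_ge0.
    + by rewrite divr_ge0// mulr_ge0// sqr_ge0.
    have -> : t ^+ 2 * poly_var alpha2 q / 2 - t ^+ 2 * s / 2 =
      t ^+ 2 * ((poly_var alpha2 q - s) / 2) by ring.
    rewrite normrM (ger0_norm (sqr_ge0 t)) ler_wpM2l ?sqr_ge0//.
    by move: Hs; rewrite !ler_norml; lra.
  rewrite mulrA -/c1 -[leRHS]c3e ler_wpM2r ?ltW// /c3; lra.
- pose v x := g x - ('X * q).[x].
  have Dv (x : R) : is_derive x 1 v (dg x - (('X * q)^`()).[x]).
    have := is_derive_lin 1 (-1) (Dg x) (is_derive_horner ('X * q) x).
    rewrite mul1r mulN1r; congr (is_derive _ _ _ _); apply/funext => y.
    by rewrite mul1r mulN1r.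
  have cdv : continuous (fun x => dg x - (('X * q)^`()).[x]).
    by move=> x; apply: cvgB; [exact: cdg|exact: continuous_horner].
  have gv : polygrowth v by apply: polygrowthB => //; exact: polygrowth_horner.
  have [N0 HN0] := centred_stat_bound Dv cdv gv Hq e'0.
  exists N0 => N /HN0 HN.
  have aY := allmom_Y N.
  have cv := is_derive_continuous Dv.
  have av := allmom_Lf N cv gv.
  have ag := allmom_Lf N continuous_g gg.
  have LvE w : Lf N v w = Lf N g w - Z N w by rewrite /v lstatB.
  have mE : mean (P N) (Lf N v) = mean (P N) (Lf N g) - mean (P N) (Z N).
    by rewrite -meanB//; congr mean; apply/funext.
  have aD : allmom (P N) (fun w => `|Lf N v w - mean (P N) (Lf N v)|).
    by apply: allmom_norm; apply: allmomB => //; exact: allmom_cst.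
  have tY := allmom_trig (P N) a b t aY.1; have tq := allmom_trig (P N) a b t (aYq N).1.
  rewrite -meanB//.
  apply: (@le_trans _ _ (mean (P N) (fun w => c2 * `|Lf N v w - mean (P N) (Lf N v)|))).
    apply: le_norm_mean; [exact: allmomB|exact: allmomZ|move=> w].
    apply: le_trans (trig_lipschitz _ _ _ _) _.
    rewrite -mulrBr normrM mulrA LvE mE /Y /Yq.
    by rewrite (_ : _ - _ - (Z N w - _) = Lf N g w - Z N w -
      (mean (P N) (Lf N g) - mean (P N) (Z N))) //; ring.
  rewrite meanZ//; apply: (@le_trans _ _ (c2 * (Num.sqrt K * e' + e'))).
    by rewrite ler_wpM2l.
  have -> : c2 * (Num.sqrt K * e' + e') = c2 * (Num.sqrt K + 1) * e' by ring.
  rewrite -[leRHS]c3e ler_wpM2r ?ltW// /c3; lra.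
Qed.

Lemma stat_weak_cvg : cvg_in_distribution P Y (gaussian 0 s).
Proof.
split=> [N|phi cphi [C HC]]; first exact: (allmom_Y N).1.
have [Q [-> [aQ mQ]]] := gaussian_moments limit_var_ge0.
have mphi : measurable_fun [set: measurableTypeR R] phi by exact: continuous_measurable_fun.
have aphi N : allmom (P N) (fun w => phi (Y w)).
  apply: (@allmom_bounded _ _ _ (P N) C) => [|w]; last exact: HC.
  exact: measurableT_comp (allmom_Y N).1.
have aphiQ : allmom Q phi by exact: (@allmom_bounded _ _ _ Q C).
have tQ (a b t : R) : mean Q (fun x => a * cos (t * x) + b * sin (t * x)) =
    a * expR (- (t ^+ 2 * s / 2)).
  (* The trigonometric means of the Gaussian law come from the moment method itself, applied to the
     constant sequence [Q]. *)
  have H := @moments_trig R (fun=> _) (fun=> measurableTypeR R) (fun=> Q)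
    (fun _ x => x) s a b t (fun=> aQ) _.
  have {}H := H (fun n => cvgR_const (fun=> mQ n)).
  exact: (cvg_unique _ (cvg_cst _) H).
have [F F0 HF] := continuous_seg_bounded M0 cdg.
(* The bound on E|Y| for large N, which [trig_weak_cvg] requires. *)
have HB := centred_stat_bound Dg cdg gg HF ltr01.
have H : mean (P N) (fun w => phi (Y w)) @[N --> \oo] --> mean Q phi.
  apply: (trig_weak_cvg allmom_Y aQ _ HB cphi HC) => a b t.
  by rewrite tQ; exact: trig_cvg_Y.
have -> : (\int[Q]_x (phi x)%:E)%E = (mean Q phi)%:E by rewrite -meanE// unlock.
have -> : (fun N => 'E_(P N)[fun w => phi (Y w)])%E =
    (fun N => (mean (P N) (fun w => phi (Y w)))%:E) by apply/funext => N; rewrite meanE.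
by apply: cvg_EFin => //; exact: nearW.
Qed.

End OneFunction.
End Transfer.

(** * Passage between complex and real notions *)

Section ComplexTranslation.
Context {R : realType}.
Local Notation normc := ComplexField.Normc.normc.

Lemma normc_real (x : R) : normc x%:C = `|x|.
Proof. by rewrite /normc /= expr0n addr0 sqrtr_sqr. Qed.

Lemma Re_le_normc (z : R[i]) : `|Re z| <= normc z.
Proof.
case: z => a b /=; rewrite /normc -sqrtr_sqr ler_sqrt ?addr_ge0 ?sqr_ge0//.
by rewrite lerDl sqr_ge0.
Qed.

Lemma Im_le_normc (z : R[i]) : `|Im z| <= normc z.
Proof.
case: z => a b /=; rewrite /normc -sqrtr_sqr ler_sqrt ?addr_ge0 ?sqr_ge0//.
by rewrite lerDr sqr_ge0.
Qed.

Lemma normc_ge0 (z : R[i]) : 0 <= normc z.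
Proof. exact: le_trans (normr_ge0 _) (Re_le_normc z). Qed.

Lemma ccvg_normc (u : nat -> R[i]) (l : R[i]) : ccvg u l ->
  normc (u n - l) @[n --> \oo] --> (0 : R).
Proof.
move=> ul; apply: cvgR_intro => e e0.
have ec : 0 < e%:C by rewrite ltcR.
have /cvgrPdist_lt /(_ _ ec)[N _ HN] := ul.
exists N => n Nn; rewrite subr0 ger0_norm ?normc_ge0//.
have := HN n Nn; rewrite /= distrC normc_def ltcR => /ltW.
by case: (u n - l).
Qed.

Lemma ccvg_Re (u : nat -> R[i]) (l : R[i]) : ccvg u l -> Re (u n) @[n --> \oo] --> Re l.
Proof.
move=> /ccvg_normc ul; apply: cvgR_intro => e /(cvgR_dist ul)[N HN].
exists N => n /HN; rewrite subr0 (ger0_norm (normc_ge0 _)) => /ltW; apply: le_trans.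
by have := Re_le_normc (u n - l); case: (u n) (l) => [a b] [a' b'].
Qed.

Lemma ccvg_Im (u : nat -> R[i]) (l : R[i]) : ccvg u l -> Im (u n) @[n --> \oo] --> Im l.
Proof.
move=> /ccvg_normc ul; apply: cvgR_intro => e /(cvgR_dist ul)[N HN].
exists N => n /HN; rewrite subr0 (ger0_norm (normc_ge0 _)) => /ltW; apply: le_trans.
by have := Im_le_normc (u n - l); case: (u n) (l) => [a b] [a' b'].
Qed.

Lemma cexpectation_real (d : measure_display) (T : measurableType d) (P : probability T R)
    (Z : T -> R) : cexpectation P (fun w => (Z w)%:C) = (mean P Z)%:C.
Proof.
rewrite /cexpectation /=; congr (_ +i* _); first by rewrite unlock.
by rewrite unlock integral0_eq.
Qed.

Lemma is_C1_real (u du : R -> R) : (forall x : R, is_derive x 1 u (du x)) ->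
  continuous du -> is_C1 (fun x => (u x)%:C).
Proof.
move=> Du cdu; have dE x : derive1 u x = du x by rewrite derive1E; exact: derive_val.
split=> [x|x||] /=.
- exact: (@ex_derive _ _ _ _ _ _ _ (Du x)).
- exact: derivable_cst.
- by have -> : (fun x : R => derive1 (fun t => u t) x) = du by apply/funext.
- have -> : (fun x : R => derive1 (fun=> 0 : R) x) = (fun=> 0).
    by apply/funext => x; rewrite derive1_cst.
  exact: cst_continuous.
Qed.

Lemma normc_cderive_real (u du : R -> R) : (forall x : R, is_derive x 1 u (du x)) ->
  forall x, normc (cderive (fun x => (u x)%:C) x) = `|du x|.
Proof.
move=> Du x; rewrite /cderive /= derive1_cst -normc_real.
by congr (normc (_ +i* _)); rewrite derive1E; exact: derive_val.
Qed.

Lemma supnorm_real_le (D : set R) (u du : R -> R) (C : R) :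
  (forall x : R, is_derive x 1 u (du x)) -> (forall x, D x -> `|du x| <= C) ->
  (supnorm D (cderive (fun x => (u x)%:C)) <= C%:E)%E.
Proof.
move=> Du uC; apply: ge_ereal_sup => _ [x Dx <-].
by rewrite (normc_cderive_real Du) lee_fin; exact: uC.
Qed.

Lemma supnorm_ge0 (D : set R) (h : R -> R[i]) : D 0 -> (0 <= supnorm D h)%E.
Proof.
move=> D0; apply: (@le_trans _ _ (normc (h 0))%:E).
  by rewrite lee_fin normc_ge0.
by apply: ereal_sup_ubound; exists 0.
Qed.

Lemma trace_fun_real n (g : R -> R) (A : 'M[R[i]]_n) :
  trace_fun (fun x => (g x)%:C) A = (\sum_k g (ev A k))%:C.
Proof. by rewrite /trace_fun rmorph_sum. Qed.

End ComplexTranslation.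

(** * The covariance form on real functions *)

Section CovarianceForm.
Context {R : realType} (M K : R) (alpha2 : nat -> nat -> R[i]).
Context (rho : fun_on M -> fun_on M -> R[i]).
Hypothesis M0 : 0 < M.
Hypothesis K0 : 0 < K.
Hypothesis hrho : asymptotic_covariance K alpha2 rho.
Hypothesis alpha2_real : forall m n, (0 < m)%N -> (0 < n)%N -> Im (alpha2 m n) = 0.
Local Notation normc := ComplexField.Normc.normc.

Definition crestr (u : R -> R) : fun_on M := restr M (fun x => (u x)%:C).

Lemma C1_crestr (u du : R -> R) : (forall x : R, is_derive x 1 u (du x)) ->
  continuous du -> C1_on (crestr u).
Proof. by move=> Du cdu; exists (fun x => (u x)%:C) => //; exact: is_C1_real Du cdu. Qed.

Lemma crestr_affine (a : R) (u v : R -> R) :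
  crestr (fun x => a * u x + v x) = fun x => a%:C * crestr u x + crestr v x.
Proof. by apply/funext => x; rewrite /crestr /restr /sigL /= rmorphD rmorphM. Qed.

Lemma C1_poly (p : {poly R}) : C1_on (crestr (horner p)).
Proof.
apply: (C1_crestr (is_derive_horner p)); exact: continuous_horner.
Qed.

Let rhop (p q : {poly R}) := rho (crestr (horner p)) (crestr (horner q)).

Lemma rho_poly_linear a p q r :
  rhop (a *: p + q) r = a%:C * rhop p r + rhop q r /\
  rhop r (a *: p + q) = a%:C * rhop r p + rhop r q.
Proof.
have [H _ _ _] := hrho.
have := H a%:C _ _ _ (C1_poly p) (C1_poly q) (C1_poly r).
rewrite -crestr_affine /rhop (_ : horner (a *: p + q) = fun x => a * p.[x] + q.[x])//.
by apply/funext => x; rewrite !hornerE.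
Qed.

Lemma rho_poly_sum (n : nat) (c : 'I_n -> R) (p : 'I_n -> {poly R}) r :
  rhop (\sum_i c i *: p i) r = \sum_i (c i)%:C * rhop (p i) r /\
  rhop r (\sum_i c i *: p i) = \sum_i (c i)%:C * rhop r (p i).
Proof.
have z : rhop 0 r = 0 /\ rhop r 0 = 0.
  have := rho_poly_linear (-1) 0 0 r; rewrite scaler0 addr0 rmorphN1 !mulN1r !addNr.
  by case.
elim: n c p => [|n IH] c p; first by rewrite !big_ord0.
rewrite !big_ord_recl; have [-> ->] := rho_poly_linear (c ord0) (p ord0)
  (\sum_(i < n) c (lift ord0 i) *: p (lift ord0 i)) r.
by have [-> ->] := IH (fun i => c (lift ord0 i)) (fun i => p (lift ord0 i)).
Qed.

(** The factor X leaves only positive powers, for which [rho] is prescribed by [alpha2]. *)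
Lemma rho_poly_var (q : {poly R}) :
  rhop ('X * q) ('X * q) = (poly_var (fun m n => Re (alpha2 m n)) q)%:C.
Proof.
have E : 'X * q = \sum_(i < size q) q`_i *: 'X^(i.+1).
  rewrite -[in LHS](coefK q) poly_def mulr_sumr; apply: eq_bigr => i _.
  by rewrite -scalerAr exprS.
have mon m n : (0 < m)%N -> (0 < n)%N -> rhop 'X^m 'X^n = (Re (alpha2 m n))%:C.
  move=> m0 n0; have [_ H _ _] := hrho.
  have monE k : crestr (horner 'X^k) = restr M (fun x => x%:C ^+ k).
    by rewrite /crestr; congr restr; apply/funext => x; rewrite hornerXn rmorphXn.
  rewrite /rhop !monE H//; have := alpha2_real m0 n0.
  by case: (alpha2 m n) => a b /= ->.
rewrite {1}E; have [-> _] := rho_poly_sum (fun i : 'I_(size q) => q`_i)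
  (fun i => 'X^(i.+1)) ('X * q).
rewrite /poly_var rmorph_sum; apply: eq_bigr => i _ /=.
rewrite rmorphM rmorph_sum; congr (_ * _).
rewrite E; have [_ ->] := rho_poly_sum (fun i : 'I_(size q) => q`_i)
  (fun i => 'X^(i.+1)) 'X^(i.+1).
by apply: eq_bigr => j _; rewrite mon// rmorphM.
Qed.

Lemma rho_bound (u du v dv : R -> R) (C D : R) :
  (forall x : R, is_derive x 1 u (du x)) -> continuous du ->
  (forall x : R, is_derive x 1 v (dv x)) -> continuous dv ->
  (forall x, `|x| <= M -> `|du x| <= C) -> (forall x, `|x| <= M -> `|dv x| <= D) ->
  normc (rho (crestr u) (crestr v)) <= K * C * D.
Proof.
move=> Du cdu Dv cdv uC vD; have [_ _ _ H] := hrho.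
have segE x : seg M x -> `|x| <= M by rewrite /seg /= in_itv /= ler_norml.
have seg0 : seg M 0 by rewrite /seg /= in_itv /= oppr_le0 ltW.
rewrite -lee_fin; apply: le_trans (H _ _ (is_C1_real Du cdu) (is_C1_real Dv cdv)) _.
rewrite !EFinM; apply: lee_pmul.
- by apply: mule_ge0; [rewrite lee_fin ltW|exact: supnorm_ge0].
- exact: supnorm_ge0.
- apply: lee_pmul => //; first by rewrite lee_fin ltW.
    exact: supnorm_ge0.
  by apply: (supnorm_real_le Du) => x /segE; exact: uC.
- by apply: (supnorm_real_le Dv) => x /segE; exact: vD.
Qed.

Lemma rho_approx (g dg : R -> R) : (forall x : R, is_derive x 1 g (dg x)) ->
  continuous dg -> forall e, 0 < e -> exists q : {poly R},
  (forall x, `|x| <= M -> `|dg x - (('X * q)^`()).[x]| <= e) /\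
  normc (rho (crestr g) (crestr g) - (poly_var (fun m n => Re (alpha2 m n)) q)%:C) <= e.
Proof.
move=> Dg cdg e e0; have [F F0 HF] := continuous_seg_bounded M0 cdg.
(* The three error terms add up to [K * e' * (2 * F + 3 * e')], which is at most [c * e'] because
   [e' <= 1]. *)
pose c := K * (2 * F + 3); have c0 : 0 < c by rewrite mulr_gt0//; lra.
pose e' := Num.min 1 (Num.min e (e / c)).
have e'0 : 0 < e' by rewrite !lt_min ltr01 e0 divr_gt0.
have e'1 : e' <= 1 by rewrite ge_min lexx.
have e'e : e' <= e by rewrite !ge_min lexx orbT.
have e'c : c * e' <= e by rewrite mulrC -ler_pdivlMr// !ge_min lexx !orbT.
have [q Hq] := C1_poly_approx M0 e'0 cdg.
exists q; split=> [x xM|]; first exact: le_trans (Hq x xM) e'e.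
pose p := 'X * q; pose h x := g x - p.[x]; pose dh x := dg x - (p^`()).[x].
have Dh (x : R) : is_derive x 1 h (dh x).
  have := is_derive_lin 1 (-1) (Dg x) (is_derive_horner p x).
  rewrite mul1r mulN1r; congr (is_derive _ _ _ _); apply/funext => y.
  by rewrite mul1r mulN1r.
have cdh : continuous dh.
  by move=> x; apply: cvgB; [exact: cdg|exact: continuous_horner].
have Dp (x : R) := is_derive_horner p x.
have cdp : continuous (horner (p^`())) by exact: continuous_horner.
have Hp x : `|x| <= M -> `|(p^`()).[x]| <= F + e'.
  move=> xM; have := HF x xM; have := Hq x xM.
  have := ler_normB (dg x) (dg x - (p^`()).[x]); rewrite opprB addrC subrK; lra.
have [H _ _ _] := hrho.
have gE : crestr g = fun x => 1 * crestr (horner p) x + crestr h x.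
  rewrite -[1 in RHS](rmorph1 (real_complex R)) -crestr_affine; congr crestr.
  by apply/funext => x; rewrite /h mul1r addrC subrK.
have C1p := C1_poly p; have C1h := C1_crestr Dh cdh; have C1g := C1_crestr Dg cdg.
rewrite -rho_poly_var -/p /rhop.
(* Bilinear expansion along g = p + h. The two mixed terms stay apart, since [rho] is not assumed
   symmetric; each remaining term contains [h] and is small. *)
have -> : rho (crestr g) (crestr g) - rho (crestr (horner p)) (crestr (horner p)) =
   rho (crestr (horner p)) (crestr h) + (rho (crestr h) (crestr (horner p)) +
   rho (crestr h) (crestr h)).
  rewrite [X in rho X _]gE (H 1 _ _ _ C1p C1h C1g).1 mul1r.
  rewrite gE (H 1 _ _ _ C1p C1h C1p).2 (H 1 _ _ _ C1p C1h C1h).2 !mul1r.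
  by rewrite addrAC [X in X - _]addrC addrK addrC.
have B1 := rho_bound Dp cdp Dh cdh Hp Hq.
have B2 := rho_bound Dh cdh Dp cdp Hq Hp.
have B3 := rho_bound Dh cdh Dh cdh Hq Hq.
apply: le_trans (le_normcD _ _) _.
have := le_normcD (rho (crestr h) (crestr (horner p))) (rho (crestr h) (crestr h)).
have : K * (F + e') * e' + K * e' * (F + e') + K * e' * e' <= c * e'.
  have -> : K * (F + e') * e' + K * e' * (F + e') + K * e' * e' = K * e' * (2 * F + 3 * e') by ring.
  have -> : c * e' = K * e' * (2 * F + 3) by rewrite /c; ring.
  apply: ler_wpM2l; last by lra.
  by rewrite mulr_ge0// ltW.
lra.
Qed.

End CovarianceForm.

(** * Reduction of the matrix statement to linear statistics of eigenvalues *)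

Theorem proposition12 (R : realType)
    (d : nat -> measure_display) (T : forall N, measurableType (d N))
    (P : forall N, probability (T N) R)
    (X : forall N, T N -> 'M[R[i]]_N)
    (alpha1 : nat -> R[i]) (alpha2 : nat -> nat -> R[i]) (M K : R)
    (rho : fun_on M -> fun_on M -> R[i])
    (hX : self_adjoint_ensemble P X)
    (hlim : second_order_limit P X alpha1 alpha2)
    (hM : 0 < M) (hK : 0 < K)
    (htail : norm_tail_bound P X M)
    (hvar : variance_bound P X K)
    (hrho : asymptotic_covariance K alpha2 rho)
    (f : R -> R[i]) (hfC1 : is_C1 f) (hfpb : polynomially_bounded f)
    (hfreal : forall x, Im (f x) = 0) :
  0 <= rho (restr M f) (restr M f) /\
  cvg_in_distribution P
    (fun N w => Re (trace_fun f (X N w) -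
       cexpectation (P N) (fun w' => trace_fun f (X N w'))))
    (gaussian 0 (Re (rho (restr M f) (restr M f)))).
Proof.
pose lam N (w : T N) := ev (X N w).
pose tau N k := lstat (@lam N) (fun x => x ^+ k).
have [hXm hXh hXi] := hX; have [hl1 hl2 hl3] := hlim.
have tauE N k w : trace_pow k (X N w) = (tau N k w)%:C by exact: trace_powE.
have lam_int N (s : seq nat) : (P N).-integrable [set: T N]
    (EFin \o (fun w => \prod_(k <- s) lstat (@lam N) (fun x => x ^+ k) w)).
  have [H _] := hXi N s; move: H; congr (_.-integrable _ _).
  apply/funext => w /=; congr (_%:E).
  by under eq_bigr do rewrite tauE; rewrite -rmorph_prod.
have expE N (F : T N -> R[i]) (Z : T N -> R) : (forall w, F w = (Z w)%:C) ->
    cexpectation (P N) F = (mean (P N) Z)%:C.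
  by move=> /funext ->; exact: cexpectation_real.
have mean_cvg k : (0 < k)%N -> exists l : R,
    N%:R^-1 * mean (P N) (lstat (@lam N) (fun x => x ^+ k)) @[N --> \oo] --> l.
  move=> k0; exists (Re (alpha1 k)).
  have E N : N%:R^-1 * mean (P N) (lstat (@lam N) (fun x => x ^+ k)) =
      Re (N%:R^-1 * cexpectation (P N) (fun w => trace_pow k (X N w))).
    by rewrite (expE _ _ _ (tauE N k)) -(rmorph_nat (real_complex R)) -fmorphV -rmorphM.
  by rewrite (funext E); exact/ccvg_Re/hl1.
pose alphaR m n := Re (alpha2 m n).
have covE N m n : ccovariance (P N) (fun w => trace_pow m (X N w)) (fun w => trace_pow n (X N w)) =
    (mean (P N) (fun w => tau N m w * tau N n w) -
     mean (P N) (tau N m) * mean (P N) (tau N n))%:C.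
  rewrite /ccovariance (expE _ _ _ (tauE N m)) (expE _ _ _ (tauE N n)).
  rewrite (expE _ _ (fun w => tau N m w * tau N n w)) => [|w].
    by rewrite rmorphB rmorphM.
  by rewrite !tauE rmorphM.
have cov_cvg m n : (0 < m)%N -> (0 < n)%N ->
    mean (P N) (fun w => lstat (@lam N) (fun x => x ^+ m) w * lstat (@lam N) (fun x => x ^+ n) w) -
    mean (P N) (lstat (@lam N) (fun x => x ^+ m)) * mean (P N) (lstat (@lam N) (fun x => x ^+ n))
      @[N --> \oo] --> alphaR m n.
  move=> m0 n0; have := ccvg_Re (hl2 m n m0 n0).
  by rewrite (funext (fun N => congr1 (@Re R) (covE N m n))).
(* Traces of powers of self-adjoint matrices are real, hence so are their covariances and the
   limits. *)
have alpha2_real m n : (0 < m)%N -> (0 < n)%N -> Im (alpha2 m n) = 0.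
  move=> m0 n0; have := ccvg_Im (hl2 m n m0 n0).
  rewrite (funext (fun N => congr1 (@Im R) (covE N m n))) /= => H.
  exact: (cvg_unique _ H (cvg_cst _)).
have cum_cvg r (n : 'I_r -> nat) : (3 <= r)%N -> (forall i, (0 < n i)%N) ->
    pcum (fun B : {set 'I_r} => mean (P N)
      (fun w => \prod_(i in B) lstat (@lam N) (fun x => x ^+ n i) w))
      [set: 'I_r]%SET @[N --> \oo] --> (0 : R).
  move=> r3 n0; have := ccvg_Re (hl3 r n r3 n0).
  have E N : Re (ccumulant (P N) (fun i w => trace_pow (n i) (X N w))) =
      pcum (fun B : {set 'I_r} => mean (P N)
        (fun w => \prod_(i in B) tau N (n i) w)) [set: 'I_r]%SET.
    rewrite /ccumulant /pcum.
    under eq_bigr => p _.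
      under eq_bigr => B _.
        rewrite (expE _ _ (fun w => \prod_(i in B) tau N (n i) w)) => [|w].
          over.
        by under eq_bigr do rewrite tauE; rewrite rmorph_prod.
      rewrite -rmorph_prod -(rmorph_nat (real_complex R)) -(rmorphN1 (real_complex R)).
      rewrite -rmorphXn -!rmorphM; over.
    by rewrite -rmorph_sum.
  by rewrite (funext E).
have tailE N : [set w | M < opnorm (X N w)] = [set w : T N | [exists k, M < `|lam N w k|]].
  by apply/funext => w /=; rewrite opnorm_gtE// ltW.
have tail_cvg : N%:R ^+ 8 * fine (P N [set w | [exists k, M < `|lam N w k|]])
    @[N --> \oo] --> (0 : R).
  have mA N := measurable_max_eigenvalue (lam_int N) M.
  have E N : N%:R ^+ 8 * fine (P N [set w | [exists k, M < `|lam N w k|]]) =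
      fine ((N%:R ^+ 8)%:E * P N [set w | (M < opnorm (X N w))%R])%E.
    by rewrite tailE fineM// fin_num_measure.
  by rewrite (funext E); apply: fine_cvg; exact: htail.
have var_bound (h dh : R -> R) (D : R) : (forall x : R, is_derive x 1 h (dh x)) ->
    continuous dh -> (forall x, `|dh x| <= D) -> forall N,
    mean (P N) (fun w => (lstat (@lam N) h w - mean (P N) (lstat (@lam N) h)) ^+ 2) <= K * D ^+ 2.
  move=> Dh cdh dhD N.
  have D0 : 0 <= D by exact: le_trans (normr_ge0 _) (dhD 0).
  have ah : allmom (P N) (lstat (@lam N) h).
    apply: (allmom_Lf lam_int); first exact: is_derive_continuous Dh.
    exact: polygrowth_lipschitz (is_derive_lipschitz Dh dhD).
  set m := mean (P N) (lstat (@lam N) h).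
  have aZ : allmom (P N) (fun w => (lstat (@lam N) h w - m) ^+ 2).
    by apply: allmomX; apply: allmomB => //; exact: allmom_cst.
  rewrite -lee_fin -meanE//.
  have := hvar (fun x => (h x)%:C) N (is_C1_real Dh cdh).
  have trE w : trace_fun (fun x => (h x)%:C) (X N w) = (lstat (@lam N) h w)%:C.
    exact: trace_fun_real.
  rewrite /cvariance (expE _ _ _ trE).
  have -> : (fun w => ComplexField.Normc.normc (trace_fun (fun x => (h x)%:C) (X N w) - m%:C) ^+ 2) =
     (fun w => (lstat (@lam N) h w - m) ^+ 2).
    by apply/funext => w; rewrite trE -rmorphB normc_real real_normK ?num_real.
  move=> /le_trans; apply; rewrite EFinM.
  apply: lee_pmul => //; first by rewrite lee_fin ltW.
    by rewrite expe2 mule_ge0// supnorm_ge0.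
  have S0 := @supnorm_ge0 R [set: R] (cderive (fun x => (h x)%:C)) I.
  have SD := @supnorm_real_le R [set: R] h dh D Dh (fun x _ => dhD x).
  by rewrite expr2 EFinM expe2; apply: lee_pmul.
pose g x := Re (f x); pose dg := derive1 g.
have fE : f = fun x => (g x)%:C.
  by apply/funext => x; rewrite /g; have := hfreal x; case: (f x) => a b /= ->.
have [hd _ hc _] := hfC1.
have Dg (x : R) : is_derive x 1 g (dg x).
  by rewrite /dg derive1E; apply/derivableP; exact: hd.
have cdg : continuous dg by exact: hc.
have gg : polygrowth g.
  have [c [k Hk]] := hfpb; exists c, k; split=> [|x].
    have := Hk 0; rewrite normr0 addr0 expr1n mulr1; exact: le_trans (normc_ge0 _).
  exact: le_trans (Re_le_normc _) (Hk x).
pose r := rho (restr M f) (restr M f).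
have rE : r = rho (@crestr R M g) (@crestr R M g) by rewrite /r /crestr -fE.
have rho_appr := rho_approx hM hK hrho alpha2_real Dg cdg.
have approx (e : R) : 0 < e -> exists q : {poly R},
    (forall x, `|x| <= M -> `|dg x - (('X * q)^`()).[x]| <= e) /\
    `|poly_var alphaR q - Re r| <= e.
  move=> /rho_appr[q [Hq Hr]]; exists q; split=> //.
  rewrite distrC rE; apply: le_trans Hr; apply: le_trans (Re_le_normc _).
  by case: (rho _ _).
(* By [rho_approx], [r] lies within any [e] of a real number. *)
have r_im : Im r = 0.
  apply/eqP; rewrite -normr_le0; apply/ler_addgt0Pr => e /rho_appr[q [_ Hr]].
  rewrite add0r rE; apply: le_trans Hr; apply: le_trans (Im_le_normc _).
  by case: (rho _ _) => a b /=; rewrite subr0.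
split.
  (* In the order of [R[i]], [0 <= r] says that [r] is real and its real part nonnegative. *)
  rewrite -/r lecE r_im eqxx /=.
  exact: (limit_var_ge0 lam_int cov_cvg approx).
rewrite -/r.
have trE N w : trace_fun f (X N w) = (lstat (@lam N) g w)%:C.
  by rewrite fE; exact: trace_fun_real.
have YE : (fun N w => Re (trace_fun f (X N w) - cexpectation (P N) (fun w' => trace_fun f (X N w')))) =
   (fun N w => lstat (@lam N) g w - mean (P N) (lstat (@lam N) g)).
  apply: functional_extensionality_dep => N; apply/funext => w.
  by rewrite (expE _ _ _ (@trE N)) trE.
rewrite YE.
exact: (stat_weak_cvg lam_int mean_cvg cov_cvg cum_cvg hM hK tail_cvg var_bound Dg cdg gg approx).
Qed.
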